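(* Let $T>0$, $0<\alpha\le1$, $0<\lambda<R$, $\beta\in(0,1)$, $\gamma\in(0,\alpha)$. Let $v,\overline v\in B(R,\lambda,\alpha)$ and let $\Gamma_{[v]},\Gamma_{[\overline v]}$ be the fundamental solutions of $\mathcal{L}_{[v]}u=0$ and $\mathcal{L}_{[\overline v]}u=0$ given by the parametrix construction. Then, for all $(x,t),(\xi,\tau)\in\Omega_T=\mathbb{R}\times[0,T]$ with $t>\tau$, the following estimates hold, with positive constants $C<\frac1{4R}$ and $K=K(R,\lambda,\alpha,T)$: $$|(D_x^s\Gamma_{[v]}-D_x^s\Gamma_{[\overline v]})(x,t,\xi,\tau)|\le\frac{K\|v-\overline v\|_{\alpha,\frac\alpha2}}{(t-\tau)^{\frac{s+1}2}}e^{-C\frac{(x-\xi)^2}{t-\tau}},\qquad s=0,1;$$ $$|(\partial_{xx}\Gamma_{[v]}-\partial_{xx}\Gamma_{[\overline v]})(x,t,\xi,\tau)|\le K\big(\|v-\overline v\|_{\alpha,\frac\alpha2}+\|v-\overline v\|^\beta_{\alpha,\frac\alpha2}\big)\Big(\frac1{|x-\xi|^{1-(\alpha-\gamma(1-\beta))}(t-\tau)^{1-\frac{\gamma(1-\beta)}2}}+\frac1{(t-\tau)^{\frac32}}\Big)e^{-C\frac{(x-\xi)^2}{t-\tau}};$$ and $$|(\partial_t\Gamma_{[v]}-\partial_t\Gamma_{[\overline v]})(x,t,\xi,\tau)|\le K\big(\|v-\overline v\|_{\alpha,\frac\alpha2}+\|v-\overline v\|^\beta_{\alpha,\frac\alpha2}\big)\Big(\frac1{|x-\xi|^{1-(\alpha-\gamma(1-\beta))}(t-\tau)^{1-\frac{\gamma(1-\beta)}2}}+\frac1{(t-\tau)^{\frac32}}\Big)e^{-C\frac{(x-\xi)^2}{t-\tau}}$$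 (the right-hand sides of the last two estimates being read as $+\infty$ when $x=\xi$ and $v\neq\overline v$).
   Context: $\Omega_T=\mathbb{R}\times[0,T]$. For $\alpha\in(0,1]$, $C^{\alpha,\frac\alpha2}(\Omega_T)$ has norm $\|u\|_{\alpha,\frac\alpha2}=\sup_{\Omega_T}|u|+\sup_{(x,t)\ne(y,s)}\frac{|u(x,t)-u(y,s)|}{|x-y|^\alpha+|t-s|^{\alpha/2}}$. $B(R,\lambda,\alpha)$ is the set of $v=(a,b,c)$ with $a,b,c\in C^{\alpha,\frac\alpha2}(\Omega_T)$, $a\ge\lambda$, and $\|a\|_{\alpha,\frac\alpha2},\|b\|_{\alpha,\frac\alpha2},\|c\|_{\alpha,\frac\alpha2}<R$; the norm of a triple is $\|v\|_{\alpha,\frac\alpha2}=\max\{\|a\|_{\alpha,\frac\alpha2},\|b\|_{\alpha,\frac\alpha2},\|c\|_{\alpha,\frac\alpha2}\}$. For $v=(a,b,c)$, $$\mathcal{L}_{[v]}u=u_t-a(x,t)u_{xx}+b(x,t)u_x+c(x,t)u.$$ Parametrix construction: for $t>\tau$, $$Z_{[v]}(x,t,\xi,\tau)=\frac1{(4\pi a(\xi,\tau)(t-\tau))^{1/2}}e^{-\frac{(x-\xi)^2}{4a(\xi,\tau)(t-\tau)}},$$ $$(\mathcal{L}Z)_1(x,t,\xi,\tau)=(a(\xi,\tau)-a(x,t))\partial_x^2Z_{[v]}+b(x,t)\partial_xZ_{[v]}+c(x,t)Z_{[v]},$$ $$(\mathcal{L}Z)_{m+1}(x,t,\xi,\tau)=\int_\tau^t\int_{\mathbb{R}}(\mathcal{L}Z)_1(x,t,y,\sigma)(\mathcal{L}Z)_m(y,\sigma,\xi,\tau)\,dy\,d\sigma\quad(m\ge1),$$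 $$\phi_{[v]}=\sum_{m=1}^\infty(-1)^m(\mathcal{L}Z)_m,\qquad\Gamma_{[v]}(x,t,\xi,\tau)=Z_{[v]}(x,t,\xi,\tau)+\int_\tau^t\int_{\mathbb{R}}Z_{[v]}(x,t,y,\sigma)\phi_{[v]}(y,\sigma,\xi,\tau)\,dy\,d\sigma.$$ It is known that the series converges and $\Gamma_{[v]}$ is a fundamental solution of $\mathcal{L}_{[v]}u=0$. $D_x^s$ is the $s$-th derivative in $x$. The numbers $\beta,\gamma$ are fixed in advance. $C,K$ denote positive constants that may depend on $R,\lambda,\alpha,T$ but not on $v,\overline v$ or on the points; $K=K(\cdot)$ lists the parameters on which $K$ depends. *)

(* Defs.v *)
From mathcomp Require Export all_boot all_order all_algebra.
From mathcomp Require Export all_classical all_reals all_analysis.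
Export Order.TTheory GRing.Theory Num.Theory.
Export numFieldNormedType.Exports.

Set Implicit Arguments.
Unset Strict Implicit.
Unset Printing Implicit Defensive.

Global Open Scope classical_set_scope.
Global Open Scope ring_scope.

(* Functions on the strip R x [0, T] are represented by total functions
   R -> R -> R; their values at times outside [0, T] play no role as long as the
   points (x, t) and (xi, tau) are taken in the strip. *)
Definition strip (R : realType) (T : R) : set (R * R) := setT `*` `[0, T].

(* The norm takes values in \bar R: u lies in C^{alpha, alpha/2} iff
   holder_norm T alpha u < +oo. *)
Definition holder_norm (R : realType) (T alpha : R) (u : R -> R -> R) :
    \bar R :=
  (ereal_sup [set `|u p.1 p.2|%:E | p in strip T] +
   ereal_sup
     [set (`|u pq.1.1 pq.1.2 - u pq.2.1 pq.2.2| /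
           (`|pq.1.1 - pq.2.1| `^ alpha +
            `|pq.1.2 - pq.2.2| `^ (alpha / 2)))%:E
     | pq in [set pq : (R * R) * (R * R) |
               [/\ strip T pq.1, strip T pq.2 & pq.1 <> pq.2]]])%E.

Record coeffs (R : realType) := Coeffs {
  ca : R -> R -> R;
  cb : R -> R -> R;
  cc : R -> R -> R
}.

Definition coeffs_sub (R : realType) (v w : coeffs R) : coeffs R :=
  Coeffs (fun x t => ca v x t - ca w x t)
         (fun x t => cb v x t - cb w x t)
         (fun x t => cc v x t - cc w x t).

Definition coeffs_norm (R : realType) (T alpha : R) (v : coeffs R) : \bar R :=
  maxe (holder_norm T alpha (ca v))
    (maxe (holder_norm T alpha (cb v)) (holder_norm T alpha (cc v))).

(* The class B(rho, lambda, alpha); the finite bound rho on the norms contains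
   membership in C^{alpha, alpha/2}. *)
Definition admissible (R : realType) (T rho lambda alpha : R) :
    set (coeffs R) :=
  [set v | [/\ (holder_norm T alpha (ca v) < rho%:E)%E,
               (holder_norm T alpha (cb v) < rho%:E)%E,
               (holder_norm T alpha (cc v) < rho%:E)%E
             & forall x t, strip T (x, t) -> lambda <= ca v x t]].

Definition parametrixZ (R : realType) (v : coeffs R) (x t xi tau : R) : R :=
  (Num.sqrt (4 * pi * ca v xi tau * (t - tau)))^-1 *
  expR (- ((x - xi) ^+ 2 / (4 * ca v xi tau * (t - tau)))).

Definition LZ1 (R : realType) (v : coeffs R) (x t xi tau : R) : R :=
  (ca v xi tau - ca v x t) * derive1n 2 (fun z => parametrixZ v z t xi tau) x +
  cb v x t * derive1 (fun z => parametrixZ v z t xi tau) x +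
  cc v x t * parametrixZ v x t xi tau.

Definition spacetime_conv (R : realType) (F G : R -> R -> R -> R -> R)
    (x t xi tau : R) : R :=
  \int[@lebesgue_measure R]_(sigma in `]tau, t[)
    \int[@lebesgue_measure R]_(y in [set: R])
      (F x t y sigma * G y sigma xi tau).

(* Shifted index: LZ v m is (LZ)_{m+1}. *)
Fixpoint LZ (R : realType) (v : coeffs R) (m : nat) : R -> R -> R -> R -> R :=
  if m is m'.+1 then spacetime_conv (LZ1 v) (LZ v m') else LZ1 v.

Definition parametrix_phi (R : realType) (v : coeffs R) (x t xi tau : R) : R :=
  limn (series (fun m : nat => (-1) ^+ m.+1 * LZ v m x t xi tau)).

Definition Gamma (R : realType) (v : coeffs R) (x t xi tau : R) : R :=
  parametrixZ v x t xi tau +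
  spacetime_conv (parametrixZ v) (parametrix_phi v) x t xi tau.

(* Derivative relative to D: the usual one at interior points of D, and the
   one-sided one at the end points of an interval. *)
Definition derive_in (R : realType) (D : set R) (f : R -> R) (t : R) : R :=
  lim ((f s - f t) / (s - t) @[s --> within D t^']).

Definition DxGamma (R : realType) (s : nat) (v : coeffs R)
    (x t xi tau : R) : R :=
  derive1n s (fun z => Gamma v z t xi tau) x.

(* Gamma v x t only makes sense for t <= T, so at t = T this is the left
   derivative. *)
Definition DtGamma (R : realType) (T : R) (v : coeffs R)
    (x t xi tau : R) : R :=
  derive_in `[0, T] (fun s => Gamma v x s xi tau) t.

(* In \bar R, 0^-1 = +oo and 0 * +oo = 0: the value is +oo if x = xi and N > 0,
   and 0 if N = 0. *)
Definition second_order_bound (R : realType)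
    (alpha beta gamma C K N : R) (x t xi tau : R) : \bar R :=
  ((K * (N + N `^ beta))%:E *
   ((`|x - xi| `^ (1 - (alpha - gamma * (1 - beta))) *
     (t - tau) `^ (1 - gamma * (1 - beta) / 2))%:E^-1 +
    ((t - tau) `^ (3 / 2))%:E^-1) *
   (expR (- (C * ((x - xi) ^+ 2 / (t - tau)))))%:E)%E.

(* Main.v *)
Require Import Defs.
From mathcomp Require Import measurable_realfun ring lra.

(** For each quantity [f] built from [v] and its analogue [g] built from [w], one carries the
    three bounds [pb N B f g]: [|f| <= B], [|g| <= B], [|f - g| <= N * B] with
    [N = ||v - w||]. They are stable under sums, products, integrals and limits, so proving each
    classical parametrix estimate for pairs yields at once a difference estimate that is linear
    in [N].  With the weight [gk c z s = s^(-1/2) exp(- c z^2 / s)], stable under convolution,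
    the iterates satisfy [|(LZ)_m| <= C 2^(-m) (t - tau)^(alpha/2 - 1) gk] and are Hoelder of
    order [alpha/2] in [x].  In the volume potential of [phi] the singularity of [Z_xx] is not
    integrable, but [Z_xx] with frozen coefficient has integral [0] in [y], which gains a
    positive power of [t - sigma] from the Hoelder bound of [phi].  Hence
    [Gamma_xx] and [Gamma_t] differ by at most [K N (t - tau)^(-1) gk], which is the
    [(t - tau)^(-3/2)] part of the claimed bounds. *)

Set Implicit Arguments.
Unset Strict Implicit.
Unset Printing Implicit Defensive.

(** * Paired bounds and integrals *)

Section pair_bound.
Context {R : realType}.
Implicit Types N B f g : R.

(** Every constant is chosen before [N], [v] and [w], so uniformity over the class is built into the
    quantifiers. A triple paired with itself, with [N = 0], turns each paired estimate into the
    single one that integrability and differentiation need. Differences of increments, such as those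
    of [LZ1] at two points for [v] and for [w], must still be linear in [N]; this needs second-order
    control, available because the kernels depend on [a] only through [k = 1 / (4 a)], as
    [k^r exp(- k u)], smooth on the compact range given by ellipticity. The Hoelder exponent drops
    from [al] to [al / 2] for the iterates since the full exponent would leave the time weight
    [s^-1], which is not integrable. The coefficients are known on the strip only: they are extended
    constantly in time, so that the estimates hold for elapsed times up to [S = T + 1] and a
    two-sided time derivative exists even at [t = T]. Convolution preserves the Gaussian exponent
    exactly, so it is lost only finitely often; [1 / (32 rho)] is what remains of [1 / (4 rho)]. *)

Definition pb N B f g := [/\ `|f| <= B, `|g| <= B & `|f - g| <= N * B].

Lemma pb_ge0 N B f g : pb N B f g -> 0 <= B.
Proof. by move=> [h _ _]; exact: le_trans h. Qed.

Lemma pb_le N B B' f g : 0 <= N -> B <= B' -> pb N B f g -> pb N B' f g.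
Proof.
move=> N0 BB' [h1 h2 h3]; split; [exact: le_trans BB'|exact: le_trans BB'|].
by apply: (le_trans h3); rewrite ler_wpM2l.
Qed.

Lemma pbD N B B' f g f' g' : pb N B f g -> pb N B' f' g' ->
  pb N (B + B') (f + f') (g + g').
Proof.
move=> [h1 h2 h3] [k1 k2 k3]; split.
- by rewrite (le_trans (ler_normD _ _))// lerD.
- by rewrite (le_trans (ler_normD _ _))// lerD.
- rewrite (_ : f + f' - (g + g') = (f - g) + (f' - g')); last by ring.
  by rewrite mulrDr (le_trans (ler_normD _ _))// lerD.
Qed.

Lemma pbN N B f g : pb N B f g -> pb N B (- f) (- g).
Proof.
by move=> [h1 h2 h3]; split; rewrite ?normrN// opprK addrC distrC.
Qed.

Lemma pbB N B B' f g f' g' : pb N B f g -> pb N B' f' g' ->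
  pb N (B + B') (f - f') (g - g').
Proof. by move=> h /pbN; exact: pbD. Qed.

Lemma pbZ N B k f g : pb N B f g -> pb N (`|k| * B) (k * f) (k * g).
Proof.
move=> [h1 h2 h3]; split; rewrite -?mulrBr normrM ?ler_wpM2l//.
by rewrite mulrCA ler_wpM2l.
Qed.

(** The factor [2] pays for the two terms of [f f' - g g' = (f - g) f' + g (f' - g')], each at most
    [N] times the product of the bounds. *)
Lemma pbM N B B' f g f' g' : 0 <= N -> pb N B f g -> pb N B' f' g' ->
  pb N (2 * B * B') (f * f') (g * g').
Proof.
move=> N0 h k; have B0 := pb_ge0 h; have B'0 := pb_ge0 k.
case: h => h1 h2 h3; case: k => k1 k2 k3.
have BB : 0 <= B * B' by rewrite mulr_ge0.
have le2 : B * B' <= 2 * B * B' by rewrite -mulrA ler_peMl// ler1n.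
split.
- by rewrite normrM (le_trans _ le2)// ler_pM.
- by rewrite normrM (le_trans _ le2)// ler_pM.
- rewrite (_ : f * f' - g * g' = (f - g) * f' + g * (f' - g')); last by ring.
  rewrite (le_trans (ler_normD _ _))// !normrM.
  rewrite (_ : N * _ = (N * B) * B' + B * (N * B')); last by ring.
  by rewrite lerD// ler_pM.
Qed.

(** How a single estimate is recovered from a paired one: a function paired with itself has
    difference zero, so [N = 0]. *)
Lemma pb_sym0 N B f g : pb N B f g -> pb 0 B f f /\ pb 0 B g g.
Proof. by move=> [h1 h2 _]; split; split; rewrite ?subrr ?normr0 ?mul0r. Qed.

Lemma pb_diag B f : `|f| <= B -> pb 0 B f f.
Proof. by move=> h; split; rewrite // subrr normr0 mul0r. Qed.

Lemma pb_cvg N B (f g : nat -> R) (lf lg : R) :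
  (forall n, pb N B (f n) (g n)) -> f @ \oo --> lf -> g @ \oo --> lg ->
  pb N B lf lg.
Proof.
have lim_le (u : nat -> R) l b : (forall n, `|u n| <= b) -> u @ \oo --> l ->
    `|l| <= b.
  move=> ub cu; have cnu : `|u n| @[n --> \oo] --> `|l| by apply: cvg_norm.
  rewrite -(cvg_lim _ cnu)//; apply: limr_le.
    by apply/cvg_ex; exists `|l|.
  by near=> n; exact: ub.
move=> h cf cg; split.
- by apply: lim_le cf => n; case: (h n).
- by apply: lim_le cg => n; case: (h n).
- apply: (lim_le (fun n => f n - g n)); first by move=> n; case: (h n).
  exact: cvgB.
Unshelve. all: by end_near. Qed.

End pair_bound.

Section integral_tools.
Context {d} {T : measurableType d} {R : realType}.
Variable mu : {measure set T -> \bar R}.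
Implicit Types (D : set T) (f g B : T -> R).

Lemma dominated_integrable D f B : measurable D -> measurable_fun D f ->
  (forall x, D x -> `|f x| <= B x) -> mu.-integrable D (EFin \o B) ->
  mu.-integrable D (EFin \o f).
Proof.
move=> mD mf fB iB; apply: (le_integrable mD _ _ iB).
  exact/measurable_EFinP.
move=> x Dx /=; rewrite lee_fin (le_trans (fB _ Dx))//.
exact: ler_norm.
Qed.

Lemma normr_Rintegral_le D f B : measurable D -> measurable_fun D f ->
  (forall x, D x -> `|f x| <= B x) -> mu.-integrable D (EFin \o B) ->
  `|\int[mu]_(x in D) f x| <= \int[mu]_(x in D) B x.
Proof.
move=> mD mf fB iB.
have fi := dominated_integrable mD mf fB iB.
rewrite (le_trans (le_normr_Rintegral mD fi))// le_Rintegral//.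
exact: integrable_norm.
Qed.

Lemma pb_Rintegral N D f g B b : measurable D ->
  measurable_fun D f -> measurable_fun D g ->
  (forall x, D x -> pb N (B x) (f x) (g x)) ->
  mu.-integrable D (EFin \o B) -> 0 <= N -> \int[mu]_(x in D) B x <= b ->
  pb N b (\int[mu]_(x in D) f x) (\int[mu]_(x in D) g x).
Proof.
move=> mD mf mg h iB N0 hb; apply: (pb_le N0 hb).
have hf x : D x -> `|f x| <= B x by move=> /h[].
have hg x : D x -> `|g x| <= B x by move=> /h[].
split; [exact: normr_Rintegral_le|exact: normr_Rintegral_le|].
rewrite -RintegralB//; last 2 first.
- exact: dominated_integrable hf iB.
- exact: dominated_integrable hg iB.
rewrite -RintegralZl//.
apply: normr_Rintegral_le => //.
- exact: measurable_funB.
- by move=> x /h[].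
- exact: (integrableZl mD N iB).
Qed.

Lemma integrable_scale D (k : R) f : measurable D ->
  mu.-integrable D (EFin \o f) -> mu.-integrable D (EFin \o (fun x => k * f x)).
Proof. by move=> mD i; exact: (integrableZl mD k i). Qed.

Lemma integrable_add D f g : measurable D ->
  mu.-integrable D (EFin \o f) -> mu.-integrable D (EFin \o g) ->
  mu.-integrable D (EFin \o (fun x => f x + g x)).
Proof. by move=> mD i j; exact: (integrableD mD i j). Qed.

End integral_tools.

Section measurability.
Context {R : realType}.
Let mu := @lebesgue_measure R.

(** No integrability is assumed. The integral is the difference of those of the positive and
    negative parts, each measurable in the parameter by Tonelli, and [fine] is measurable on the
    extended reals, so slices of infinite integral do no harm. *)
Lemma measurable_Rintegral_param d (T1 : measurableType d) (f : T1 * R -> R) :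
  measurable_fun setT f ->
  measurable_fun setT (fun x => \int[mu]_(y in [set: R]) f (x, y)).
Proof.
move=> mf; rewrite /Rintegral.
have mE : measurable_fun setT (EFin \o f) by exact/measurable_EFinP.
pose fp z := maxe (f z)%:E 0; pose fm z := maxe (- (f z)%:E)%E 0.
have mfp : measurable_fun setT (fubini_F mu fp).
  apply: measurable_fun_fubini_tonelli_F => [|z].
    exact: measurable_maxe.
  by rewrite le_max lexx orbT.
have mfm : measurable_fun setT (fubini_F mu fm).
  apply: measurable_fun_fubini_tonelli_F => [|z].
    by apply: measurable_maxe => //; exact: measurableT_comp.
  by rewrite le_max lexx orbT.
have -> : (fun x => fine (\int[mu]_y (f (x, y))%:E)) =
    fine \o (fun x => fubini_F mu fp x - fubini_F mu fm x)%E.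
  apply/funext => x /=; congr fine; rewrite integralE /fubini_F.
  by congr (_ - _)%E; apply: eq_integral => y _; rewrite ?funeposE ?funenegE.
have h := emeasurable_funB mfp mfm.
have mfine : measurable_fun [set: \bar R] (@fine R) by exact: fine_measurable.
exact: (measurableT_comp mfine h).
Qed.

(** The variable interval is moved into the integrand as an indicator, which reduces the claim to a
    fixed domain. *)
Lemma measurable_Rintegral_itv_param d (T1 : measurableType d) (a b : T1 -> R)
    (f : T1 * R -> R) :
  measurable_fun setT a -> measurable_fun setT b -> measurable_fun setT f ->
  measurable_fun setT (fun x => \int[mu]_(y in `]a x, b x[) f (x, y)).
Proof.
move=> ma mb mf.
have -> : (fun x => \int[mu]_(y in `]a x, b x[) f (x, y)) =
  (fun x => \int[mu]_(y in [set: R])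
     (if (a x < y) && (y < b x) then f (x, y) else 0)).
  apply/funext => x; rewrite Rintegral_mkcond; apply: eq_Rintegral => y _.
  by rewrite patchE mem_setE in_itv.
apply: (measurable_Rintegral_param (f := fun z => if (a z.1 < z.2) && (z.2 < b z.1) then f z else 0)).
have m1 : measurable_fun setT (a \o fst : T1 * R -> R) by exact: measurableT_comp.
have m2 : measurable_fun setT (b \o fst : T1 * R -> R) by exact: measurableT_comp.
apply: measurable_fun_ifT => //.
by apply: measurable_and; apply: measurable_fun_ltr => //.
Qed.

End measurability.

(* The tools above with binders over [R] itself instead of the carrier of its
   sigma-algebra. *)
Section real_line.
Context {R : realType}.
Let mu := @lebesgue_measure R.
Implicit Types (D : set R) (f g B : R -> R).

Lemma set_ooE (a b s : R) : `]a, b[%classic s = (a < s < b) :> Prop.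
Proof. by rewrite /= in_itv. Qed.

Lemma set_ocE (a b s : R) : `]a, b]%classic s = (a < s <= b) :> Prop.
Proof. by rewrite /= in_itv. Qed.

Lemma integrable_le D f B : measurable D -> measurable_fun D f ->
  (forall x : R, D x -> `|f x| <= B x) -> mu.-integrable D (EFin \o B) ->
  mu.-integrable D (EFin \o f).
Proof.
by move=> mD mf fB iB; apply: (@dominated_integrable _ _ _ mu D f B).
Qed.

Lemma Rintegral_norm_le D f B : measurable D -> measurable_fun D f ->
  (forall x : R, D x -> `|f x| <= B x) -> mu.-integrable D (EFin \o B) ->
  `|\int[mu]_(x in D) f x| <= \int[mu]_(x in D) B x.
Proof.
by move=> mD mf fB iB; apply: (@normr_Rintegral_le _ _ _ mu D f B).
Qed.

Lemma pb_integral N D f g B b : measurable D ->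
  measurable_fun D f -> measurable_fun D g ->
  (forall x : R, D x -> pb N (B x) (f x) (g x)) ->
  mu.-integrable D (EFin \o B) -> 0 <= N -> \int[mu]_(x in D) B x <= b ->
  pb N b (\int[mu]_(x in D) f x) (\int[mu]_(x in D) g x).
Proof.
by move=> mD mf mg fB iB N0 hb; apply: (@pb_Rintegral _ _ _ mu N D f g B b).
Qed.

End real_line.

(** * Improper integrals of powers *)

Section improper_integrals.
Context {R : realType}.
Let mu := @lebesgue_measure R.

Lemma is_derive_powR (q x : R) : 0 < x ->
  is_derive x 1 (@powR R ^~ q) (q * x `^ (q - 1)).
Proof.
move=> x0; apply: DeriveDef.
  by apply: derivable_powR; rewrite in_itv/= x0.
by rewrite -derive1E powR_derive1// in_itv/= x0.
Qed.

Lemma continuous_powR_gt0 (q x : R) : 0 < x -> {for x, continuous (@powR R ^~ q)}.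
Proof.
move=> x0; apply: differentiable_continuous; apply/derivable1_diffP.
by apply: derivable_powR; rewrite in_itv/= x0.
Qed.

Lemma is_derive_shift (a x : R) : is_derive x 1 (fun s : R => s - a) 1.
Proof.
have := is_deriveB (is_derive_id x (1 : R)) (is_derive_cst a x 1).
by rewrite subr0.
Qed.

Lemma is_derive_reflect (a x : R) : is_derive x 1 (fun s : R => a - s) (-1).
Proof.
have := is_deriveB (is_derive_cst a x 1) (is_derive_id x (1 : R)).
by rewrite sub0r.
Qed.

(** Singularities may sit at both end points. Exhausting the interval by compact ones and using
    monotone convergence, which the sign of [f] permits, gives the value and the integrability at
    once. *)
Lemma improper_FTC2 (f F : R -> R) (a b la lb : R) : a < b ->
  (forall x, a < x < b -> is_derive x 1 F (f x)) ->
  (forall x, a < x < b -> 0 <= f x) ->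
  (forall x, a < x < b -> {for x, continuous f}) ->
  measurable_fun setT f ->
  F x @[x --> a^'+] --> la -> F x @[x --> b^'-] --> lb ->
  mu.-integrable `]a, b[ (EFin \o f) /\ \int[mu]_(x in `]a, b[) f x = lb - la.
Proof.
move=> ab dF f0 cf mf Fa Fb.
(* Starting the denominators at [3] makes [2 * d n < b - a] for every [n], so all the compact
   intervals are nondegenerate. *)
pose d n : R := (b - a) / n.+3%:R.
have d0 n : 0 < d n by rewrite divr_gt0// subr_gt0.
have dd n : d n + d n < b - a.
  have : d n <= (b - a) / 3 by apply: ler_wpM2l; rewrite ?subr_ge0 ?(ltW ab)// lef_pV2 ?posrE// ler_nat.
  by have := d0 n; lra.
have dcvg : d @ \oo --> 0.
  rewrite -(mulr0 (b - a)); apply: cvgM; first exact: cvg_cst.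
  by have := @cvg_harmonic R; rewrite -(cvg_shiftn 2); under eq_fun do rewrite /= addn2.
pose G n : set R := `[a + d n, b - d n]%classic.
have Gsub n : G n `<=` `]a, b[%classic.
  by apply: subset_itvSoo; rewrite bnd_simp; have := d0 n; lra.
have dnd m n : (m <= n)%N -> d n <= d m.
  move=> mn; apply: ler_wpM2l; first by rewrite subr_ge0 ltW.
  by rewrite lef_pV2 ?posrE// ler_nat.
have ndG : {homo G : n m / (n <= m)%N >-> (n <= m)%O}.
  move=> m n mn; rewrite subsetEset; apply: subset_itvScc; rewrite bnd_simp.
    by have := dnd _ _ mn; lra.
  by have := dnd _ _ mn; lra.
have UG : \bigcup_n G n = `]a, b[%classic.
  apply/seteqP; split => [x [n _]|x /=]; first exact: Gsub.
  rewrite in_itv/= => /andP[ax xb].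
  have m0 : 0 < Num.min (x - a) (b - x) by rewrite lt_min; lra.
  have /cvgrPdist_lt/(_ _ m0)[n _ /(_ n (leqnn n))] := dcvg.
  rewrite /= sub0r normrN gtr0_norm// lt_min => dn.
  by exists n => //; rewrite /G/= in_itv/=; lra.
have intG n : (\int[mu]_(x in G n) (f x)%:E)%E = (F (b - d n) - F (a + d n))%:E.
  have inab x : a + d n <= x <= b - d n -> a < x < b by have := d0 n; lra.
  have dlt : a + d n < b - d n by have := dd n; lra.
  have cF x : a < x < b -> {for x, continuous F}.
    move=> xab; apply: differentiable_continuous; apply/derivable1_diffP.
    by have [] := dF _ xab.
  rewrite (@continuous_FTC2 _ f F)//.
  - apply: continuous_in_subspaceT => x; rewrite inE/= in_itv/= => /inab.
    exact: cf.
  - split.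
    + move=> x; rewrite in_itv/= => xab.
      by have [] : is_derive x 1 F (f x) by apply: dF; apply: inab; lra.
    + by apply: cvg_at_right_filter; apply: cF; have := d0 n; lra.
    + by apply: cvg_at_left_filter; apply: cF; have := d0 n; lra.
  - move=> x; rewrite in_itv/= => xab; rewrite derive1E.
    by have [_ ->] : is_derive x 1 F (f x) by apply: dF; apply: inab; lra.
have cvg1 : (\int[mu]_(x in G n) (f x)%:E)%E @[n --> \oo] -->
    (\int[mu]_(x in `]a, b[) (f x)%:E)%E.
  rewrite -UG; apply: ge0_nondecreasing_set_cvg_integral => //.
  - by move=> n; exact: measurable_itv.
  - by move=> n; apply: measurable_funTS; exact/measurable_EFinP.
  - by move=> n x /Gsub/=; rewrite in_itv/= lee_fin => /f0.
have cvg2 : (\int[mu]_(x in G n) (f x)%:E)%E @[n --> \oo] --> (lb - la)%:E.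
  under eq_fun do rewrite intG.
  apply: cvg_EFin; first exact: nearW.
  apply: cvgB.
  - move/cvg_at_leftP : Fb; apply; split; first by move=> n; have := d0 n; lra.
    by rewrite -[X in _ --> X](subr0 b); apply: cvgB => //; exact: cvg_cst.
  - move/cvg_at_rightP : Fa; apply; split; first by move=> n; have := d0 n; lra.
    by rewrite -[X in _ --> X](addr0 a); apply: cvgD => //; exact: cvg_cst.
have E := cvg_unique _ cvg1 cvg2.
have {}E : (\int[mu]_(x in `]a, b[) (f x)%:E)%E = (lb - la)%:E by exact: E.
split; last by rewrite /Rintegral E.
apply/integrableP; split.
  by apply: measurable_funTS; exact/measurable_EFinP.
rewrite (_ : integral _ _ _ = (lb - la)%:E) ?ltry// -E.
apply: eq_integral => x; rewrite inE/= in_itv/= => /f0 fx.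
by rewrite ger0_norm.
Qed.

Lemma measurable_powR_shift (q t : R) : measurable_fun setT (fun s : R => (s - t) `^ q).
Proof.
apply: (measurableT_comp (f := @powR R ^~ q)); first exact: measurable_powR.
exact: measurable_funB.
Qed.

Lemma measurable_powR_refl (q t : R) : measurable_fun setT (fun s : R => (t - s) `^ q).
Proof.
apply: (measurableT_comp (f := @powR R ^~ q)); first exact: measurable_powR.
exact: measurable_funB.
Qed.

Lemma integral_powR_left (tau t q : R) : tau < t -> 0 < q ->
  mu.-integrable `]tau, t[ (EFin \o (fun s => (s - tau) `^ (q - 1))) /\
  \int[mu]_(s in `]tau, t[) (s - tau) `^ (q - 1) = (t - tau) `^ q / q.
Proof.
move=> taut q0; rewrite -[X in _ = X]subr0.
have q_neq0 : q != 0 by rewrite gt_eqF.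
apply: (@improper_FTC2 _ (fun s => (s - tau) `^ q / q)) => //.
- move=> x xt.
  have x0 : 0 < x - tau by lra.
  have D := is_derive_powR q x0.
  rewrite (_ : (fun _ => _) = q^-1 *: ((@powR R ^~ q) \o (fun s => s - tau))); last first.
    by apply/funext => s /=; rewrite /GRing.scale/= mulrC.
  rewrite (_ : (_ `^ _) = q^-1 *: (q * (x - tau) `^ (q - 1) * 1)); last first.
    by rewrite mulr1 /GRing.scale/= mulKf.
  apply: is_deriveZ; apply: is_derive1_comp.
  exact: is_derive_shift.
- by move=> x _; exact: powR_ge0.
- move=> x xt; have x0 : 0 < x - tau by lra.
  apply: (@continuous_comp _ _ _ (fun s => s - tau) (@powR R ^~ (q - 1))).
    by apply: cvgB; [exact: cvg_id|exact: cvg_cst].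
  exact: continuous_powR_gt0.
- exact: measurable_powR_shift.
- rewrite -(mul0r q^-1); apply: cvgM; last exact: cvg_cst.
  have h := powR_cvg0 q0.
  apply/cvg_at_rightP => u [u1 u2].
  move/cvg_at_rightP : h; apply; split => [n|]; first by rewrite subr_gt0.
  by rewrite -(subrr tau); apply: cvgB => //; exact: cvg_cst.
- apply: cvg_at_left_filter; apply: cvgM; last exact: cvg_cst.
  apply: (@continuous_comp _ _ _ (fun s => s - tau) (@powR R ^~ q)).
    by apply: cvgB; [exact: cvg_id|exact: cvg_cst].
  by apply: continuous_powR_gt0; lra.
Qed.

Lemma integral_powR_right (tau t q : R) : tau < t -> 0 < q ->
  mu.-integrable `]tau, t[ (EFin \o (fun s => (t - s) `^ (q - 1))) /\
  \int[mu]_(s in `]tau, t[) (t - s) `^ (q - 1) = (t - tau) `^ q / q.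
Proof.
move=> taut q0; rewrite -[X in _ = X]opprK -[X in _ = X]sub0r.
have q_neq0 : q != 0 by rewrite gt_eqF.
apply: (@improper_FTC2 _ (fun s => - ((t - s) `^ q / q))) => //.
- move=> x xt.
  have x0 : 0 < t - x by lra.
  have D := is_derive_powR q x0.
  rewrite (_ : (fun _ => _) = (- q^-1) *: ((@powR R ^~ q) \o (fun s => t - s))); last first.
    by apply/funext => s; rewrite -[RHS]/(- q^-1 * (t - s) `^ q) mulNr mulrC. 
  rewrite (_ : (_ `^ _) = (- q^-1) *: (q * (t - x) `^ (q - 1) * (- 1))); last first.
    by rewrite mulrN1 -[RHS]/(- q^-1 * - (q * (t - x) `^ (q - 1))) mulrNN mulKf.
  apply: is_deriveZ; apply: is_derive1_comp.
  exact: is_derive_reflect.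
- by move=> x _; exact: powR_ge0.
- move=> x xt; have x0 : 0 < t - x by lra.
  apply: (@continuous_comp _ _ _ (fun s => t - s) (@powR R ^~ (q - 1))).
    by apply: cvgB; [exact: cvg_cst|exact: cvg_id].
  exact: continuous_powR_gt0.
- exact: measurable_powR_refl.
- apply: cvg_at_right_filter; apply: cvgN; apply: cvgM; last exact: cvg_cst.
  apply: (@continuous_comp _ _ _ (fun s => t - s) (@powR R ^~ q)).
    by apply: cvgB; [exact: cvg_cst|exact: cvg_id].
  by apply: continuous_powR_gt0; lra.
- rewrite -oppr0; apply: cvgN.
  rewrite -(mul0r q^-1); apply: cvgM; last exact: cvg_cst.
  have h := powR_cvg0 q0.
  apply/cvg_at_leftP => u [u1 u2].
  move/cvg_at_rightP : h; apply; split => [n|]; first by rewrite subr_gt0.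
  by rewrite -(subrr t); apply: cvgB => //; exact: cvg_cst.
Qed.

(** The standard integrable majorant in time: one singularity at each end, with the powers added
    rather than multiplied, so that its integral is elementary. *)
Definition endpoint_bound (A B p q tau t s : R) :=
  A * (s - tau) `^ (q - 1) + B * (t - s) `^ (p - 1).

Lemma integral_endpoint_bound (A B p q tau t : R) : tau < t -> 0 < p -> 0 < q ->
  mu.-integrable `]tau, t[ (EFin \o endpoint_bound A B p q tau t) /\
  \int[mu]_(s in `]tau, t[) endpoint_bound A B p q tau t s =
    A * ((t - tau) `^ q / q) + B * ((t - tau) `^ p / p).
Proof.
move=> taut p0 q0.
have [i1 e1] := integral_powR_left taut q0.
have [i2 e2] := integral_powR_right taut p0.
have m : measurable `]tau, t[%classic by exact: measurable_itv.
have j1 : mu.-integrable `]tau, t[ (EFin \o (fun s => A * (s - tau) `^ (q - 1))).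
  exact: integrable_scale.
have j2 : mu.-integrable `]tau, t[ (EFin \o (fun s => B * (t - s) `^ (p - 1))).
  exact: integrable_scale.
split; first exact: integrable_add.
by rewrite /endpoint_bound RintegralD// !RintegralZl// e1 e2.
Qed.

End improper_integrals.

(** * Mean value estimates for pairs and increments *)

Section mean_value.
Context {R : realType}.
Implicit Types (F : R -> R) (k p q B M N : R).

Lemma lipschitz_deriv F F1 k0 k1 B :
  (forall k, k0 <= k <= k1 -> is_derive k 1 F (F1 k)) ->
  (forall k, k0 <= k <= k1 -> `|F1 k| <= B) ->
  forall p q, k0 <= p <= k1 -> k0 <= q <= k1 -> `|F p - F q| <= B * `|p - q|.
Proof.
move=> dF bF1 p q; wlog pq : p q / q <= p => [hw pI qI|pI qI].
  have [qp|/ltW pq] := leP q p; first exact: hw.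
  by rewrite distrC (distrC p); exact: hw.
have dI x : x \in `[q, p] -> k0 <= x <= k1 by rewrite in_itv/=; lra.
have [c /dI cI ->] : exists2 c, c \in `[q, p] & F p - F q = F1 c * (p - q).
  apply: MVT_segment => //.
    by move=> x /subset_itv_oo_cc/dI; exact: dF.
  by apply: derivable_within_continuous => x /dI /dF[].
by rewrite normrM ler_wpM2r// bF1.
Qed.

(** The mean value theorem is applied to the difference of [F] along the segments from [q] to [p]
    and from [q'] to [p']. This second-order estimate keeps the bound linear in the change of
    coefficients when increments in space are compared; two separate Lipschitz bounds would lose
    it. *)
Lemma four_point F F1 F2 k0 k1 B :
  (forall k, k0 <= k <= k1 -> is_derive k 1 F (F1 k)) ->
  (forall k, k0 <= k <= k1 -> is_derive k 1 F1 (F2 k)) ->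
  (forall k, k0 <= k <= k1 -> `|F1 k| <= B) ->
  (forall k, k0 <= k <= k1 -> `|F2 k| <= B) ->
  forall p p' q q', k0 <= p <= k1 -> k0 <= p' <= k1 ->
    k0 <= q <= k1 -> k0 <= q' <= k1 ->
  `|(F p - F p') - (F q - F q')| <=
    B * (`|(p - p') - (q - q')| + `|p' - q'| * (`|p - p'| + `|q - q'|)).
Proof.
move=> dF dF1 bF1 bF2 p p' q q' hp hp' hq hq'.
have B0 : 0 <= B by apply: le_trans (bF1 _ hp).
pose A (th : R) := q + th * (p - q); pose A' (th : R) := q' + th * (p' - q').
have inI (a b th : R) : k0 <= a <= k1 -> k0 <= b <= k1 -> 0 <= th <= 1 ->
    k0 <= b + th * (a - b) <= k1.
  by move=> *; nra.
pose phi (th : R) := F (A th) - F (A' th).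
pose dphi (th : R) := F1 (A th) * (p - q) - F1 (A' th) * (p' - q').
have dlin (a b th : R) : is_derive th 1 (fun x : R => b + x * a) a.
  have := is_deriveD (is_derive_cst b th 1)
    (is_deriveZ a (is_derive_id th (1 : R))).
  rewrite add0r (_ : cst b + _ = (fun x => b + x * a)); last first.
    by apply/funext => x; rewrite mulrC.
  by rewrite (_ : a *: 1 = a)// /GRing.scale/= mulr1.
have dphiP (th : R) : 0 <= th <= 1 -> is_derive th 1 phi (dphi th).
  move=> hth.
  have D1 := dF _ (inI _ _ _ hp hq hth); have D2 := dF _ (inI _ _ _ hp' hq' hth).
  exact: (is_deriveB (@is_derive1_comp _ F A th _ _ D1 (dlin (p - q) q th))
    (@is_derive1_comp _ F A' th _ _ D2 (dlin (p' - q') q' th))).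
have [c] : exists2 c, c \in `[0, 1] & phi 1 - phi 0 = dphi c * (1 - 0).
  apply: MVT_segment => //.
    by move=> x /subset_itv_oo_cc; rewrite in_itv/= => /dphiP.
  by apply: derivable_within_continuous => x; rewrite in_itv/= => /dphiP[].
rewrite in_itv/= subr0 mulr1 /phi /A /A' !mul0r !mul1r !addr0 !subrKC => hc E.
rewrite {}E /dphi.
(* The first term sees the change of the two increments, the second the distance between the two
   segments, which is a convex combination of [p - p'] and [q - q']. *)
rewrite (_ : _ - _ = F1 (A c) * ((p - p') - (q - q')) +
  (F1 (A c) - F1 (A' c)) * (p' - q')); last by ring.
rewrite [leRHS]mulrDr (le_trans (ler_normD _ _))// lerD// normrM.
  by rewrite ler_wpM2r// bF1//; exact: inI.
rewrite mulrCA mulrC ler_wpM2l//.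
rewrite (le_trans (lipschitz_deriv dF1 bF2 _ _))//; [exact: inI|exact: inI|].
rewrite ler_wpM2l//.
rewrite (_ : A c - A' c = c * (p - p') + (1 - c) * (q - q')); last by rewrite /A /A'; ring.
rewrite (le_trans (ler_normD _ _))// lerD// normrM ler_piMl// ger0_norm; lra.
Qed.

Lemma pb_comp F F1 k0 k1 B M N :
  (forall k, k0 <= k <= k1 -> is_derive k 1 F (F1 k)) ->
  (forall k, k0 <= k <= k1 -> `|F k| <= B) ->
  (forall k, k0 <= k <= k1 -> `|F1 k| <= B) -> 0 <= M -> 0 <= N ->
  forall p q, k0 <= p <= k1 -> k0 <= q <= k1 -> `|p - q| <= N * M ->
  pb N (B * (1 + M)) (F p) (F q).
Proof.
move=> dF bF bF1 M0 N0 p q hp hq pq.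
have B0 : 0 <= B by apply: le_trans (bF _ hp).
have BB : B <= B * (1 + M) by nra.
split; [exact: le_trans (bF _ hp) _|exact: le_trans (bF _ hq) _|].
rewrite (le_trans (lipschitz_deriv dF bF1 hp hq))//.
rewrite (le_trans (ler_wpM2l B0 pq))//.
by rewrite mulrCA ler_wpM2l// ler_wpM2l//; lra.
Qed.

(** Here [p], [p'] are values for [v] at two points, [q], [q'] those for [w], and [M * d] bounds the
    increments between the points. The factor [1 + 2 * M] collects the two terms of [four_point]. *)
Lemma pb_comp_incr F F1 F2 k0 k1 B M N d :
  (forall k, k0 <= k <= k1 -> is_derive k 1 F (F1 k)) ->
  (forall k, k0 <= k <= k1 -> is_derive k 1 F1 (F2 k)) ->
  (forall k, k0 <= k <= k1 -> `|F1 k| <= B) ->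
  (forall k, k0 <= k <= k1 -> `|F2 k| <= B) -> 0 <= M -> 0 <= N ->
  forall p p' q q', k0 <= p <= k1 -> k0 <= p' <= k1 ->
    k0 <= q <= k1 -> k0 <= q' <= k1 ->
  `|p' - q'| <= N * M -> pb N (M * d) (p - p') (q - q') ->
  pb N (B * (M * d * (1 + 2 * M))) (F p - F p') (F q - F q').
Proof.
move=> dF dF1 bF1 bF2 M0 N0 p p' q q' hp hp' hq hq' pq' h.
have B0 : 0 <= B by apply: le_trans (bF1 _ hp).
have Md := pb_ge0 h; case: h => h1 h2 h3.
have le1 : M * d <= M * d * (1 + 2 * M) by rewrite ler_peMr//; lra.
split.
- rewrite (le_trans (lipschitz_deriv dF bF1 hp hp'))// ler_wpM2l//.
  exact: le_trans h1 _.
- rewrite (le_trans (lipschitz_deriv dF bF1 hq hq'))// ler_wpM2l//.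
  exact: le_trans h2 _.
- rewrite (le_trans (four_point dF dF1 bF1 bF2 hp hp' hq hq'))// mulrCA ler_wpM2l//.
  have -> : N * (M * d * (1 + 2 * M)) = N * (M * d) + (N * M) * (M * d + M * d).
    by ring.
  by rewrite lerD// ler_pM// ?addr_ge0// lerD.
Qed.

(** From [y^(n+1) / (n+1)! <= expR y] at [y = delta * (1 + u)]; one power of [1 + u] is left over
    and discarded, as [1 + u >= 1]. *)
Lemma poly_expR_bound (n : nat) (delta : R) : 0 < delta ->
  exists2 C : R, 0 < C &
    forall u, 0 <= u -> (1 + u) ^+ n * expR (- (delta * u)) <= C.
Proof.
move=> d0; exists (expR delta * n.+1`!%:R / delta ^+ n.+1).
  by rewrite divr_gt0 ?mulr_gt0 ?expR_gt0 ?exprn_gt0 ?ltr0n ?fact_gt0.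
move=> u u0.
have v0 : 0 <= delta * (1 + u) by rewrite mulr_ge0 ?ltW//; lra.
have := expR_ge1Dxn n v0 => h.
have {h} : (delta * (1 + u)) ^+ n.+1 / n.+1`!%:R <= expR (delta * (1 + u)) by lra.
rewrite ler_pdivrMr ?ltr0n ?fact_gt0// exprMn => h.
rewrite ler_pdivlMr ?exprn_gt0//.
have -> : - (delta * u) = delta - delta * (1 + u) by ring.
rewrite expRB.
have e0 := expR_gt0 (delta * (1 + u)).
have h2 : (1 + u) ^+ n * delta ^+ n.+1 <= expR (delta * (1 + u)) * n.+1`!%:R.
  rewrite (le_trans _ h)// mulrC ler_wpM2l ?exprn_ge0 ?(ltW d0)//.
  by rewrite exprS ler_peMl// ?exprn_ge0//; lra.
rewrite (_ : _ * _ * _ = expR delta *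
  ((1 + u) ^+ n * delta ^+ n.+1 / expR (delta * (1 + u)))); last by ring.
by rewrite ler_wpM2l ?expR_ge0// ler_pdivrMr// [leRHS]mulrC.
Qed.

End mean_value.

(** * Gaussian integrals *)

Section gaussian.
Context {R : realType}.
Let mu := @lebesgue_measure R.

Definition gk (c z s : R) := s `^ (- 2^-1) * expR (- (c * (z ^+ 2 / s))).

Lemma gk_ge0 c z s : 0 <= gk c z s.
Proof. by rewrite mulr_ge0 ?powR_ge0 ?expR_ge0. Qed.

Lemma powRV2_sqrt (s : R) : 0 <= s -> s `^ (- 2^-1) = (Num.sqrt s)^-1.
Proof. by move=> s0; rewrite powRN powR12_sqrt. Qed.

Lemma integral_gauss_shift (k m : R) : 0 < k ->
  mu.-integrable setT (EFin \o (fun y => expR (- (k * (y - m) ^+ 2)))) /\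
  \int[mu]_(y in [set: R]) expR (- (k * (y - m) ^+ 2)) = Num.sqrt (pi / k).
Proof.
move=> k0; pose sg : R := Num.sqrt ((2 * k)^-1).
have k2 : 0 < (2 * k)^-1 by rewrite invr_gt0; lra.
have sg0 : sg != 0 by rewrite gt_eqF// sqrtr_gt0.
have sg2 : sg ^+ 2 = (2 * k)^-1 by rewrite sqr_sqrtr// ltW.
have pk : 0 < pi / k :> R by rewrite divr_gt0// pi_gt0.
have sne : Num.sqrt (pi / k) != 0 by rewrite gt_eqF// sqrtr_gt0.
have E : (fun y => expR (- (k * (y - m) ^+ 2))) =
    (fun y => Num.sqrt (pi / k) * normal_pdf m sg y).
  apply/funext => y; rewrite normal_pdfE//= /normal_peak /normal_fun sg2.
  rewrite (_ : (2 * k)^-1 * pi *+ 2 = pi / k); last by field; rewrite gt_eqF.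
  rewrite mulVKf//; congr expR; field.
  by rewrite gt_eqF.
have i1 := integrable_normal_pdf m sg.
rewrite E; split; first exact: integrable_scale.
by rewrite RintegralZl// /Rintegral integral_normal_pdf/= mulr1.
Qed.

(** Completing the square in [y] around the weighted mean [m] leaves a Gaussian of parameter [k].
    The identity is exact: [c] does not deteriorate, so it survives arbitrarily many
    convolutions. *)
Lemma gk_conv (c x xi s1 s2 : R) : 0 < c -> 0 < s1 -> 0 < s2 ->
  mu.-integrable setT (EFin \o (fun y => gk c (x - y) s1 * gk c (y - xi) s2)) /\
  \int[mu]_(y in [set: R]) (gk c (x - y) s1 * gk c (y - xi) s2) =
    Num.sqrt (pi / c) * gk c (x - xi) (s1 + s2).
Proof.
move=> c0 s10 s20.
have s120 : 0 < s1 + s2 by rewrite addr_gt0.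
pose k := c * ((s1 + s2) / (s1 * s2)); pose m := (s2 * x + s1 * xi) / (s1 + s2).
have ss : 0 < (s1 + s2) / (s1 * s2) by rewrite divr_gt0// mulr_gt0.
have k0 : 0 < k by rewrite mulr_gt0.
have [i1 e1] := integral_gauss_shift m k0.
pose A := s1 `^ (- 2^-1) * s2 `^ (- 2^-1) * expR (- (c * ((x - xi) ^+ 2 / (s1 + s2)))).
have E : (fun y => gk c (x - y) s1 * gk c (y - xi) s2) =
    (fun y => A * expR (- (k * (y - m) ^+ 2))).
  apply/funext => y; rewrite /gk /A mulrACA -!mulrA; congr (_ * (_ * _)).
  rewrite -!expRD; congr expR; rewrite /k /m; field.
  by rewrite !gt_eqF.
rewrite E; split; first exact: integrable_scale.
rewrite RintegralZl// e1 /A /gk /k.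
rewrite !powRV2_sqrt ?ltW//.
have -> : pi / (c * ((s1 + s2) / (s1 * s2))) = (pi / c) * (s1 * s2 / (s1 + s2)).
  by field; rewrite !gt_eqF.
have : 0 <= pi / c by rewrite divr_ge0 ?pi_ge0 ?ltW.
move: (pi / c) => P P0.
rewrite (sqrtrM _ P0) -(mulrA s1) (sqrtrM _ (ltW s10)) (sqrtrM _ (ltW s20)).
rewrite (sqrtrV (ltW s120)).
by field; rewrite !gt_eqF ?sqrtr_gt0.
Qed.

End gaussian.

(** * Limits and derivatives under the integral sign *)

Section limits_under_integral.
Context {d} {T : measurableType d} {R : realType}.
Variable mu : {measure set T -> \bar R}.

Lemma cvg_Rintegral_dominated (D : set T) (f : nat -> T -> R) (g G : T -> R) :
  measurable D -> (forall n, measurable_fun D (f n)) -> measurable_fun D g ->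
  (forall x, D x -> f ^~ x @ \oo --> g x) ->
  mu.-integrable D (EFin \o G) ->
  (forall n x, D x -> `|f n x| <= G x) ->
  \int[mu]_(x in D) f n x @[n --> \oo] --> \int[mu]_(x in D) g x.
Proof.
move=> mD mf mg fg iG fG.
have mf' n : measurable_fun D (EFin \o f n) by exact/measurable_EFinP.
have mg' : measurable_fun D (EFin \o g) by exact/measurable_EFinP.
have fg' x : D x -> (f n x)%:E @[n --> \oo] --> (g x)%:E.
  by move=> Dx; apply: cvg_EFin; [exact: nearW|exact: fg].
have fG' x n : D x -> (`|(f n x)%:E| <= (G x)%:E)%E.
  by move=> Dx; rewrite lee_fin fG.
have [ig _ cv] := @dominated_convergence _ _ _ mu D mD (fun n x => (f n x)%:E)
  (EFin \o g) (EFin \o G) mf' mg' (aeW _ fg') iG (aeW _ fG').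
apply: fine_cvg.
rewrite /Rintegral fineK; last exact: integrable_fin_num.
exact: cv.
Qed.

Lemma is_derive_Rintegral (D : set T) (f df : R -> T -> R) (G : T -> R) (a e : R) :
  measurable D -> 0 < e ->
  (forall x, `|x - a| < e -> mu.-integrable D (EFin \o f x)) ->
  (forall x y, `|x - a| < e -> D y -> is_derive x 1 (f ^~ y) (df x y)) ->
  mu.-integrable D (EFin \o G) ->
  (forall x y, `|x - a| < e -> D y -> `|df x y| <= G y) ->
  is_derive a 1 (fun x => \int[mu]_(y in D) f x y) (\int[mu]_(y in D) df a y).
Proof.
move=> mD e0 intf dfE iG dfG.
have Ia : `]a - e, a + e[%classic a by rewrite /= in_itv/=; lra.
have Ix x : `]a - e, a + e[%classic x -> `|x - a| < e.
  by rewrite /= in_itv/= ltr_norml; lra.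
have ea : `|a - a| < e by rewrite subrr normr0.
have intf' x : `]a - e, a + e[%classic x -> mu.-integrable D (EFin \o f x).
  by move=> /Ix; exact: intf.
have der x y : `]a - e, a + e[%classic x -> D y -> derivable (f ^~ y) x 1.
  by move=> /Ix h Dy; have [] := dfE _ _ h Dy.
have d1E x y : `|x - a| < e -> D y -> partial1of2 f x y = df x y.
  by move=> h Dy; rewrite partial1of2E; have [] := dfE _ _ h Dy.
have iG' : mu.-integrable D (EFin \o (fun y => `|G y|)) by exact: integrable_norm.
have dG x y : `]a - e, a + e[%classic x -> D y -> `|partial1of2 f x y| <= `|G y|.
  by move=> /Ix h Dy; rewrite d1E// (le_trans (dfG _ _ h Dy))// ler_norm.
apply: DeriveDef.
  exact: (derivable_under_integral mD Ia intf' der _ iG' dG).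
rewrite -derive1E (differentiation_under_integral mD Ia intf' der _ iG' dG)//.
by apply: eq_Rintegral => y; rewrite inE => Dy; rewrite d1E.
Qed.

End limits_under_integral.

Section real_line.
Context {R : realType}.
Let mu := @lebesgue_measure R.

Lemma cvg_integral_dominated (D : set R) (f : nat -> R -> R) (g G : R -> R) :
  measurable D -> (forall n, measurable_fun D (f n)) -> measurable_fun D g ->
  (forall x : R, D x -> f ^~ x @ \oo --> g x) ->
  mu.-integrable D (EFin \o G) ->
  (forall n (x : R), D x -> `|f n x| <= G x) ->
  \int[mu]_(x in D) f n x @[n --> \oo] --> \int[mu]_(x in D) g x.
Proof.
move=> mD mf mg fg iG fG.
by apply: (@cvg_Rintegral_dominated _ _ _ mu D f g G).
Qed.

Lemma is_derive_integral (D : set R) (f df : R -> R -> R) (G : R -> R) (a e : R) :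
  measurable D -> 0 < e ->
  (forall x, `|x - a| < e -> mu.-integrable D (EFin \o f x)) ->
  (forall x y : R, `|x - a| < e -> D y -> is_derive x 1 (f ^~ y) (df x y)) ->
  mu.-integrable D (EFin \o G) ->
  (forall x y : R, `|x - a| < e -> D y -> `|df x y| <= G y) ->
  is_derive a 1 (fun x => \int[mu]_(y in D) f x y) (\int[mu]_(y in D) df a y).
Proof.
move=> mD e0 intf dfE iG dfG.
by apply: (@is_derive_Rintegral _ _ _ mu D f df G a e).
Qed.

End real_line.

Section measurable_operations.
Context {d} {T : measurableType d} {R : realType}.
Implicit Types (D : set T) (f g : T -> R).

Lemma measurable_fun_powR D f (p : R) : measurable_fun D f ->
  measurable_fun D (fun x => f x `^ p).
Proof. exact: (measurableT_comp (measurable_powR p)). Qed.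

Lemma measurable_fun_expR D f : measurable_fun D f ->
  measurable_fun D (fun x => expR (f x)).
Proof. by move=> mf; apply: (measurableT_comp _ mf); exact: measurable_expR. Qed.

Lemma measurable_fun_normr D f : measurable_fun D f ->
  measurable_fun D (fun x => `|f x|).
Proof. exact: measurableT_comp. Qed.

Lemma measurable_fun_invr D f : measurable_fun D f ->
  measurable_fun D (fun x => (f x)^-1).
Proof.
move=> mf.
(* The power [-1] agrees with the inverse on nonnegative numbers, hence the square; at zeros of [f]
   both sides are [0]. *)
rewrite (_ : (fun _ => _) = fun x => f x * (f x ^+ 2) `^ (-1)); last first.
  apply/funext => x; rewrite powR_inv1 ?sqr_ge0//.
  have [->|fx0] := eqVneq (f x) 0; first by rewrite invr0 mul0r.
  by rewrite expr2 invfM mulVKf.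
by apply: measurable_funM => //; apply: measurable_fun_powR; exact: measurable_funX.
Qed.

Lemma measurable_fun_sqrt D f : measurable_fun D f ->
  measurable_fun D (fun x => Num.sqrt (f x)).
Proof.
move=> mf; have ms : measurable_fun [set: R] (@Num.sqrt R).
  by apply: continuous_measurable_fun => x; exact: sqrt_continuous.
exact: (measurableT_comp ms).
Qed.

End measurable_operations.

(** * Measurability of Hoelder functions *)

Section hoelder_measurable.
Context {R : realType}.

(** The McShane formula: the function is the infimum of the cones [a q + M * (distance to q)] over
    rational points [q]. Each cone lies above it by hypothesis, cones with nearby vertices come
    arbitrarily close, and a countable infimum of measurable functions is measurable. *)
Lemma measurable_hoelder (a : R -> R -> R) (M al : R) : 0 < al ->
  (forall x y t s, `|a x t - a y s| <= M * (`|x - y| `^ al + `|t - s| `^ (al / 2))) ->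
  measurable_fun [set: R * R] (fun z => a z.1 z.2).
Proof.
move=> al0 ha.
have M0 : 0 <= M.
  have := ha 1 0 0 0; rewrite !subr0 normr1 normr0 powR1 powR0 ?mulf_neq0 ?gt_eqF//.
  by rewrite addr0 mulr1; exact: le_trans.
pose q (n : nat) : R * R :=
  if unpickle n is Some (r1, r2) then (ratr r1, ratr r2) else (0, 0).
pose h (n : nat) (z : R * R) := a (q n).1 (q n).2 +
  M * (`|(q n).1 - z.1| `^ al + `|(q n).2 - z.2| `^ (al / 2)).
have lb n z : a z.1 z.2 <= h n z.
  have := ha z.1 (q n).1 z.2 (q n).2; rewrite /h distrC => /ler_normlP[].
  by rewrite (distrC z.1) (distrC z.2); lra.
have mh n : measurable_fun setT (h n).
  apply: measurable_funD => //; apply: measurable_funM => //; apply: measurable_funD.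
    apply: measurable_fun_powR; apply: measurable_fun_normr.
    exact: measurable_funB.
  by apply: measurable_fun_powR; apply: measurable_fun_normr; exact: measurable_funB.
have hlb z : has_lbound (range (h ^~ z)).
  by exists (a z.1 z.2) => _ [n _ <-]; exact: lb.
have -> : (fun z => a z.1 z.2) = (fun z => infs (h ^~ z) 0); last first.
  by apply: measurable_fun_infs => //.
apply/funext => z; rewrite /infs/=.
have sE : sdrop (h ^~ z) 0%N = range (h ^~ z).
  by rewrite /sdrop; congr image; apply/seteqP; split.
rewrite sE; apply/eqP; rewrite eq_le; apply/andP; split.
  apply: lb_le_inf; first by exists (h 0%N z), 0%N.
  by move=> _ [n _ <-]; exact: lb.
apply/ler_addgt0Pr => e e0.
have cp (p : R) : 0 < p -> forall e', 0 < e' -> exists2 dl, 0 < dl & forall u, 0 <= u < dl -> u `^ p <= e'.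
  move=> p0 e' e'0; exists (e' `^ p^-1); first exact: powR_gt0.
  move=> u /andP[u0 ud].
  rewrite -[leRHS](_ : (e' `^ p^-1) `^ p = e'); last first.
    by rewrite -powRrM mulVf ?gt_eqF// powRr1// ltW.
  by apply: ge0_ler_powR; rewrite ?nnegrE ?powR_ge0 ?(ltW p0)// ltW.
(* The error is twice [M * (e' + e')]: once for the cone and once for the value at its vertex. *)
pose e' := e / (4 * (M + 1)).
have e'0 : 0 < e' by rewrite divr_gt0// mulr_gt0//; lra.
have [d1 d10 hd1] := cp _ al0 _ e'0.
have al20 : 0 < al / 2 by lra.
have [d2 d20 hd2] := cp _ al20 _ e'0.
have [r1 hr1] := @rat_in_itvoo R z.1 (z.1 + d1) ltac:(by rewrite ltrDl).
have [r2 hr2] := @rat_in_itvoo R z.2 (z.2 + d2) ltac:(by rewrite ltrDl).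
have qE : q (pickle (r1, r2)) = (ratr r1, ratr r2) by rewrite /q pickleK.
apply: (@le_trans _ _ (h (pickle (r1, r2)) z)).
  by apply: ge_inf => //; exists (pickle (r1, r2)).
rewrite /h qE/=.
move: hr1 hr2; rewrite !in_itv/= => hr1 hr2.
have k1 : `|ratr r1 - z.1| `^ al <= e'.
  by apply: hd1; rewrite normr_ge0/= ger0_norm; lra.
have k2 : `|ratr r2 - z.2| `^ (al / 2) <= e'.
  by apply: hd2; rewrite normr_ge0/= ger0_norm; lra.
have /ler_normlP[_ k3] := ha (ratr r1) z.1 (ratr r2) z.2.
have k4 : M * (`|ratr r1 - z.1| `^ al + `|ratr r2 - z.2| `^ (al / 2)) <= M * (e' + e').
  by rewrite ler_wpM2l// lerD.
have k5 : M * (e' + e') <= e / 2.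
  have -> : e / 2 = (M + 1) * (e' + e') by rewrite /e'; field; lra.
  by rewrite ler_wpM2r//; lra.
lra.
Qed.

End hoelder_measurable.

(** * Integrals up to a moving end point *)

Section moving_endpoint.
Context {R : realType}.
Let mu := @lebesgue_measure R.

Lemma dist3_le (x y z w e : R) : `|x - y| <= e / 3 -> `|y - z| <= e / 3 ->
  `|w - z| <= e / 3 -> `|x - w| <= e.
Proof. by rewrite !ler_norml; lra. Qed.

Lemma le_powR_neg (r u v : R) : 0 < u -> u <= v -> r <= 0 -> v `^ r <= u `^ r.
Proof.
move=> u0 uv r0; rewrite -(opprK r) (powRN v) (powRN u).
rewrite lef_pV2 ?posrE ?powR_gt0//; last exact: lt_le_trans uv.
by apply: ge0_ler_powR; rewrite ?nnegrE; lra.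
Qed.

Lemma le_powR_sub1 (r u v : R) : 0 < u -> u <= v -> r <= 1 ->
  v `^ (r - 1) <= u `^ (r - 1).
Proof. by move=> u0 uv r1; apply: le_powR_neg; rewrite ?subr_le0. Qed.

Lemma powR_small (p e : R) : 0 < p -> 0 < e ->
  exists2 dl, 0 < dl & forall u, 0 <= u <= dl -> u `^ p <= e.
Proof.
move=> p0 e0; exists (e `^ p^-1); first exact: powR_gt0.
move=> u /andP[u0 ud].
rewrite -[leRHS](_ : (e `^ p^-1) `^ p = e); last first.
  by rewrite -powRrM mulVf ?gt_eqF// powRr1// ltW.
by apply: ge0_ler_powR; rewrite ?nnegrE ?powR_ge0 ?(ltW p0).
Qed.

Lemma endpoint_bound_ge0 (A B p q tau t s : R) : 0 <= A -> 0 <= B ->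
  0 <= endpoint_bound A B p q tau t s.
Proof. by move=> A0 B0; rewrite addr_ge0// mulr_ge0// powR_ge0. Qed.

Section tail.
Variables (A B p q tau : R).
Hypotheses (A0 : 0 <= A) (B0 : 0 <= B) (p0 : 0 < p) (q0 : 0 < q) (q1 : q <= 1).

Lemma endpoint_integrable (f : R -> R) t : tau < t -> measurable_fun setT f ->
  (forall s, tau < s < t -> `|f s| <= endpoint_bound A B p q tau t s) ->
  mu.-integrable `]tau, t[ (EFin \o f).
Proof.
move=> taut mf hf.
apply: (@integrable_le _ _ _ (endpoint_bound A B p q tau t)) => //.
- exact: measurable_funTS.
- have [i _] := integral_endpoint_bound A B taut p0 q0; exact: i.
Qed.

(** Past [a] the singularity at [tau] is replaced by its value at [a], an upper bound as [q <= 1];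
    what is left is explicit and small when [t - a] is small. *)
Lemma endpoint_split (f : R -> R) t a : tau < a < t -> measurable_fun setT f ->
  (forall s, tau < s < t -> `|f s| <= endpoint_bound A B p q tau t s) ->
  `|\int[mu]_(s in `]tau, t[) f s - \int[mu]_(s in `]tau, a]) f s| <=
  A * (a - tau) `^ (q - 1) * (t - a) + B * ((t - a) `^ p / p).
Proof.
move=> /andP[taua at_] mf hf.
have taut : tau < t by lra.
rewrite (@Rintegral_itvB _ _ (BRight tau) (BLeft t) a)//; last 2 first.
- exact: endpoint_integrable.
- by rewrite bnd_simp ltW.
have [i e] := integral_endpoint_bound (A * (a - tau) `^ (q - 1)) B at_ p0 ltr01.
have -> : A * (a - tau) `^ (q - 1) * (t - a) + B * ((t - a) `^ p / p) =
  \int[mu]_(s in `]a, t[) endpoint_bound (A * (a - tau) `^ (q - 1)) B p 1 a t s.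
  by rewrite e powRr1 ?subr_ge0 ?ltW// divr1.
apply: Rintegral_norm_le => //; first exact: measurable_funTS.
move=> s; rewrite set_ooE => /andP[as_ st].
rewrite (le_trans (hf s _))//; first lra.
rewrite /endpoint_bound subrr powRr0 mulr1 lerD2r ler_wpM2l//.
by apply: le_powR_sub1 => //; lra.
Qed.

(** Dominated convergence does not apply directly: the interval and the singular point of the
    majorant both move with [n]. Cutting at a fixed [a] slightly below [t] leaves tails that are
    small for all large [n], and a fixed interval []tau, a]] on which one majorant suffices. *)
Lemma cvg_Rintegral_moving (f : nat -> R -> R) (g : R -> R) (tn : nat -> R) t :
  tau < t -> (forall n, tau < tn n) -> tn @ \oo --> t ->
  (forall n, measurable_fun setT (f n)) -> measurable_fun setT g ->
  (forall n s, tau < s < tn n -> `|f n s| <= endpoint_bound A B p q tau (tn n) s) ->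
  (forall s, tau < s < t -> `|g s| <= endpoint_bound A B p q tau t s) ->
  (forall s, tau < s < t -> f ^~ s @ \oo --> g s) -> p <= 1 ->
  \int[mu]_(s in `]tau, tn n[) f n s @[n --> \oo] --> \int[mu]_(s in `]tau, t[) g s.
Proof.
move=> taut taun cvt mf mg hf hg fg p1.
apply/cvgrPdist_le => e e0.
pose D0 := (t - tau) / 2; have D00 : 0 < D0 by rewrite /D0; lra.
pose c := A * D0 `^ (q - 1) * 2.
have c0 : 0 <= c by rewrite !mulr_ge0 ?powR_ge0.
have e1 : 0 < e / (3 * (2 * (B / p + 1))).
  by rewrite divr_gt0// !mulr_gt0// ltr_wpDl// divr_ge0// ltW.
have [d1 d10 hd1] := powR_small p0 e1.
(* The three bounds on [dl] keep [a] at distance at least [D0] from [tau], make the tail of the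
   moving singularity small, and make the tail of the singularity at [tau] small. Lengths up to
   [2 * dl] are allowed for, since [tn n] may exceed [t]. *)
pose dl := Num.min (Num.min D0 (d1 / 2)) (e / (3 * (2 * (c + 1)))).
have dl0 : 0 < dl.
  by rewrite !lt_min D00 !divr_gt0// !mulr_gt0//; lra.
have [dlD0 dld1 dle] : [/\ dl <= D0, dl <= d1 / 2 & dl <= e / (3 * (2 * (c + 1)))].
  by rewrite /dl !ge_min !lexx !orbT.
pose a := t - dl.
have taua : tau < a by rewrite /a; move: dlD0; rewrite /D0; lra.
have at_ : a < t by rewrite /a; lra.
have dl2 : 0 < dl / 2 by lra.
have tail_le t' : a < t' -> t' - a <= 2 * dl ->
    A * (a - tau) `^ (q - 1) * (t' - a) + B * ((t' - a) `^ p / p) <= e / 3.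
  move=> at' t'a.
  have h1 : A * (a - tau) `^ (q - 1) * (t' - a) <= e / 3 / 2.
    apply: (@le_trans _ _ (A * D0 `^ (q - 1) * (2 * dl))).
      rewrite ler_pM ?mulr_ge0 ?powR_ge0//; first lra.
      rewrite ler_wpM2l//; apply: le_powR_sub1 => //.
      by rewrite /a; move: dlD0; rewrite /D0; lra.
    rewrite (_ : _ * (2 * dl) = c * dl); last by rewrite /c; ring.
    apply: (@le_trans _ _ ((c + 1) * dl)); first by rewrite ler_wpM2r; lra.
    rewrite mulrC -ler_pdivlMr; last lra.
    apply: (le_trans dle); rewrite le_eqVlt; apply/orP; left; apply/eqP; field; lra.
  have h2 : B * ((t' - a) `^ p / p) <= e / 3 / 2.
    have hp : (t' - a) `^ p <= e / (3 * (2 * (B / p + 1))) by apply: hd1; lra.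
    rewrite mulrCA mulrC.
    have Bp : 0 <= B / p by rewrite divr_ge0// ltW.
    move: (B / p) Bp hp => b b0 hp.
    apply: (@le_trans _ _ ((b + 1) * (e / (3 * (2 * (b + 1)))))).
      by rewrite ler_pM ?powR_ge0//; lra.
    by rewrite le_eqVlt; apply/orP; left; apply/eqP; field; lra.
  lra.
have cvD : \int[mu]_(s in `]tau, a]) f n s @[n --> \oo] -->
    \int[mu]_(s in `]tau, a]) g s.
  have [N _ hN] : \forall n \near \oo, `|t - tn n| < dl / 2.
    by move/cvgrPdist_lt : cvt => /(_ _ dl2).
  rewrite -(cvg_shiftn N).
  (* On []tau, a]] the moving end is at distance at least [dl / 2], so its singularity is replaced
     by a constant; the trivial exponent [1 - 1] puts this constant in the form covered by
     [integral_powR_left]. *)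
  apply: (@cvg_integral_dominated _ _ _ _
    (fun s => A * (s - tau) `^ (q - 1) +
      B * (dl / 2) `^ (p - 1) * (s - tau) `^ (1 - 1))) => //.
  - by move=> n; exact: measurable_funTS.
  - exact: measurable_funTS.
  - move=> s; rewrite set_ocE => sa.
    have sT : tau < s < t by lra.
    by have := fg _ sT; rewrite -(cvg_shiftn N).
  - have ta : `]tau, a] `<=` `]tau, t[%classic by apply: subset_itvl; rewrite bnd_simp.
    have ia r : 0 < r -> mu.-integrable `]tau, a] (EFin \o (fun s => (s - tau) `^ (r - 1))).
      by move=> /(integral_powR_left taut)[i _]; apply: integrableS i.
    by apply: integrable_add => //; apply: integrable_scale => //; exact: ia.
  - move=> n s; rewrite set_ocE => sa.
    have := hN (n + N)%N (leq_addl _ _); rewrite /= => /ltr_normlP[h1 h2].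
    rewrite (le_trans (hf _ _ _))//; first by rewrite /a in sa; lra.
    rewrite subrr powRr0 mulr1 /endpoint_bound lerD2l ler_wpM2l//.
    apply: le_powR_sub1 => //.
      by rewrite /a in sa; lra.
have e30 : 0 < e / 3 by lra.
near=> n.
have hn : `|t - tn n| < dl / 2.
  by near: n; move/cvgrPdist_lt : cvt => /(_ _ dl2).
have hDn : `|\int[mu]_(s in `]tau, a]) g s - \int[mu]_(s in `]tau, a]) f n s| <= e / 3.
  by near: n; move/cvgrPdist_le : cvD => /(_ _ e30).
move: hn => /ltr_normlP[hn1 hn2].
have hg' : `|\int[mu]_(s in `]tau, t[) g s - \int[mu]_(s in `]tau, a]) g s| <= e / 3.
  apply: (le_trans (endpoint_split _ mg hg)); first lra.
  by apply: tail_le => //; rewrite /a; lra.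
have hf' : `|\int[mu]_(s in `]tau, tn n[) f n s - \int[mu]_(s in `]tau, a]) f n s| <= e / 3.
  have an : a < tn n by rewrite /a; lra.
  apply: (le_trans (endpoint_split _ (mf n) (hf n))); first lra.
  by apply: tail_le => //; rewrite /a; lra.
exact: dist3_le hg' hDn hf'.
Unshelve. all: by end_near. Qed.

End tail.
End moving_endpoint.

Section pointwise_derivatives.
Context {R : realType}.
Implicit Types (f g : R -> R) (x a b k : R).

Lemma der_eq f x a b : is_derive x 1 f a -> a = b -> is_derive x 1 f b.
Proof. by move=> + <-. Qed.

Lemma derD f g x a b : is_derive x 1 f a -> is_derive x 1 g b ->
  is_derive x 1 (fun y : R => f y + g y) (a + b).
Proof. by move=> df dg; exact: is_deriveD. Qed.

Lemma derM f g x a b : is_derive x 1 f a -> is_derive x 1 g b ->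
  is_derive x 1 (fun y : R => f y * g y) (a * g x + f x * b).
Proof.
move=> df dg; apply: der_eq (is_deriveM df dg) _.
by rewrite /GRing.scale/=; ring.
Qed.

Lemma derZ f x a k : is_derive x 1 f a -> is_derive x 1 (fun y : R => k * f y) (k * a).
Proof. by move=> df; exact: is_deriveZ. Qed.

Lemma derB f g x a b : is_derive x 1 f a -> is_derive x 1 g b ->
  is_derive x 1 (fun y : R => f y - g y) (a - b).
Proof. by move=> df dg; exact: is_deriveB. Qed.

Lemma derid x : is_derive x 1 (fun y : R => y) 1.
Proof. exact: is_derive_id. Qed.

Lemma dercst x k : is_derive x 1 (fun y : R => k) 0.
Proof. exact: is_derive_cst. Qed.

Lemma derexp f x a : is_derive x 1 f a ->
  is_derive x 1 (fun y : R => expR (f y)) (expR (f x) * a).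
Proof. by move=> df; apply: (@is_derive1_comp _ expR f). Qed.

Lemma derinv f x a : f x != 0 -> is_derive x 1 f a ->
  is_derive x 1 (fun y : R => (f y)^-1) (- a / f x ^+ 2).
Proof.
move=> fx df; apply: der_eq (is_deriveV fx df) _.
by rewrite /GRing.scale/=; ring.
Qed.

Lemma is_derive_near f g x a : (\forall y \near x, f y = g y) ->
  is_derive x 1 f a -> is_derive x 1 g a.
Proof. exact: near_eq_is_derive. Qed.

End pointwise_derivatives.

(** * The heat kernel *)

Section heat_kernel.
Context {R : realType}.
Implicit Types (r k u z s : R).

(* [Fr r k u = k^r exp(- k u)].  With [k = 1 / (4 a)] and [u = z^2 / s], [h0] is the heat
   kernel and [hx], [hxx], [hxxx] are its derivatives in [z]; [hxx] is also [4 k] times its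
   derivative in [s]. *)
Definition Fr r k u := expR (r * ln k - k * u).

(** Half-integer powers of the elapsed time are written as natural powers of [isp s], so that the
    kernel estimates reduce to polynomial identities. *)
Definition isp (s : R) := (Num.sqrt s)^-1.
Definition ipi : R := (Num.sqrt pi)^-1.

Definition h0 k z s := ipi * isp s * Fr (1/2) k (z ^+ 2 / s).
Definition hx k z s := ipi * isp s * (- 2 * (z / s)) * Fr (3/2) k (z ^+ 2 / s).
Definition hxx k z s :=
  ipi * isp s * (4 * (z / s) ^+ 2) * Fr (5/2) k (z ^+ 2 / s)
  + ipi * isp s * (- 2 / s) * Fr (3/2) k (z ^+ 2 / s).
Definition hxxx k z s :=
  ipi * isp s * (- 8 * (z / s) ^+ 3) * Fr (7/2) k (z ^+ 2 / s)
  + ipi * isp s * (12 * (z / s / s)) * Fr (5/2) k (z ^+ 2 / s).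

(** Differentiation in [z] produces a factor [k], absorbed here by raising [r] by one; hence the
    exponents [1/2], [3/2], [5/2], [7/2] of the kernels. *)
Lemma FrS r k u : 0 < k -> Fr (r + 1) k u = k * Fr r k u.
Proof.
move=> k0; rewrite /Fr mulrDl mul1r addrAC expRD lnK ?posrE//.
by rewrite mulrC.
Qed.

Lemma ipi_gt0 : 0 < ipi.
Proof. by rewrite invr_gt0 sqrtr_gt0 pi_gt0. Qed.

Lemma expR_half_ln k : 0 < k -> expR (1 / 2 * ln k) = Num.sqrt k.
Proof. by move=> k0; rewrite -powR12_sqrt ?(ltW k0)// /powR gt_eqF// div1r. Qed.

Lemma isp_gt0 s : 0 < s -> 0 < isp s.
Proof. by move=> s0; rewrite invr_gt0 sqrtr_gt0. Qed.

Lemma derFr_z r k z s : 0 < k ->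
  is_derive z 1 (fun z => Fr r k (z ^+ 2 / s)) (- 2 * (z / s) * Fr (r + 1) k (z ^+ 2 / s)).
Proof.
move=> k0; rewrite FrS//.
have D := derB (dercst z (r * ln k)) (derZ k (derM (derM (derid z) (derid z)) (dercst z s^-1))).
apply: der_eq (derexp D) _; rewrite /Fr expr2; ring.
Qed.

Lemma derFr_k r k u : 0 < k ->
  is_derive k 1 (fun k => Fr r k u) ((r / k - u) * Fr r k u).
Proof.
move=> k0.
have D := derB (derZ r (is_derive1_ln k0)) (derM (derid k) (dercst k u)).
by apply: der_eq (derexp D) _; rewrite /Fr; ring.
Qed.

Lemma derFr_kk r k u : 0 < k ->
  is_derive k 1 (fun k => (r / k - u) * Fr r k u)
    (((r / k - u) ^+ 2 - r / k ^+ 2) * Fr r k u).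
Proof.
move=> k0.
have D := derB (derZ r (derinv (lt0r_neq0 k0) (derid k))) (dercst k u).
apply: der_eq (derM D (derFr_k r u k0)) _; field.
by rewrite gt_eqF.
Qed.

Lemma der_h0 k z s : 0 < k -> is_derive z 1 (fun z => h0 k z s) (hx k z s).
Proof.
move=> k0; apply: der_eq (derZ (ipi * isp s) (derFr_z (1/2) z s k0)) _.
by rewrite /hx (_ : 1 / 2 + 1 = 3 / 2 :> R); [ring|lra].
Qed.

Lemma der_hx k z s : 0 < k -> is_derive z 1 (fun z => hx k z s) (hxx k z s).
Proof.
move=> k0.
have D := derZ (ipi * isp s) (derZ (-2) (derM (derid z) (dercst z s^-1))).
apply: der_eq (derM D (derFr_z (3/2) z s k0)) _.
by rewrite /hxx (_ : 3 / 2 + 1 = 5 / 2 :> R); [ring|lra].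
Qed.

Lemma der_hxx k z s : 0 < k -> is_derive z 1 (fun z => hxx k z s) (hxxx k z s).
Proof.
move=> k0.
have Dz := derM (derid z) (dercst z s^-1).
have D1 := derZ (ipi * isp s) (derZ 4 (derM Dz Dz)).
have D2 := derM D1 (derFr_z (5/2) z s k0).
have D3 := derZ (ipi * isp s * (- 2 / s)) (derFr_z (3/2) z s k0).
rewrite (_ : hxx k ^~ s = fun z => ipi * isp s * (4 * (z / s * (z / s))) * Fr (5 / 2) k (z ^+ 2 / s) +
   ipi * isp s * (- 2 / s) * Fr (3 / 2) k (z ^+ 2 / s)); last first.
  by apply/funext => y; rewrite /hxx expr2.
apply: der_eq (derD D2 D3) _.
rewrite /hxxx (_ : 3 / 2 + 1 = 5 / 2 :> R); last lra.
rewrite (_ : 5 / 2 + 1 = 7 / 2 :> R); last lra.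
ring.
Qed.

Lemma der_isp s : 0 < s -> is_derive s 1 isp (- (1/2) * isp s / s).
Proof.
move=> s0.
have D := derexp (derZ (- (1 / 2)) (is_derive1_ln s0)).
have E y : 0 < y -> expR (- (1/2) * ln y) = isp y.
  by move=> y0; rewrite mulNr expRN expR_half_ln.
apply: der_eq; last first.
  by rewrite -(E s s0) -mulrA mulrCA; reflexivity.
apply: is_derive_near D; near=> y; apply: E; near: y.
exact: lt_nbhsr.
Unshelve. all: by end_near. Qed.

Lemma der_h0_s k z s : 0 < k -> 0 < s ->
  is_derive s 1 (fun s => h0 k z s) ((4 * k)^-1 * hxx k z s).
Proof.
move=> k0 s0; have sn : s != 0 by rewrite gt_eqF.
have D1 := derZ (z ^+ 2) (derinv sn (derid s)).
have D2 := derexp (derB (dercst s (1/2 * ln k)) (derZ k D1)).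
have D := derM (derZ ipi (der_isp s0)) D2.
apply: der_eq D _.
rewrite /hxx (_ : 5 / 2 = 3 / 2 + 1 :> R); last lra.
rewrite FrS// (_ : 3 / 2 = 1 / 2 + 1 :> R); last lra.
rewrite FrS// /Fr; field.
by rewrite sn lt0r_neq0.
Qed.

End heat_kernel.

Section heat_kernel_bounds.
Context {R : realType}.
Implicit Types (r k u z s : R).

Section bounds.
Variables (k0 k1 : R).
Hypotheses (k0_gt0 : 0 < k0) (k01 : k0 <= k1).

(** Ellipticity confines [k] to [[k0, k1]], so [k^r] is at most [expR L]. Each derivative in [k]
    raises the degree of the prefactor in [u] by one, whence [(1 + u)^2] for up to two
    derivatives. *)
Lemma Fr_bound r : exists2 C : R, 0 < C & forall k u : R, k0 <= k <= k1 -> 0 <= u ->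
  [/\ `|Fr r k u| <= C * ((1 + u) ^+ 2 * expR (- (k0 * u))),
      `|(r / k - u) * Fr r k u| <= C * ((1 + u) ^+ 2 * expR (- (k0 * u))) &
      `|((r / k - u) ^+ 2 - r / k ^+ 2) * Fr r k u|
        <= C * ((1 + u) ^+ 2 * expR (- (k0 * u)))].
Proof.
pose L := `|r| * (`|ln k0| + `|ln k1|).
pose b := 1 + `|r| / k0 + `|r| / k0 ^+ 2.
have b1 : 1 <= b by rewrite /b -addrA lerDl addr_ge0// divr_ge0// ?exprn_ge0// ltW.
exists (2 * expR L * b ^+ 2); first by rewrite !mulr_gt0 ?exprn_gt0 ?expR_gt0//; lra.
move=> k u kI u0; have k0p := k0_gt0; have k01p := k01.
have k_gt0 : 0 < k by lra.
have FL : Fr r k u <= expR L * expR (- (k0 * u)).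
  rewrite /Fr -expRD ler_expR lerD//; last by rewrite lerN2 ler_wpM2r//; lra.
  rewrite (le_trans (ler_norm _))// normrM ler_wpM2l//.
  have h1 : ln k0 <= ln k by rewrite ler_ln ?posrE//; lra.
  have h2 : ln k <= ln k1 by rewrite ler_ln ?posrE//; lra.
  apply/ler_normlP.
  have := ler_norm (- ln k0); have := ler_norm (ln k1); rewrite normrN.
  by have := normr_ge0 (ln k0); have := normr_ge0 (ln k1); split; lra.
have F0 : 0 <= Fr r k u by exact: expR_ge0.
have E0 : 0 <= expR L * expR (- (k0 * u)) by rewrite mulr_ge0 ?expR_ge0.
have gen p : `|p| <= 2 * b ^+ 2 * (1 + u) ^+ 2 ->
    `|p * Fr r k u| <= 2 * expR L * b ^+ 2 * ((1 + u) ^+ 2 * expR (- (k0 * u))).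
  move=> hp; rewrite normrM (ger0_norm F0) (le_trans (ler_pM _ _ hp FL))//.
  by rewrite le_eqVlt; apply/orP; left; apply/eqP; ring.
have rk : `|r / k| <= `|r| / k0.
  rewrite normrM normfV (gtr0_norm k_gt0) ler_wpM2l// lef_pV2 ?posrE//; lra.
have rk2 : `|r / k ^+ 2| <= `|r| / k0 ^+ 2.
  rewrite normrM normfV normrX (gtr0_norm k_gt0) ler_wpM2l//.
  rewrite lef_pV2 ?posrE ?exprn_gt0// ler_pXn2r// ?nnegrE ?(ltW k_gt0) ?(ltW k0p)//; lra.
have p0 : 0 <= `|r| / k0 by rewrite divr_ge0// ltW.
have p1 : 0 <= `|r| / k0 ^+ 2 by rewrite divr_ge0// exprn_ge0// ltW.
have bb : b <= b ^+ 2 by rewrite expr2 ler_peMl//; lra.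
have uu : 1 + u <= (1 + u) ^+ 2 by rewrite expr2 ler_peMl//; lra.
have h1 : `|r / k - u| <= b * (1 + u).
  rewrite (le_trans (ler_normB _ _))// (ger0_norm u0).
  have : `|r| / k0 * u >= 0 by rewrite mulr_ge0.
  have : `|r| / k0 ^+ 2 * u >= 0 by rewrite mulr_ge0.
  rewrite /b; nra.
have bu : b * (1 + u) <= b ^+ 2 * (1 + u) ^+ 2 by rewrite ler_pM//; lra.
have bu1 : 1 <= b * (1 + u) by nra.
split.
- by rewrite -[X in `|X|]mul1r; apply: gen; rewrite normr1; lra.
- by apply: gen; lra.
- apply: gen; rewrite (le_trans (ler_normB _ _))// normrX.
  have : `|r / k - u| ^+ 2 <= (b * (1 + u)) ^+ 2 by rewrite ler_pXn2r// ?nnegrE//; lra.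
  have : `|r / k ^+ 2| <= b by rewrite /b; lra.
  have : b <= b ^+ 2 * (1 + u) ^+ 2 by apply: (le_trans bb); rewrite ler_peMr ?exprn_ge0// ?(le_trans _ uu); lra.
  rewrite exprMn; lra.
Qed.

End bounds.
End heat_kernel_bounds.

(** * Dependence of the kernels on the coefficient *)

Section kernel_pairs.
Context {R : realType}.
Variables (k0 k1 M : R).
Hypotheses (k0_gt0 : 0 < k0) (k01 : k0 <= k1) (M0 : 0 <= M).

(** The degree [5] is [2] from [Fr_bound] plus [3] from the prefactor [om], cubic because of [hxxx].
    Half of the exponent [k0] is spent on absorbing it. *)
Lemma pbFr (r : R) : exists2 C : R, 0 < C & forall (N p q u om W : R),
  0 <= N -> k0 <= p <= k1 -> k0 <= q <= k1 -> `|p - q| <= N * M -> 0 <= u ->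
  `|om| <= W * (1 + u) ^+ 3 ->
  pb N (C * W * expR (- (k0 / 2 * u))) (om * Fr r p u) (om * Fr r q u).
Proof.
have k0p := k0_gt0; have Mp := M0.
have [C C0 hC] := Fr_bound k0_gt0 k01 r.
have k02 : 0 < k0 / 2 by lra.
have [C' C'0 hC'] := poly_expR_bound 5 k02.
exists (C * C' * (1 + M)); first by rewrite !mulr_gt0//; lra.
move=> N p q u om W N0 hp hq pq u0 hom.
have W0 : 0 <= W.
  have : 0 <= W * (1 + u) ^+ 3 by exact: le_trans hom.
  by rewrite pmulr_lge0// exprn_gt0//; lra.
set B := C * ((1 + u) ^+ 2 * expR (- (k0 * u))).
have B0 : 0 <= B.
  by rewrite !mulr_ge0 ?(ltW C0) ?exprn_ge0 ?expR_ge0//; lra.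
have h : pb N (B * (1 + M)) (Fr r p u) (Fr r q u).
  apply: (@pb_comp _ (fun k => Fr r k u) (fun k => (r / k - u) * Fr r k u) k0 k1) => //.
  - by move=> k kI; apply: derFr_k; lra.
  - by move=> k kI; have [] := hC k u kI u0.
  - by move=> k kI; have [] := hC k u kI u0.
apply: pb_le (pbZ om h) => //.
apply: (@le_trans _ _ (W * (1 + u) ^+ 3 * (B * (1 + M)))).
  by rewrite ler_wpM2r// mulr_ge0//; lra.
have -> : W * (1 + u) ^+ 3 * (B * (1 + M)) =
    C * (1 + M) * W * expR (- (k0 / 2 * u)) * ((1 + u) ^+ 5 * expR (- (k0 / 2 * u))).
  rewrite /B (_ : - (k0 * u) = - (k0 / 2 * u) + - (k0 / 2 * u)); last by field.
  by rewrite expRD; ring.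
rewrite (_ : _ * _ * _ * W * _ = C * (1 + M) * W * expR (- (k0 / 2 * u)) * C'); last by ring.
by rewrite ler_wpM2l ?hC'// !mulr_ge0 ?expR_ge0 ?(ltW C0)//; lra.
Qed.

Lemma pbFr_incr (r : R) : exists2 C : R, 0 < C & forall (N p p' q q' u om W d : R),
  0 <= N -> k0 <= p <= k1 -> k0 <= p' <= k1 -> k0 <= q <= k1 -> k0 <= q' <= k1 ->
  `|p' - q'| <= N * M -> pb N (M * d) (p - p') (q - q') -> 0 <= d -> 0 <= u ->
  `|om| <= W * (1 + u) ^+ 3 ->
  pb N (C * W * d * expR (- (k0 / 2 * u)))
    (om * Fr r p u - om * Fr r p' u) (om * Fr r q u - om * Fr r q' u).
Proof.
have k0p := k0_gt0; have Mp := M0.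
have [C C0 hC] := Fr_bound k0_gt0 k01 r.
have k02 : 0 < k0 / 2 by lra.
have [C' C'0 hC'] := poly_expR_bound 5 k02.
exists (C * C' * (1 + M * (1 + 2 * M))).
  by rewrite !mulr_gt0//; have := mulr_ge0 M0 M0; lra.
move=> N p p' q q' u om W d N0 hp hp' hq hq' pq h d0 u0 hom.
have W0 : 0 <= W.
  have : 0 <= W * (1 + u) ^+ 3 by exact: le_trans hom.
  by rewrite pmulr_lge0// exprn_gt0//; lra.
set B := C * ((1 + u) ^+ 2 * expR (- (k0 * u))).
have B0 : 0 <= B.
  by rewrite !mulr_ge0 ?(ltW C0) ?exprn_ge0 ?expR_ge0//; lra.
have {}h : pb N (B * (M * d * (1 + 2 * M))) (Fr r p u - Fr r p' u) (Fr r q u - Fr r q' u).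
  apply: (@pb_comp_incr _ (fun k => Fr r k u) (fun k => (r / k - u) * Fr r k u)
    (fun k => ((r / k - u) ^+ 2 - r / k ^+ 2) * Fr r k u) k0 k1) => //.
  - by move=> k kI; apply: derFr_k; lra.
  - by move=> k kI; apply: derFr_kk; lra.
  - by move=> k kI; have [] := hC k u kI u0.
  - by move=> k kI; have [] := hC k u kI u0.
rewrite -!mulrBr; apply: pb_le (pbZ om h) => //.
have D0 : 0 <= M * d * (1 + 2 * M) by rewrite !mulr_ge0//; lra.
apply: (@le_trans _ _ (W * (1 + u) ^+ 3 * (B * (M * d * (1 + 2 * M))))).
  by rewrite ler_wpM2r// mulr_ge0.
have -> : W * (1 + u) ^+ 3 * (B * (M * d * (1 + 2 * M))) =
    C * (M * d * (1 + 2 * M)) * W * expR (- (k0 / 2 * u)) * ((1 + u) ^+ 5 * expR (- (k0 / 2 * u))).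
  rewrite /B (_ : - (k0 * u) = - (k0 / 2 * u) + - (k0 / 2 * u)); last by field.
  by rewrite expRD; ring.
apply: (@le_trans _ _ (C * (M * d * (1 + 2 * M)) * W * expR (- (k0 / 2 * u)) * C')).
  by rewrite ler_wpM2l ?hC'// !mulr_ge0 ?expR_ge0 ?(ltW C0)//; lra.
rewrite -subr_ge0 (_ : _ - _ = C * C' * W * d * expR (- (k0 / 2 * u))); last by ring.
by rewrite !mulr_ge0 ?expR_ge0 ?(ltW C0) ?(ltW C'0).
Qed.

Lemma sqr_isp (s : R) : 0 < s -> isp s ^+ 2 = s^-1.
Proof. by move=> s0; rewrite exprVn sqr_sqrtr// ltW. Qed.

Lemma gkE (c z s : R) : 0 < s -> gk c z s = isp s * expR (- (c * (z ^+ 2 / s))).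
Proof. by move=> s0; rewrite /gk powRV2_sqrt// ltW. Qed.

Lemma scaled_variable (z s : R) : 0 < s -> let w := z * isp s in
  [/\ z ^+ 2 / s = w ^+ 2, z / s = isp s * w, s^-1 = isp s ^+ 2 & `|w| <= 1 + w ^+ 2].
Proof.
move=> s0 w; rewrite -sqr_isp// /w; split; [ring|ring|by []|].
rewrite -[X in _ <= 1 + X]real_normK ?num_real//.
have := normr_ge0 (z * isp s); set x := `|_|; nra.
Qed.

Definition kpair (N p q : R) :=
  [/\ 0 <= N, k0 <= p <= k1, k0 <= q <= k1 & `|p - q| <= N * M].

(** In the scaled variable [w = z * isp s] every derivative in [z] costs exactly one factor [isp s]
    and a polynomial in [w], which [pbFr] absorbs. *)
Lemma ker_bounds : exists2 C : R, 0 < C & forall N p q z s : R, kpair N p q -> 0 < s ->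
  [/\ pb N (C * gk (k0 / 2) z s) (h0 p z s) (h0 q z s),
      pb N (C * isp s * gk (k0 / 2) z s) (hx p z s) (hx q z s),
      pb N (C * isp s ^+ 2 * gk (k0 / 2) z s) (hxx p z s) (hxx q z s) &
      pb N (C * isp s ^+ 3 * gk (k0 / 2) z s) (hxxx p z s) (hxxx q z s)].
Proof.
have [C1 C10 h1] := pbFr (1/2); have [C3 C30 h3] := pbFr (3/2).
have [C5 C50 h5] := pbFr (5/2); have [C7 C70 h7] := pbFr (7/2).
have p0 := @ipi_gt0 R.
exists (ipi * (C1 + 2 * C3 + 4 * C5 + 2 * C3 + 8 * C7 + 12 * C5)).
  by rewrite mulr_gt0//; lra.
move=> N p q z s [N0 hp hq pq] s0.
have i0 := isp_gt0 s0.
have [u_w zs_w s_w w1] := scaled_variable z s0.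
set w := z * isp s in u_w zs_w w1.
have u0 : 0 <= w ^+ 2 by exact: sqr_ge0.
have u1 : 1 <= (1 + w ^+ 2) ^+ 3 by rewrite exprn_ege1//; lra.
have u2 : 1 + w ^+ 2 <= (1 + w ^+ 2) ^+ 3.
  by apply: ler_eXnr => //; lra.
have e0 := expR_ge0 (- (k0 / 2 * w ^+ 2)).
rewrite gkE// /h0 /hx /hxx /hxxx u_w zs_w s_w.
have ii0 : 0 < ipi * isp s by rewrite mulr_gt0.
have ge0 n : 0 <= ipi * isp s ^+ n * expR (- (k0 / 2 * w ^+ 2)).
  by rewrite !mulr_ge0 ?exprn_ge0 ?(ltW i0) ?(ltW p0).
have fin n (B C : R) : B = C * (ipi * isp s ^+ n * expR (- (k0 / 2 * w ^+ 2))) ->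
    C <= C1 + 2 * C3 + 4 * C5 + 2 * C3 + 8 * C7 + 12 * C5 ->
    B <= (C1 + 2 * C3 + 4 * C5 + 2 * C3 + 8 * C7 + 12 * C5) *
      (ipi * isp s ^+ n * expR (- (k0 / 2 * w ^+ 2))).
  by move=> -> CC; rewrite ler_wpM2r.
have nm (a b : R) : 0 < a -> `|a * b| = a * `|b|.
  by move=> a0; rewrite normrM gtr0_norm.
split.
- have := h1 N p q _ (ipi * isp s) (ipi * isp s) N0 hp hq pq u0.
  rewrite (gtr0_norm ii0) ler_peMr ?(ltW ii0)// => /(_ isT).
  apply: pb_le => //; apply: le_trans (fin 1%N _ C1 _ _) _; [ring|lra|].
  by rewrite le_eqVlt; apply/orP; left; apply/eqP; ring.
- have := h3 N p q _ (ipi * isp s * (-2 * (isp s * w))) (ipi * isp s * (2 * isp s)) N0 hp hq pq u0.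
  have hom : `|ipi * isp s * (-2 * (isp s * w))| <=
      ipi * isp s * (2 * isp s) * (1 + w ^+ 2) ^+ 3.
    rewrite nm// -[leRHS]mulrA ler_wpM2l ?(ltW ii0)// mulNr normrN nm// -[leRHS]mulrA ler_wpM2l//.
    by rewrite nm// ler_wpM2l ?(ltW i0)//; lra.
  move=> /(_ hom); apply: pb_le => //.
  apply: le_trans (fin 2%N _ (2 * C3) _ _) _; [ring|lra|].
  by rewrite le_eqVlt; apply/orP; left; apply/eqP; ring.
- have hom1 : `|ipi * isp s * (4 * (isp s * w) ^+ 2)| <=
      ipi * isp s * (4 * isp s ^+ 2) * (1 + w ^+ 2) ^+ 3.
    rewrite nm// -[leRHS]mulrA ler_wpM2l ?(ltW ii0)// nm// -[leRHS]mulrA ler_wpM2l//.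
    by rewrite exprMn nm ?exprn_gt0// ler_wpM2l ?exprn_ge0 ?(ltW i0)// ger0_norm//; lra.
  have hom2 : `|ipi * isp s * (-2 * isp s ^+ 2)| <=
      ipi * isp s * (2 * isp s ^+ 2) * (1 + w ^+ 2) ^+ 3.
    rewrite nm// -[leRHS]mulrA ler_wpM2l ?(ltW ii0)// mulNr normrN nm// -[leRHS]mulrA ler_wpM2l//.
    by rewrite gtr0_norm ?exprn_gt0// ler_peMr ?exprn_ge0 ?(ltW i0).
  have := pbD (h5 N p q _ _ _ N0 hp hq pq u0 hom1) (h3 N p q _ _ _ N0 hp hq pq u0 hom2).
  apply: pb_le => //.
  apply: le_trans (fin 3%N _ (4 * C5 + 2 * C3) _ _) _; [ring|lra|].
  by rewrite le_eqVlt; apply/orP; left; apply/eqP; ring.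
- have hom1 : `|ipi * isp s * (-8 * (isp s * w) ^+ 3)| <=
      ipi * isp s * (8 * isp s ^+ 3) * (1 + w ^+ 2) ^+ 3.
    rewrite nm// -[leRHS]mulrA ler_wpM2l ?(ltW ii0)// mulNr normrN nm// -[leRHS]mulrA ler_wpM2l//.
    rewrite exprMn nm ?exprn_gt0// ler_wpM2l ?exprn_ge0 ?(ltW i0)// normrX.
    by rewrite ler_pXn2r// nnegrE; lra.
  have hom2 : `|ipi * isp s * (12 * (isp s * w * isp s ^+ 2))| <=
      ipi * isp s * (12 * isp s ^+ 3) * (1 + w ^+ 2) ^+ 3.
    rewrite nm// -[leRHS]mulrA ler_wpM2l ?(ltW ii0)// nm// -[leRHS]mulrA ler_wpM2l//.
    rewrite (_ : isp s * w * _ = isp s ^+ 3 * w); last by ring.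
    by rewrite nm ?exprn_gt0// ler_wpM2l ?exprn_ge0 ?(ltW i0)//; lra.
  have := pbD (h7 N p q _ _ _ N0 hp hq pq u0 hom1) (h5 N p q _ _ _ N0 hp hq pq u0 hom2).
  apply: pb_le => //.
  apply: le_trans (fin 4%N _ (8 * C7 + 12 * C5) _ _) _; [ring|lra|].
  by rewrite le_eqVlt; apply/orP; left; apply/eqP; ring.
Qed.

(** The kernels of one triple are compared at two parameters [p], [p'], those of the other at [q],
    [q']; [d] is the modulus between the two points where the parameters are taken. Such differences
    arise when the coefficient of a kernel is frozen. *)
Lemma ker_incr_bounds : exists2 C : R, 0 < C & forall N p p' q q' z s d : R,
  kpair N p q -> kpair N p' q' -> pb N (M * d) (p - p') (q - q') -> 0 <= d -> 0 < s ->
  pb N (C * d * gk (k0 / 2) z s) (h0 p z s - h0 p' z s) (h0 q z s - h0 q' z s) /\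
  pb N (C * d * isp s ^+ 2 * gk (k0 / 2) z s)
    (hxx p z s - hxx p' z s) (hxx q z s - hxx q' z s).
Proof.
have [C1 C10 h1] := pbFr_incr (1/2); have [C3 C30 h3] := pbFr_incr (3/2).
have [C5 C50 h5] := pbFr_incr (5/2).
have p0 := @ipi_gt0 R.
exists (ipi * (C1 + 4 * C5 + 2 * C3)); first by rewrite mulr_gt0//; lra.
move=> N p p' q q' z s d [N0 hp hq pq] [_ hp' hq' pq'] hinc d0 s0.
have i0 := isp_gt0 s0.
have [u_w zs_w s_w w1] := scaled_variable z s0.
set w := z * isp s in u_w zs_w w1.
have u0 : 0 <= w ^+ 2 by exact: sqr_ge0.
have u1 : 1 <= (1 + w ^+ 2) ^+ 3 by rewrite exprn_ege1//; lra.
have u2 : 1 + w ^+ 2 <= (1 + w ^+ 2) ^+ 3.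
  by apply: ler_eXnr => //; lra.
have e0 := expR_ge0 (- (k0 / 2 * w ^+ 2)).
rewrite gkE// /h0 /hxx u_w zs_w s_w.
have ii0 : 0 < ipi * isp s by rewrite mulr_gt0.
have ge0 n : 0 <= d * (ipi * isp s ^+ n * expR (- (k0 / 2 * w ^+ 2))).
  by rewrite !mulr_ge0 ?exprn_ge0 ?(ltW i0) ?(ltW p0).
have fin n (B C : R) : B = C * (d * (ipi * isp s ^+ n * expR (- (k0 / 2 * w ^+ 2)))) ->
    C <= C1 + 4 * C5 + 2 * C3 ->
    B <= (C1 + 4 * C5 + 2 * C3) *
      (d * (ipi * isp s ^+ n * expR (- (k0 / 2 * w ^+ 2)))).
  by move=> -> CC; rewrite ler_wpM2r.
have nm (a b : R) : 0 < a -> `|a * b| = a * `|b|.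
  by move=> a0; rewrite normrM gtr0_norm.
split.
- have := h1 N p p' q q' _ (ipi * isp s) (ipi * isp s) d N0 hp hp' hq hq' pq' hinc d0 u0.
  rewrite (gtr0_norm ii0) ler_peMr ?(ltW ii0)// => /(_ isT).
  apply: pb_le => //; apply: le_trans (fin 1%N _ C1 _ _) _; [ring|lra|].
  by rewrite le_eqVlt; apply/orP; left; apply/eqP; ring.
- have hom1 : `|ipi * isp s * (4 * (isp s * w) ^+ 2)| <=
      ipi * isp s * (4 * isp s ^+ 2) * (1 + w ^+ 2) ^+ 3.
    rewrite nm// -[leRHS]mulrA ler_wpM2l ?(ltW ii0)// nm// -[leRHS]mulrA ler_wpM2l//.
    by rewrite exprMn nm ?exprn_gt0// ler_wpM2l ?exprn_ge0 ?(ltW i0)// ger0_norm//; lra.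
  have hom2 : `|ipi * isp s * (-2 * isp s ^+ 2)| <=
      ipi * isp s * (2 * isp s ^+ 2) * (1 + w ^+ 2) ^+ 3.
    rewrite nm// -[leRHS]mulrA ler_wpM2l ?(ltW ii0)// mulNr normrN nm// -[leRHS]mulrA ler_wpM2l//.
    by rewrite gtr0_norm ?exprn_gt0// ler_peMr ?exprn_ge0 ?(ltW i0).
  have := pbD (h5 N p p' q q' _ _ _ d N0 hp hp' hq hq' pq' hinc d0 u0 hom1)
    (h3 N p p' q q' _ _ _ d N0 hp hp' hq hq' pq' hinc d0 u0 hom2).
  have E (a b a' b' : R) : a - a' + (b - b') = a + b - (a' + b') by ring.
  rewrite !E; apply: pb_le => //.
  apply: le_trans (fin 3%N _ (4 * C5 + 2 * C3) _ _) _; [ring|lra|].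
  by rewrite le_eqVlt; apply/orP; left; apply/eqP; ring.
Qed.

End kernel_pairs.

(** * Pairs of coefficient triples and the first kernel *)

Section coefficient_pairs.
Context {R : realType}.
Implicit Types (v w : coeffs R) (x y t s xi tau : R).

(* The modulus in the denominator of [holder_norm]. *)
Definition hd (al x y t s : R) := `|x - y| `^ al + `|t - s| `^ (al / 2).

Definition kap v x t := (4 * ca v x t)^-1.

(** All that the estimates use about two admissible triples. The bounds hold at all real times, and
    one constant [A] serves for sizes and Hoelder quotients. *)
Record coef_pair (al lam rho A N : R) v w : Prop := CoefPair {
  cp_N : 0 <= N;
  cp_v : forall x t, lam <= ca v x t <= rho;
  cp_w : forall x t, lam <= ca w x t <= rho;
  cp_a : forall x t, pb N A (ca v x t) (ca w x t);
  cp_b : forall x t, pb N A (cb v x t) (cb w x t);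
  cp_c : forall x t, pb N A (cc v x t) (cc w x t);
  cp_ah : forall x y t s,
    pb N (A * hd al x y t s) (ca v x t - ca v y s) (ca w x t - ca w y s);
  cp_bh : forall x y t s,
    pb N (A * hd al x y t s) (cb v x t - cb v y s) (cb w x t - cb w y s);
  cp_ch : forall x y t s,
    pb N (A * hd al x y t s) (cc v x t - cc v y s) (cc w x t - cc w y s)
}.

Lemma coef_pair_l al lam rho A N v w :
  coef_pair al lam rho A N v w -> coef_pair al lam rho A 0 v v.
Proof.
case=> N0 hv hw ha hb hc hah hbh hch; split=> // *.
- exact: (pb_sym0 (ha _ _)).1.
- exact: (pb_sym0 (hb _ _)).1.
- exact: (pb_sym0 (hc _ _)).1.
- exact: (pb_sym0 (hah _ _ _ _)).1.
- exact: (pb_sym0 (hbh _ _ _ _)).1.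
- exact: (pb_sym0 (hch _ _ _ _)).1.
Qed.

Lemma coef_pair_r al lam rho A N v w :
  coef_pair al lam rho A N v w -> coef_pair al lam rho A 0 w w.
Proof.
case=> N0 hv hw ha hb hc hah hbh hch; split=> // *.
- exact: (pb_sym0 (ha _ _)).2.
- exact: (pb_sym0 (hb _ _)).2.
- exact: (pb_sym0 (hc _ _)).2.
- exact: (pb_sym0 (hah _ _ _ _)).2.
- exact: (pb_sym0 (hbh _ _ _ _)).2.
- exact: (pb_sym0 (hch _ _ _ _)).2.
Qed.

Lemma hd_ge0 al x y t s : 0 <= hd al x y t s.
Proof. by rewrite addr_ge0// powR_ge0. Qed.

(** The map from [a] to [1 / (4 a)] has bounded first and second derivatives on [[lam, rho]], so
    paired bounds and paired Hoelder increments pass from [a] to the parameter of the kernels. *)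
Lemma kap_pairs (al lam rho A : R) : 0 < lam -> lam <= rho -> 1 <= A ->
  exists2 M : R, 0 <= M & forall N v w, coef_pair al lam rho A N v w ->
  (forall x t, kpair (4 * rho)^-1 (4 * lam)^-1 M N (kap v x t) (kap w x t)) /\
  (forall x y t s, pb N (M * hd al x y t s)
    (kap v x t - kap v y s) (kap w x t - kap w y s)).
Proof.
move=> lam0 lamrho A1.
pose B := (4^-1 * lam^-1) + (4^-1 * lam ^- 2) + (2^-1 * lam ^- 3).
pose F (a : R) := 4^-1 * a^-1; pose F1 (a : R) := 4^-1 * (- 1 / a ^+ 2).
pose F2 (a : R) := 2^-1 * a ^- 3.
have [p1 p2 p3] : [/\ 0 < 4^-1 * lam^-1 , 0 < 4^-1 * lam ^- 2 & 0 < 2^-1 * lam ^- 3].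
  by split; rewrite mulr_gt0// invr_gt0// exprn_gt0.
have B0 : 0 <= B by rewrite /B; lra.
have dF a : lam <= a <= rho -> is_derive a 1 F (F1 a).
  move=> aI; have a0 : 0 < a by lra.
  exact: (derZ 4^-1 (derinv (lt0r_neq0 a0) (derid a))).
have dF1 a : lam <= a <= rho -> is_derive a 1 F1 (F2 a).
  move=> aI; have a0 : 0 < a by lra.
  have aa : a * a != 0 by rewrite mulf_neq0// gt_eqF.
  have D := derZ 4^-1 (derZ (-1) (@derinv R (fun a => a * a) a _ aa (derM (derid a) (derid a)))).
  rewrite (_ : F1 = fun y => 4^-1 * (-1 * (y * y)^-1))//.
  by apply: der_eq D _; rewrite /F2; field; rewrite gt_eqF.
have le_inv n (a : R) : lam <= a -> a ^- n <= lam ^- n.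
  move=> aI; rewrite lef_pV2 ?posrE ?exprn_gt0//; last lra.
  by rewrite lerXn2r// nnegrE; lra.
have bF1 a : lam <= a <= rho -> `|F1 a| <= B.
  move=> aI; rewrite /F1 mulN1r mulrN normrN gtr0_norm; last first.
    by rewrite mulr_gt0// invr_gt0 exprn_gt0//; lra.
  apply: (@le_trans _ _ (4^-1 * lam ^- 2)); last by rewrite /B; lra.
  by rewrite ler_wpM2l// le_inv//; lra.
have bF2 a : lam <= a <= rho -> `|F2 a| <= B.
  move=> aI; rewrite /F2 gtr0_norm; last first.
    by rewrite mulr_gt0// invr_gt0 exprn_gt0//; lra.
  apply: (@le_trans _ _ (2^-1 * lam ^- 3)); last by rewrite /B; lra.
  by rewrite ler_wpM2l// le_inv//; lra.
have kF v x t : kap v x t = F (ca v x t) by rewrite /kap /F invfM.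
exists (B * A * (1 + 2 * A)); first by rewrite !mulr_ge0//; lra.
move=> N v w h; have N0 := cp_N h.
have AA : A <= A * (1 + 2 * A) by rewrite ler_peMr//; lra.
split=> [x t|x y t s].
  have kI u : lam <= ca u x t <= rho -> (4 * rho)^-1 <= kap u x t <= (4 * lam)^-1.
    by move=> uI; rewrite /kap !lef_pV2 ?posrE; lra.
  split=> //; [exact/kI/(cp_v h)|exact/kI/(cp_w h)|].
  rewrite !kF (le_trans (lipschitz_deriv dF bF1 (cp_v h x t) (cp_w h x t)))//.
  have [_ _ ab] := cp_a h x t.
  rewrite (le_trans (ler_wpM2l B0 ab))// mulrCA ler_wpM2l// -mulrA ler_wpM2l//.
rewrite !kF.
have [_ _ ab] := cp_a h y s.
have := pb_comp_incr dF dF1 bF1 bF2 _ N0 (cp_v h x t) (cp_v h y s) (cp_w h x t)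
  (cp_w h y s) ab (cp_ah h x y t s).
have -> : B * (A * hd al x y t s * (1 + 2 * A)) =
  B * A * (1 + 2 * A) * hd al x y t s by ring.
by apply; lra.
Qed.

Lemma Z_h0 v x t xi tau : 0 < ca v xi tau -> tau < t ->
  parametrixZ v x t xi tau = h0 (kap v xi tau) (x - xi) (t - tau).
Proof.
move=> a0 tt; have s0 : 0 < t - tau by lra.
rewrite /parametrixZ /h0 /Fr /kap.
have k0 : 0 < (4 * ca v xi tau)^-1 by rewrite invr_gt0 mulr_gt0.
rewrite expRD.
rewrite expR_half_ln// sqrtrV ?mulr_ge0 ?(ltW a0)//.
have -> : 4 * pi * ca v xi tau * (t - tau) = pi * ((4 * ca v xi tau) * (t - tau)) by ring.
rewrite (sqrtrM _ (pi_ge0 R)) sqrtrM ?mulr_ge0 ?(ltW a0)//.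
rewrite /ipi /isp !invfM -!mulrA; congr (_ * _).
rewrite [LHS]mulrCA; congr (_ * (_ * _)).
by congr expR; field; rewrite !gt_eqF.
Qed.

(** The square root of a nonpositive number is [0], and so is its inverse. Vanishing for [t <= tau]
    makes everything built from the parametrix measurable on the whole space. *)
Lemma Z_eq0 v x t xi tau : 0 < ca v xi tau -> t <= tau -> parametrixZ v x t xi tau = 0.
Proof.
move=> a0 tt; rewrite /parametrixZ ler0_sqrtr ?invr0 ?mul0r//.
by rewrite pmulr_rle0 ?subr_le0// !mulr_gt0// pi_gt0.
Qed.

Lemma der_Z v x t xi tau : 0 < ca v xi tau -> tau < t ->
  is_derive x 1 (fun z => parametrixZ v z t xi tau) (hx (kap v xi tau) (x - xi) (t - tau)).
Proof.
move=> a0 tt.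
rewrite (_ : (fun _ => _) = (fun z => h0 (kap v xi tau) z (t - tau)) \o (fun z => z - xi)).
  rewrite -[hx _ _ _]mulr1; apply: is_derive1_comp; last exact: is_derive_shift.
  by apply: der_h0; rewrite invr_gt0 mulr_gt0.
by apply/funext => z /=; rewrite Z_h0.
Qed.

Lemma derive1_Z v x t xi tau : 0 < ca v xi tau -> tau < t ->
  derive1 (fun z => parametrixZ v z t xi tau) x = hx (kap v xi tau) (x - xi) (t - tau).
Proof. by move=> a0 tt; rewrite derive1E; have [_ ->] := der_Z x a0 tt. Qed.

Lemma der_derive1_Z v x t xi tau : 0 < ca v xi tau -> tau < t ->
  is_derive x 1 (derive1 (fun z => parametrixZ v z t xi tau))
    (hxx (kap v xi tau) (x - xi) (t - tau)).
Proof.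
move=> a0 tt.
rewrite (_ : derive1 _ = (fun z => hx (kap v xi tau) z (t - tau)) \o (fun z => z - xi)).
  rewrite -[hxx _ _ _]mulr1; apply: is_derive1_comp; last exact: is_derive_shift.
  by apply: der_hx; rewrite invr_gt0 mulr_gt0.
by apply/funext => z /=; rewrite derive1_Z.
Qed.

Lemma LZ1E v x t xi tau : 0 < ca v xi tau -> tau < t -> LZ1 v x t xi tau =
  (ca v xi tau - ca v x t) * hxx (kap v xi tau) (x - xi) (t - tau) +
  cb v x t * hx (kap v xi tau) (x - xi) (t - tau) +
  cc v x t * h0 (kap v xi tau) (x - xi) (t - tau).
Proof.
move=> a0 tt; rewrite /LZ1 Z_h0// derive1_Z// derive1nS derive1n1.
by rewrite derive1E; have [_ ->] := der_derive1_Z x a0 tt.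
Qed.

Lemma LZ1_eq0 v x t xi tau : 0 < ca v xi tau -> t <= tau -> LZ1 v x t xi tau = 0.
Proof.
move=> a0 tt; rewrite /LZ1.
have -> : (fun z => parametrixZ v z t xi tau) = cst 0.
  by apply/funext => z; rewrite Z_eq0.
have d0 : derive1 (cst (0 : R)) = cst 0 by apply/funext => z; rewrite derive1_cst.
by rewrite derive1nS derive1n1 !d0 Z_eq0// !mulr0 !addr0.
Qed.

End coefficient_pairs.

(** * Comparison of Gaussian and time weights *)

Section gaussian_weights.
Context {R : realType}.
Implicit Types (c z s x y al : R).

Lemma gk_le c c' z s : 0 < s -> c <= c' -> gk c' z s <= gk c z s.
Proof.
move=> s0 cc; rewrite /gk ler_wpM2l ?powR_ge0// ler_expR lerN2 ler_wpM2r//.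
by rewrite divr_ge0 ?sqr_ge0// ltW.
Qed.

Lemma gk_absorb (n : nat) c c' : c < c' -> exists2 C : R, 0 < C &
  forall z s, 0 < s -> (1 + z ^+ 2 / s) ^+ n * gk c' z s <= C * gk c z s.
Proof.
move=> cc; have d0 : 0 < c' - c by lra.
have [C C0 hC] := poly_expR_bound n d0.
exists C => // z s s0.
have u0 : 0 <= z ^+ 2 / s by rewrite divr_ge0 ?sqr_ge0// ltW.
rewrite /gk (_ : - (c' * (z ^+ 2 / s)) =
  - ((c' - c) * (z ^+ 2 / s)) + - (c * (z ^+ 2 / s))); last by ring.
rewrite expRD; set E := expR (- (c * _)); set p := s `^ _.
rewrite (_ : _ * (p * _) = p * ((1 + z ^+ 2 / s) ^+ n * expR (- ((c' - c) * (z ^+ 2 / s))) * E)); last by ring.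
rewrite (_ : C * _ = p * (C * E)); last by ring.
rewrite ler_wpM2l ?powR_ge0// ler_wpM2r ?expR_ge0//.
exact: hC.
Qed.

(** A shift by at most [sqrt s] turns [z^2 / s] into at most [2 z^2 / s + 2], hence the halved
    exponent and the factor [expR c]. *)
Lemma gk_shift c z z' s : 0 <= c -> 0 < s -> (z - z') ^+ 2 <= s ->
  gk c z s <= expR c * gk (c / 2) z' s.
Proof.
move=> c0 s0 zz; rewrite /gk [leRHS]mulrCA ler_wpM2l ?powR_ge0// -expRD ler_expR.
have : c * (z' ^+ 2 / s) <= c * ((2 * z ^+ 2 + 2 * s) / s).
  rewrite ler_wpM2l// ler_wpM2r ?invr_ge0 ?(ltW s0)//.
  by have := sqr_ge0 (2 * z - z'); lra.
rewrite (_ : (2 * z ^+ 2 + 2 * s) / s = 2 * (z ^+ 2 / s) + 2); last by field; rewrite gt_eqF.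
by move: (z ^+ 2 / s) (z' ^+ 2 / s) => u u'; nra.
Qed.

Lemma powRDp (s a b : R) : 0 < s -> s `^ (a + b) = s `^ a * s `^ b.
Proof. by move=> s0; rewrite powRD//; apply/implyP => _; rewrite gt_eqF. Qed.

Lemma isp_powR s : 0 < s -> isp s = s `^ (- (1/2)).
Proof.
by move=> s0; rewrite /isp -powR12_sqrt ?ltW// -powRN; congr (_ `^ _); lra.
Qed.

(** This is how Hoelder continuity gains time: next to a Gaussian, [|z|^al] is worth [s^(al/2)] once
    a polynomial in [z^2 / s] has been absorbed. The scaled variable to the power [al] is at most
    [1] or at most linear, according to its size. *)
Lemma powR_abs_le al z s : 0 < al -> al <= 1 -> 0 < s ->
  `|z| `^ al <= s `^ (al / 2) * (1 + z ^+ 2 / s).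
Proof.
move=> al0 al1 s0.
have i0 := isp_gt0 s0.
have zE : `|z| = `|z * isp s| * (s `^ (1/2)).
  rewrite normrM (gtr0_norm i0) isp_powR// -mulrA -powRDp//.
  by rewrite addNr powRr0 mulr1.
rewrite {1}zE powRM ?normr_ge0 ?powR_ge0// mulrC -powRrM.
rewrite (_ : 1 / 2 * al = al / 2); last by field.
rewrite ler_wpM2l ?powR_ge0//.
have [-> _ _ _] := scaled_variable z s0.
rewrite -[X in 1 + X](real_normK (num_real _)).
have := normr_ge0 (z * isp s); move: `|z * isp s| => w w0.
have [w1|w1] := leP w 1.
  apply: (@le_trans _ _ 1); last by rewrite lerDl sqr_ge0.
  have : w `^ al <= 1 `^ al by apply: ge0_ler_powR; rewrite ?nnegrE//; lra.
  by rewrite powR1.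
apply: (@le_trans _ _ w); last by nra.
by apply: ler1_powR => //; lra.
Qed.

(** The exponent is [-1] from the second derivative of the heat kernel plus the gain [al / 2]; being
    above [-1], it is integrable. *)
Definition tw al s := s `^ (al / 2 - 1).

Lemma tw_ge0 al s : 0 <= tw al s. Proof. exact: powR_ge0. Qed.

Lemma twE al s : 0 < s -> isp s ^+ 2 * s `^ (al / 2) = tw al s.
Proof.
move=> s0; rewrite sqr_isp// -powR_inv1 ?ltW// -powRDp// /tw.
by congr (_ `^ _); ring.
Qed.

(** On [(0, S]] a weaker singularity is compared with a stronger one at the price of a factor [S];
    this is one of the places where constants come to depend on [T]. *)
Lemma powR_ratio_le (S s a b : R) : 1 <= S -> 0 < s -> s <= S -> b <= a -> a - b <= 1 ->
  s `^ a <= S * s `^ b.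
Proof.
move=> S1 s0 sS ba ab1.
have aE : a = (a - b) + b by rewrite subrK.
rewrite {1}aE powRDp// ler_wpM2r ?powR_ge0//.
apply: (@le_trans _ _ (S `^ (a - b))).
  by apply: ge0_ler_powR; rewrite ?nnegrE ?subr_ge0//; lra.
by apply: ler1_powR.
Qed.

Lemma isp_le_tw al (S s : R) : al <= 1 -> 0 < al -> 1 <= S -> 0 < s -> s <= S ->
  isp s <= S * tw al s.
Proof. by move=> *; rewrite isp_powR//; apply: powR_ratio_le => //; lra. Qed.

Lemma one_le_tw al (S s : R) : al <= 1 -> 0 < al -> 1 <= S -> 0 < s -> s <= S ->
  1 <= S * tw al s.
Proof. by move=> *; rewrite -[leLHS](powRr0 s); apply: powR_ratio_le => //; lra. Qed.

Lemma hd_le al x y t tau : 0 < al -> al <= 1 -> tau < t ->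
  hd al x y t tau <= 2 * ((t - tau) `^ (al / 2) * (1 + (x - y) ^+ 2 / (t - tau))).
Proof.
move=> al0 al1 tt; have s0 : 0 < t - tau by lra.
rewrite /hd (gtr0_norm s0) mulr_natl mulr2n lerD//; first exact: powR_abs_le.
by rewrite ler_peMr ?powR_ge0// lerDl divr_ge0 ?sqr_ge0// ltW.
Qed.

Lemma pb_mvt (N B : R) (F G F' G' : R -> R) z z' : 0 <= N ->
  (forall y, is_derive y 1 F (F' y)) -> (forall y, is_derive y 1 G (G' y)) ->
  (forall y, Num.min z z' <= y <= Num.max z z' -> pb N B (F' y) (G' y)) ->
  pb N (B * `|z - z'|) (F z - F z') (G z - G z').
Proof.
move=> N0 dF dG hB.
have zI : Num.min z z' <= z <= Num.max z z' by rewrite ge_min le_max lexx.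
have zI' : Num.min z z' <= z' <= Num.max z z' by rewrite ge_min le_max lexx !orbT.
split.
- by apply: (lipschitz_deriv (k0 := Num.min z z') (k1 := Num.max z z') (fun y _ => dF y)) => // y /hB[].
- by apply: (lipschitz_deriv (k0 := Num.min z z') (k1 := Num.max z z') (fun y _ => dG y)) => // y /hB[].
- rewrite (_ : _ - _ = (F z - G z) - (F z' - G z')); last by ring.
  rewrite mulrA.
  apply: (lipschitz_deriv (F := fun y => F y - G y) (k0 := Num.min z z')
    (k1 := Num.max z z') (fun y _ => derB (dF y) (dG y))) => //.
  by move=> y /hB[].
Qed.

End gaussian_weights.

(** * The parametrix series *)

Section first_kernel.
Context {R : realType}.
Variables (al lam rho A S : R).
Hypotheses (al0 : 0 < al) (al1 : al <= 1) (lam0 : 0 < lam) (lamrho : lam <= rho)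
  (A1 : 1 <= A) (S1 : 1 <= S).
Let k0 := (4 * rho)^-1.
Let k1 := (4 * lam)^-1.

(* The kernels decay with exponent [k0 / 2]; the gap down to [ckn] pays for polynomial
   factors in [z^2 / s] and for shifts of [z]. *)
Definition ckn (rho : R) := (4 * rho)^-1 / 8.
Let c := ckn rho.

Lemma k0_gt0 : 0 < k0.
Proof. by rewrite invr_gt0 mulr_gt0//; apply: lt_le_trans lamrho. Qed.

Lemma k0_le_k1 : k0 <= k1.
Proof.
have l0 := lam0; have lr := lamrho.
by rewrite lef_pV2 ?posrE; lra.
Qed.

Lemma cp_ca_gt0 N v w : coef_pair al lam rho A N v w -> forall x t, 0 < ca v x t.
Proof.
by move=> h x t; have /andP[h1 _] := cp_v h x t; exact: lt_le_trans h1.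
Qed.

Lemma cp_caw_gt0 N v w : coef_pair al lam rho A N v w -> forall x t, 0 < ca w x t.
Proof.
by move=> h x t; have /andP[h1 _] := cp_w h x t; exact: lt_le_trans h1.
Qed.

Lemma hdC x y t s : hd al x y t s = hd al y x s t :> R.
Proof. by rewrite /hd (distrC x) (distrC t). Qed.

Lemma hd_space x y t : hd al x y t t = `|x - y| `^ al :> R.
Proof. by rewrite /hd subrr normr0 powR0 ?addr0// gt_eqF// divr_gt0. Qed.

(** Only the leading term is critical: [hxx] carries the nonintegrable [s^-1], and the increment of
    [a] in front of it brings back [s^(al/2)]. The terms with [cb] and [cc] are less singular and
    are compared with [tw] on [(0, S]]. *)
Lemma LZ1_bound : exists2 K : R, 0 < K & forall (N : R) v w (x t xi tau : R),
  coef_pair al lam rho A N v w -> tau < t -> t - tau <= S ->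
  pb N (K * tw al (t - tau) * gk c (x - xi) (t - tau)) (LZ1 v x t xi tau) (LZ1 w x t xi tau).
Proof.
have [M M0 hM] := kap_pairs al lam0 lamrho A1.
have k00 := k0_gt0; have A1' := A1; have S1' := S1; have al0' := al0; have al1' := al1.
have [C C0 hC] := ker_bounds k00 k0_le_k1 M0.
have ck : c < k0 / 2 by rewrite /c /ckn -/k0; lra.
have [C' C'0 hC'] := gk_absorb 1 ck.
exists (4 * A * C * C' + 2 * A * C * S + 2 * A * C * S).
  have : 0 < A * C by rewrite mulr_gt0//; lra.
  have : 0 < A * C * C' by rewrite !mulr_gt0//; lra.
  have : 0 < A * C * S by rewrite !mulr_gt0//; lra.
  by rewrite -!(mulrA 2) -!(mulrA 4); lra.
move=> N v w x t xi tau h tt sS.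
have N0 := cp_N h; have s0 : 0 < t - tau by lra.
have [hk _] := hM _ _ _ h.
have [b0 b1 b2 _] := hC _ _ _ (x - xi) _ (hk xi tau) s0.
rewrite !LZ1E//; [|exact: cp_caw_gt0 h _ _|exact: cp_ca_gt0 h _ _].
have tw0 := tw_ge0 al (t - tau); have i0 := isp_gt0 s0.
have g0 := gk_ge0 (k0 / 2) (x - xi) (t - tau).
have gg : gk (k0 / 2) (x - xi) (t - tau) <= gk c (x - xi) (t - tau).
  by apply: gk_le => //; exact: ltW.
have hA := hC' (x - xi) _ s0.
have m0 : 0 <= (t - tau) `^ (al / 2) by exact: powR_ge0.
have hh := hd_le x xi al0 al1 tt.
have E1 := twE al s0.
have i_tw := isp_le_tw al1 al0 S1 s0 sS.
have o_tw := one_le_tw al1 al0 S1 s0 sS.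
have gc0 : 0 <= gk c (x - xi) (t - tau) by exact: gk_ge0.
move: hA hh E1 i_tw o_tw b0 b1 b2 gg g0 tw0 m0 i0 gc0.
set G := gk (k0 / 2) _ _; set g := gk c _ _; set m := (t - tau) `^ _.
set u := (x - xi) ^+ 2 / (t - tau); set W := tw al _; set i := isp _.
clearbody G g m u W i; rewrite expr1 => hA hh E1 i_tw o_tw b0 b1 b2 gg g0 tw0 m0 i0 gc0.
rewrite 2!mulrDl; rewrite 2!mulrDl.
apply: pbD; first apply: pbD.
- apply: pb_le (pbM N0 (cp_ah h xi x tau t) b2) => //.
  rewrite hdC.
  apply: (@le_trans _ _ (2 * (A * (2 * (m * (1 + u)))) * (C * i ^+ 2 * G))).
    rewrite ler_wpM2r ?mulr_ge0 ?exprn_ge0 ?(ltW C0) ?(ltW i0)//.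
    by rewrite ler_wpM2l// ler_wpM2l//; lra.
  rewrite (_ : 2 * _ * _ = 4 * A * C * (i ^+ 2 * m) * ((1 + u) * G)); last by ring.
  rewrite E1 (_ : 4 * A * C * C' * W * g = 4 * A * C * W * (C' * g)); last by ring.
  by rewrite ler_wpM2l// !mulr_ge0//; lra.
- apply: pb_le (pbM N0 (cp_b h x t) b1) => //.
  rewrite (_ : 2 * A * _ = 2 * A * C * (i * G)); last by ring.
  rewrite (_ : _ * W * g = 2 * A * C * (S * W * g)); last by ring.
  by rewrite ler_wpM2l ?ler_pM ?(ltW i0)// !mulr_ge0//; lra.
- apply: pb_le (pbM N0 (cp_c h x t) b0) => //.
  rewrite (_ : 2 * A * _ = 2 * A * C * (1 * G)); last by ring.
  rewrite (_ : _ * W * g = 2 * A * C * (S * W * g)); last by ring.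
  by rewrite ler_wpM2l ?ler_pM// !mulr_ge0//; lra.
Qed.

End first_kernel.

Section first_kernel_hoelder.
Context {R : realType}.
Variables (al lam rho A S : R).
Hypotheses (al0 : 0 < al) (al1 : al <= 1) (lam0 : 0 < lam) (lamrho : lam <= rho)
  (A1 : 1 <= A) (S1 : 1 <= S).
Let k0 := (4 * rho)^-1.
Let k1 := (4 * lam)^-1.

Let c := ckn rho.
Let k00 : 0 < k0 := k0_gt0 lam0 lamrho.
Let k01 : k0 <= k1 := k0_le_k1 lam0 lamrho.

(** For [|x - x'|] at least [sqrt (t - tau)] the weight is at least one and [LZ1_bound] at both
    points suffices. Below that, a kernel increment costs one more derivative by the mean value
    theorem, and [gk_shift] moves the Gaussian to a fixed centre. *)
Lemma LZ1_hoelder : exists2 K : R, 0 < K & forall (N : R) v w (x x' t xi tau : R),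
  coef_pair al lam rho A N v w -> tau < t -> t - tau <= S ->
  pb N (K * ((`|x - x'| * isp (t - tau)) `^ (al / 2) * tw al (t - tau)) *
    (gk c (x - xi) (t - tau) + gk c (x' - xi) (t - tau)))
    (LZ1 v x t xi tau - LZ1 v x' t xi tau) (LZ1 w x t xi tau - LZ1 w x' t xi tau).
Proof.
have [M M0 hM] := kap_pairs al lam0 lamrho A1.
have k00' := k00; have A1' := A1; have S1' := S1; have al0' := al0; have al1' := al1.
have [C C0 hC] := ker_bounds k00 k01 M0.
have [KL KL0 hL] := LZ1_bound al0 al1 lam0 lamrho A1 S1.
have ck : c < k0 / 4 by rewrite /c /ckn -/k0; lra.
have [C' C'0 hC'] := gk_absorb 1 ck.
pose e := expR (k0 / 2); have e1 : 1 <= e by rewrite -expR0 ler_expR; lra.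
have AC : 0 < A * C by rewrite mulr_gt0//; lra.
have S0 : 0 < S by lra.
pose K2 := 4 * (A * C) * e * C' + 2 * (A * C) * e * S + 2 * (A * C) * e * S.
pose K3 := 2 * (A * C) + 2 * (A * C) * S * S + 2 * (A * C) * S * S.
have [[S0' e0' C'0' AC'] [A0' C0']] : [/\ 0 <= S, 0 <= e, 0 <= C' & 0 <= A * C] /\ 0 <= A /\ 0 <= C by split; split; lra.
have K20 : 0 <= K2 by rewrite /K2; do !apply: addr_ge0; do !apply: mulr_ge0.
have K30 : 0 <= K3 by rewrite /K3; do !apply: addr_ge0; do !apply: mulr_ge0.
have [a21 a20 ka kb] : [/\ al / 2 <= 1, 0 <= al / 2, 0 <= k0 / 2 & c <= k0 / 2] by split; lra.
have [a22 a23] : al / 2 <= al /\ 0 <= al / 2 - 0 by split; lra.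
exists (KL + K2 + K3); first lra.
move=> N v w x x' t xi tau h tt sS.
have N0 := cp_N h; have s0 : 0 < t - tau by lra.
have tw0 := tw_ge0 al (t - tau); have i0 := isp_gt0 s0.
have gx0 := gk_ge0 c (x - xi) (t - tau); have gx0' := gk_ge0 c (x' - xi) (t - tau).
have r0 : 0 <= `|x - x'| * isp (t - tau) by rewrite mulr_ge0// ltW.
have E0 := powR_ge0 (`|x - x'| * isp (t - tau)) (al / 2).
have [r1|r1] := leP 1 (`|x - x'| * isp (t - tau)).
  apply: pb_le (pbB (hL _ _ _ x _ xi _ h tt sS) (hL _ _ _ x' _ xi _ h tt sS)) => //.
  rewrite -mulrDr ler_wpM2r ?addr_ge0//.
  have E1 : 1 <= (`|x - x'| * isp (t - tau)) `^ (al / 2).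
    by rewrite -[leLHS](powRr0 (`|x - x'| * isp (t - tau))); apply: ler_powR => //; lra.
  apply: (@le_trans _ _ ((KL + K2 + K3) * tw al (t - tau))).
    by rewrite ler_wpM2r//; lra.
  by rewrite ler_wpM2l ?ler_peMl//; lra.
have a0v := cp_ca_gt0 lam0 h; have a0w := cp_caw_gt0 lam0 h.
have [hk _] := hM _ _ _ h.
have [kp_gt0 kq_gt0] : 0 < kap v xi tau /\ 0 < kap w xi tau.
  by rewrite !invr_gt0 !mulr_gt0.
set E := (_ * _) `^ _.
have rE : `|x - x'| * isp (t - tau) <= E.
  have [->|rn0] := eqVneq (`|x - x'| * isp (t - tau)) 0; first exact: powR_ge0.
  apply: ger1_powR; last exact: a21.
  by rewrite lt0r rn0 r0 ltW.
have dm : `|x - x'| `^ al <= E * (t - tau) `^ (al / 2).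
  have -> : `|x - x'| = `|x - x'| * isp (t - tau) * (t - tau) `^ (1 / 2).
    by rewrite -mulrA isp_powR// -powRDp// addNr powRr0 mulr1.
  rewrite (powRM _ r0 (powR_ge0 _ _)) -powRrM (_ : 1 / 2 * al = al / 2); last by field.
  rewrite ler_wpM2r ?powR_ge0//.
  have [->|rn0] := eqVneq (`|x - x'| * isp (t - tau)) 0.
    by rewrite powR0 ?powR_ge0// gt_eqF.
  apply: ger_powR; last exact: a22.
  by rewrite lt0r rn0 r0 ltW.
have xx : (x - xi - (x' - xi)) ^+ 2 <= t - tau.
  rewrite (_ : _ - _ = x - x'); last by ring.
  have : (`|x - x'| * isp (t - tau)) ^+ 2 <= 1 by rewrite exprn_ile1// ltW.
  by rewrite exprMn sqr_isp// ler_pdivrMr// mul1r real_normK ?num_real.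
have [b0 b1 b2 _] := hC _ _ _ (x' - xi) _ (hk xi tau) s0.
set G4 := gk (k0 / 4) (x - xi) (t - tau).
have G40 : 0 <= G4 by exact: gk_ge0.
have hG (y : R) : Num.min (x - xi) (x' - xi) <= y <= Num.max (x - xi) (x' - xi) ->
    gk (k0 / 2) y (t - tau) <= e * G4.
  move=> yI; rewrite /G4 (_ : k0 / 4 = k0 / 2 / 2); last by field.
  apply: gk_shift => //.
  apply: le_trans xx.
  have : `|y - (x - xi)| <= `|x - xi - (x' - xi)|.
    move: yI; have [ab|/ltW ab] := leP (x - xi) (x' - xi) => /andP[y1 y2].
      rewrite [leRHS]distrC !ger0_norm ?subr_ge0//.
      by rewrite lerD2r.
    by rewrite distrC !ger0_norm ?subr_ge0// lerD2l lerN2.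
  by rewrite -[X in _ -> X <= _]real_normK ?num_real// -[X in _ -> _ <= X]real_normK ?num_real// ler_sqr ?nnegrE.
have incr (n : nat) (F F' : R -> R -> R -> R) (s := t - tau) :
    (forall k z : R, 0 < k -> is_derive z 1 (fun z => F k z s) (F' k z s)) ->
    (forall z : R, pb N (C * isp s ^+ n.+1 * gk (k0 / 2) z s) (F' (kap v xi tau) z s) (F' (kap w xi tau) z s)) ->
    pb N (C * e * E * isp s ^+ n * G4)
      (F (kap v xi tau) (x - xi) s - F (kap v xi tau) (x' - xi) s)
      (F (kap w xi tau) (x - xi) s - F (kap w xi tau) (x' - xi) s).
  move=> dF bF'.
  have := pb_mvt (B := C * isp s ^+ n.+1 * (e * G4)) (z := x - xi) (z' := x' - xi) N0
    (fun z => dF _ z kp_gt0) (fun z => dF _ z kq_gt0).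
  have hB (y : R) : Num.min (x - xi) (x' - xi) <= y <= Num.max (x - xi) (x' - xi) ->
    pb N (C * isp s ^+ n.+1 * (e * G4)) (F' (kap v xi tau) y s) (F' (kap w xi tau) y s).
    move=> /hG yG; apply: pb_le (bF' y) => //.
    by rewrite ler_wpM2l// mulr_ge0 ?exprn_ge0 ?(ltW i0) ?(ltW C0).
  move=> /(_ hB); apply: pb_le => //.

  rewrite (_ : x - xi - _ = x - x'); last by ring.
  rewrite (_ : C * _ * _ * _ = C * e * isp s ^+ n * G4 * (`|x - x'| * isp s)); last by rewrite exprS; ring.
  rewrite (_ : C * e * E * _ * _ = C * e * isp s ^+ n * G4 * E); last by ring.
  have e0 := e0'.
  exact: (ler_wpM2l (mulr_ge0 (mulr_ge0 (mulr_ge0 (ltW C0) e0) (exprn_ge0 n (ltW i0))) G40) rE).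
have i2 := incr 2%N hxx hxxx (fun k z k_gt0 => der_hxx z _ k_gt0)
  (fun z => let: And4 _ _ _ h := hC _ _ _ z _ (hk xi tau) s0 in h).
have i1 := incr 1%N hx hxx (fun k z k_gt0 => der_hx z _ k_gt0)
  (fun z => let: And4 _ _ h _ := hC _ _ _ z _ (hk xi tau) s0 in h).
have i0' := incr 0%N h0 hx (fun k z k_gt0 => der_h0 z _ k_gt0)
  (fun z => let: And4 _ h _ _ := hC _ _ _ z _ (hk xi tau) s0 in h).
rewrite !LZ1E//.
have hA := hC' (x - xi) _ s0.
have m0 : 0 <= (t - tau) `^ (al / 2) by exact: powR_ge0.
have mS : (t - tau) `^ (al / 2) <= S.
  rewrite -[leRHS]mulr1 -[X in _ <= S * X](powRr0 (t - tau)).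
  by apply: powR_ratio_le => //; rewrite subr0.
have hh := hd_le x xi al0 al1 tt.
have E1 := twE al s0.
have i_tw := isp_le_tw al1 al0 S1 s0 sS.
have o_tw := one_le_tw al1 al0 S1 s0 sS.
have g4g : G4 <= gk c (x - xi) (t - tau) by apply: gk_le => //; exact: ltW.
have gg' : gk (k0 / 2) (x' - xi) (t - tau) <= gk c (x' - xi) (t - tau).
  by apply: gk_le.
have G'0 := gk_ge0 (k0 / 2) (x' - xi) (t - tau).
(* [T1], [T3], [T5] carry the increments of the kernels with coefficients at [x], and [T2], [T4],
   [T6] those of the coefficients with kernels at [x']; [K2] and [K3] are their respective
   constants. *)
have T1 := pbM N0 (cp_ah h xi x tau t) i2.
have T2 := pbM N0 (cp_ah h x' x t t) b2.
have T3 := pbM N0 (cp_b h x t) i1.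
have T4 := pbM N0 (cp_bh h x x' t t) b1.
have T5 := pbM N0 (cp_c h x t) i0'.
have T6 := pbM N0 (cp_ch h x x' t t) b0.
have := pbD (pbD (pbD T1 T3) T5) (pbD (pbD T2 T4) T6).
have ident (a0 a b d a' b' d' p q r p' q' r' : R) :
  (a0 - a) * (p - p') + b * (q - q') + d * (r - r') +
  ((a' - a) * p' + (b - b') * q' + (d - d') * r') =
  (a0 - a) * p + b * q + d * r - ((a0 - a') * p' + b' * q' + d' * r') by ring.
rewrite !ident; apply: pb_le => //.
rewrite hdC !(hd_space al0) (distrC x').
move: hA hh E1 i_tw o_tw gg' G'0 tw0 m0 mS g4g gx0 gx0' dm E0 i0 G40.
rewrite -/E -/G4.
set G' := gk (k0 / 2) _ _; set g := gk c (x - xi) _; set g' := gk c (x' - xi) _.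
set m := (t - tau) `^ _; set D := `|x - x'| `^ al.
set u := (x - xi) ^+ 2 / (t - tau); set W := tw al _; set i := isp _.
rewrite expr1 => hA hh E1 i_tw o_tw gg' G'0 tw0 m0 mS g4g gx0 gx0' dm E0 i0 G40.
have D0 : 0 <= D by exact: powR_ge0.
clear incr i0' i1 i2 T1 T2 T3 T4 T5 T6 ident hG rE hC hC' hL hM b0 b1 b2.
clearbody G4 G' g g' m D u W i E.
have EW : 0 <= E * W by rewrite mulr_ge0.
have i0l : 0 <= i by exact: ltW.
have ACE : 0 <= A * C * e * E by do 2 apply: mulr_ge0 => //.
have ACE4 : 0 <= 4 * (A * C * e * E) by rewrite mulr_ge0.
have ACE2 : 0 <= 2 * (A * C * e * E) by rewrite mulr_ge0.
have AC2 : 0 <= 2 * (A * C) by rewrite mulr_ge0// ltW.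
have part1 : 2 * (A * hd al x xi t tau) * (C * e * E * i ^+ 2 * G4) +
    2 * A * (C * e * E * i ^+ 1 * G4) + 2 * A * (C * e * E * i ^+ 0 * G4) <= K2 * (E * W) * g.
  have p1 : 2 * (A * hd al x xi t tau) * (C * e * E * i ^+ 2 * G4) <= 4 * (A * C) * e * C' * (E * W) * g.
    apply: (@le_trans _ _ (2 * (A * (2 * (m * (1 + u)))) * (C * e * E * i ^+ 2 * G4))).
      rewrite ler_wpM2r ?mulr_ge0 ?exprn_ge0 ?(ltW C0)//.
      by rewrite ler_wpM2l// ler_wpM2l.
    rewrite (_ : 2 * _ * _ = 4 * (A * C * e * E) * ((i ^+ 2 * m) * ((1 + u) * G4))); last by ring.
    rewrite (_ : _ * g = 4 * (A * C * e * E) * (W * (C' * g))); last by ring.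
    by rewrite E1 ler_wpM2l// ler_wpM2l.
  have p2 : 2 * A * (C * e * E * i ^+ 1 * G4) <= 2 * (A * C) * e * S * (E * W) * g.
    rewrite (_ : 2 * A * _ = 2 * (A * C * e * E) * (i * G4)); last by ring.
    rewrite (_ : _ * g = 2 * (A * C * e * E) * (S * W * g)); last by ring.
    by rewrite ler_wpM2l// ler_pM.
  have p3 : 2 * A * (C * e * E * i ^+ 0 * G4) <= 2 * (A * C) * e * S * (E * W) * g.
    rewrite (_ : 2 * A * _ = 2 * (A * C * e * E) * (1 * G4)); last by ring.
    rewrite (_ : _ * g = 2 * (A * C * e * E) * (S * W * g)); last by ring.
    by rewrite ler_wpM2l// ler_pM.
  by rewrite /K2 (mulrDl _ _ (E * W)) (mulrDl _ _ (E * W)) !(mulrDl _ _ g); lra.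
have part2 : 2 * (A * D) * (C * i ^+ 2 * G') + 2 * (A * D) * (C * i * G') +
    2 * (A * D) * (C * G') <= K3 * (E * W) * g'.
  have ACl := ltW AC; have Sl := ltW S0.
  have q0 X Y : 0 <= X -> X * m <= Y -> 2 * (A * D) * (C * X * G') <= 2 * (A * C) * (E * Y) * g'.
    move=> X0 XY.
    rewrite (_ : 2 * _ * _ = 2 * (A * C) * (D * X * G')); last by ring.
    rewrite -[leRHS]mulrA ler_wpM2l//.
    apply: ler_pM => //; first by rewrite mulr_ge0.
    apply: (@le_trans _ _ (E * m * X)); first by rewrite ler_wpM2r.
    by rewrite -mulrA ler_wpM2l// mulrC.
  have q1 : 2 * (A * D) * (C * i ^+ 2 * G') <= 2 * (A * C) * (E * W) * g'.
    by apply: q0; rewrite ?exprn_ge0// E1.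
  have q2 : 2 * (A * D) * (C * i * G') <= 2 * (A * C) * (E * (S * W * S)) * g'.
    by apply: q0 => //; rewrite ler_pM.
  have q3 : 2 * (A * D) * (C * 1 * G') <= 2 * (A * C) * (E * (S * W * S)) * g'.
    by apply: q0 => //; rewrite ler_pM.
  rewrite mulr1 in q3.
  rewrite /K3 (_ : _ * (E * W) * g' = 2 * (A * C) * (E * W) * g' +
    2 * (A * C) * (E * (S * W * S)) * g' + 2 * (A * C) * (E * (S * W * S)) * g'); last by ring.
  by lra.
apply: le_trans (lerD part1 part2) _.
have z1 : 0 <= KL * (E * W) * (g + g') by rewrite !mulr_ge0 ?addr_ge0// ltW.
have z2 : 0 <= K2 * (E * W) * g' by rewrite !mulr_ge0.
have z3 : 0 <= K3 * (E * W) * g by rewrite !mulr_ge0.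
rewrite (_ : (KL + K2 + K3) * (E * W) * (g + g') = KL * (E * W) * (g + g') +
  K2 * (E * W) * g + K2 * (E * W) * g' + K3 * (E * W) * g + K3 * (E * W) * g'); last by ring.
lra.
Qed.

End first_kernel_hoelder.

(** * Measurability of the kernels and their iterates *)

Section kernel_measurability.
Context {R : realType}.
Let mu := @lebesgue_measure R.

Definition mcoef (v : coeffs R) :=
  [/\ measurable_fun [set: R * R] (fun z => ca v z.1 z.2),
      measurable_fun [set: R * R] (fun z => cb v z.1 z.2) &
      measurable_fun [set: R * R] (fun z => cc v z.1 z.2)].

Lemma coef_pair_measurable (al lam rho A N : R) v w : 0 < al ->
  coef_pair al lam rho A N v w -> mcoef v.
Proof.
move=> al0 h; split.
- by apply: (measurable_hoelder (M := A) al0) => x y t s; have [] := cp_ah h x y t s.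
- by apply: (measurable_hoelder (M := A) al0) => x y t s; have [] := cp_bh h x y t s.
- by apply: (measurable_hoelder (M := A) al0) => x y t s; have [] := cp_ch h x y t s.
Qed.

Section composed.
Context d (T0 : measurableType d).
Implicit Types X T Y S : T0 -> R.

Lemma measurable_pair_comp (a : R -> R -> R) X T :
  measurable_fun [set: R * R] (fun z => a z.1 z.2) ->
  measurable_fun setT X -> measurable_fun setT T ->
  measurable_fun setT (fun q => a (X q) (T q)).
Proof.
move=> ma mX mT.
have mp : measurable_fun setT (fun q => (X q, T q)) by exact: measurable_fun_pair.
exact: (measurableT_comp ma mp).
Qed.

Lemma measurable_fun_div X Y : measurable_fun setT X -> measurable_fun setT Y ->
  measurable_fun setT (fun q => X q / Y q).
Proof. by move=> mX mY; apply: measurable_funM => //; exact: measurable_fun_invr. Qed.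

Lemma measurable_fun_exp X n : measurable_fun setT X ->
  measurable_fun setT (fun q => X q ^+ n).
Proof. exact: measurable_funX. Qed.

Lemma measurable_Fr (r : R) X Y : measurable_fun setT X -> measurable_fun setT Y ->
  measurable_fun setT (fun q => Fr r (X q) (Y q)).
Proof.
move=> mX mY; apply: measurable_fun_expR; apply: measurable_funB.
  apply: measurable_funM => //; apply: (measurableT_comp _ mX).
  exact: measurable_ln.
exact: measurable_funM.
Qed.

Lemma measurable_isp X : measurable_fun setT X -> measurable_fun setT (fun q => isp (X q)).
Proof. by move=> mX; apply: measurable_fun_invr; exact: measurable_fun_sqrt. Qed.

Lemma measurable_kernels X Y S : measurable_fun setT X -> measurable_fun setT Y ->
  measurable_fun setT S ->
  [/\ measurable_fun setT (fun q => h0 (X q) (Y q) (S q)),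
      measurable_fun setT (fun q => hx (X q) (Y q) (S q)) &
      measurable_fun setT (fun q => hxx (X q) (Y q) (S q))].
Proof.
move=> mX mY mS.
have mi := measurable_isp mS.
have mp : measurable_fun setT (fun q => ipi * isp (S q)) by exact: measurable_funM.
have mu_ : measurable_fun setT (fun q => Y q ^+ 2 / S q).
  by apply: measurable_fun_div => //; exact: measurable_fun_exp.
have md := measurable_fun_div mY mS.
have mF r := measurable_Fr r mX mu_.
split.
- exact: measurable_funM.
- apply: measurable_funM; last exact: mF.
  by apply: measurable_funM => //; exact: measurable_funM.
- apply: measurable_funD; apply: measurable_funM; try exact: mF.
    apply: measurable_funM => //; apply: measurable_funM => //.
    exact: measurable_fun_exp.
  by apply: measurable_funM => //; exact: measurable_fun_div.
Qed.

Lemma measurable_kap v X T : mcoef v -> measurable_fun setT X -> measurable_fun setT T ->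
  measurable_fun setT (fun q => kap v (X q) (T q)).
Proof.
move=> [ma _ _] mX mT; apply: measurable_fun_invr; apply: measurable_funM => //.
exact: measurable_pair_comp.
Qed.

Lemma measurable_LZ1 v X T Y S : mcoef v -> (forall x t, 0 < ca v x t) ->
  measurable_fun setT X -> measurable_fun setT T ->
  measurable_fun setT Y -> measurable_fun setT S ->
  measurable_fun setT (fun q => LZ1 v (X q) (T q) (Y q) (S q)).
Proof.
move=> mv a0 mX mT mY mS; have [ma mb mc] := mv.
have -> : (fun q => LZ1 v (X q) (T q) (Y q) (S q)) = (fun q =>
    if S q < T q then
      (ca v (Y q) (S q) - ca v (X q) (T q)) * hxx (kap v (Y q) (S q)) (X q - Y q) (T q - S q) +
      cb v (X q) (T q) * hx (kap v (Y q) (S q)) (X q - Y q) (T q - S q) +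
      cc v (X q) (T q) * h0 (kap v (Y q) (S q)) (X q - Y q) (T q - S q)
    else 0).
  apply/funext => q; case: ltP => h; first by rewrite LZ1E.
  by rewrite LZ1_eq0.
have mk := measurable_kap mv mY mS.
have [m0 m1 m2] := measurable_kernels mk (measurable_funB mX mY) (measurable_funB mT mS).
apply: measurable_fun_ifT; last exact: measurable_cst.
  exact: measurable_fun_ltr.
apply: measurable_funD; last by apply: measurable_funM => //; exact: measurable_pair_comp.
apply: measurable_funD; last by apply: measurable_funM => //; exact: measurable_pair_comp.
apply: measurable_funM => //; apply: measurable_funB; exact: measurable_pair_comp.
Qed.

End composed.

(** [F] and [G] have to be measurable after composition with measurable maps from an arbitrary
    space, because the integration variables are treated as parameters and enlarge the space from
    [T0] to [T0 * R * R]. *)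
Lemma measurable_spacetime_conv d (T0 : measurableType d) (X T : T0 -> R)
    (F G : R -> R -> R -> R -> R) xi tau :
  measurable_fun setT X -> measurable_fun setT T ->
  (forall d' (T1 : measurableType d') (X' T' Y' S' : T1 -> R),
     measurable_fun setT X' -> measurable_fun setT T' ->
     measurable_fun setT Y' -> measurable_fun setT S' ->
     measurable_fun setT (fun q => F (X' q) (T' q) (Y' q) (S' q))) ->
  (forall d' (T1 : measurableType d') (Y' S' : T1 -> R),
     measurable_fun setT Y' -> measurable_fun setT S' ->
     measurable_fun setT (fun q => G (Y' q) (S' q) xi tau)) ->
  measurable_fun setT (fun q => spacetime_conv F G (X q) (T q) xi tau).
Proof.
move=> mX mT mF mG.
apply: (@measurable_Rintegral_itv_param R d T0 (fun _ => tau) T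
  (fun z => \int[mu]_(y in [set: R]) (F (X z.1) (T z.1) y z.2 * G y z.2 xi tau))) => //.
apply: (@measurable_Rintegral_param R _ _
  (fun z => F (X z.1.1) (T z.1.1) z.2 z.1.2 * G z.2 z.1.2 xi tau)).
have m1 : measurable_fun setT (fun z : (T0 * R) * R => z.1) by exact: measurable_fst.
have m11 : measurable_fun setT (fun z : (T0 * R) * R => z.1.1) by exact: (measurableT_comp measurable_fst m1).
have m12 : measurable_fun setT (fun z : (T0 * R) * R => z.1.2) by exact: (measurableT_comp measurable_snd m1).
have m2 : measurable_fun setT (fun z : (T0 * R) * R => z.2) by exact: measurable_snd.
apply: measurable_funM; last exact: mG.
by apply: mF => //; [exact: (measurableT_comp mX m11)|exact: (measurableT_comp mT m11)].
Qed.

Lemma measurable_LZ v m : mcoef v -> (forall x t, 0 < ca v x t) ->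
  forall d (T0 : measurableType d) (X T : T0 -> R) xi tau,
  measurable_fun setT X -> measurable_fun setT T ->
  measurable_fun setT (fun q => LZ v m (X q) (T q) xi tau).
Proof.
move=> mv a0; elim: m => [|m IH] d T0 X T xi tau mX mT /=.
  by apply: measurable_LZ1 => //; exact: measurable_cst.
apply: measurable_spacetime_conv => //.
  by move=> *; exact: measurable_LZ1.
by move=> *; exact: IH.
Qed.

End kernel_measurability.

(** * Convolution in space and time *)

Section convolution_bounds.
Context {R : realType}.
Let mu := @lebesgue_measure R.

Definition gconst (c : R) := Num.sqrt (pi / c).

(** The left factor may carry two Gaussians, centred at [x] and [x'], which is the form of the
    Hoelder estimates; a single Gaussian is the case [x = x']. *)
Lemma inner_pb2 (N c x x' xi s1 s2 A B : R) (Fv Fw Gv Gw : R -> R) :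
  0 <= N -> 0 < c -> 0 < s1 -> 0 < s2 ->
  measurable_fun setT Fv -> measurable_fun setT Fw ->
  measurable_fun setT Gv -> measurable_fun setT Gw ->
  (forall y : R, pb N (A * (gk c (x - y) s1 + gk c (x' - y) s1)) (Fv y) (Fw y)) ->
  (forall y : R, pb N (B * gk c (y - xi) s2) (Gv y) (Gw y)) ->
  [/\ mu.-integrable setT (EFin \o (fun y => Fv y * Gv y)),
      mu.-integrable setT (EFin \o (fun y => Fw y * Gw y)) &
      pb N (2 * A * B * gconst c * (gk c (x - xi) (s1 + s2) + gk c (x' - xi) (s1 + s2)))
        (\int[mu]_(y in [set: R]) (Fv y * Gv y)) (\int[mu]_(y in [set: R]) (Fw y * Gw y))].
Proof.
move=> N0 c0 s10 s20 mFv mFw mGv mGw hF hG.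
have [i1 e1] := gk_conv x xi c0 s10 s20.
have [i2 e2] := gk_conv x' xi c0 s10 s20.
pose bd (y : R) := 2 * A * B * (gk c (x - y) s1 * gk c (y - xi) s2
  + gk c (x' - y) s1 * gk c (y - xi) s2).
have ibd : mu.-integrable setT (EFin \o bd).
  by apply: integrable_scale => //; exact: integrable_add.
have ebd : \int[mu]_(y in [set: R]) bd y =
    2 * A * B * gconst c * (gk c (x - xi) (s1 + s2) + gk c (x' - xi) (s1 + s2)).
  rewrite /bd RintegralZl//; last exact: integrable_add.
  by rewrite RintegralD// e1 e2 -mulrDr !mulrA.
have hFG (y : R) : pb N (bd y) (Fv y * Gv y) (Fw y * Gw y).
  apply: pb_le (pbM N0 (hF y) (hG y)) => //.
  by rewrite le_eqVlt; apply/orP; left; apply/eqP; rewrite /bd; ring.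
have mv : measurable_fun setT (fun y => Fv y * Gv y) by exact: measurable_funM.
have mw : measurable_fun setT (fun y => Fw y * Gw y) by exact: measurable_funM.
split.
- by apply: (@integrable_le _ _ _ bd) => // y _; case: (hFG y).
- by apply: (@integrable_le _ _ _ bd) => // y _; case: (hFG y).
- by apply: (@pb_integral _ _ _ _ _ bd) => //; rewrite ebd.
Qed.

Lemma inner_pb (N c x xi s1 s2 A B : R) (Fv Fw Gv Gw : R -> R) :
  0 <= N -> 0 < c -> 0 < s1 -> 0 < s2 ->
  measurable_fun setT Fv -> measurable_fun setT Fw ->
  measurable_fun setT Gv -> measurable_fun setT Gw ->
  (forall y : R, pb N (A * gk c (x - y) s1) (Fv y) (Fw y)) ->
  (forall y : R, pb N (B * gk c (y - xi) s2) (Gv y) (Gw y)) ->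
  [/\ mu.-integrable setT (EFin \o (fun y => Fv y * Gv y)),
      mu.-integrable setT (EFin \o (fun y => Fw y * Gw y)) &
      pb N (2 * A * B * gconst c * gk c (x - xi) (s1 + s2))
        (\int[mu]_(y in [set: R]) (Fv y * Gv y)) (\int[mu]_(y in [set: R]) (Fw y * Gw y))].
Proof.
move=> N0 c0 s10 s20 mFv mFw mGv mGw hF hG.
have hF' (y : R) : pb N (A / 2 * (gk c (x - y) s1 + gk c (x - y) s1)) (Fv y) (Fw y).
  rewrite (_ : A / 2 * _ = A * gk c (x - y) s1); [exact: hF|].
  by field.
have [i1 i2 h] := inner_pb2 N0 c0 s10 s20 mFv mFw mGv mGw hF' hG.
split => //; apply: pb_le h => //.
by rewrite le_eqVlt; apply/orP; left; apply/eqP; field.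
Qed.

(** At every [s] one of the distances to the end points is at least half of [t - tau]; the
    corresponding factor is bounded by its value at that half. *)
Lemma prod_endpoint_le (p q tau t s : R) : p <= 1 -> q <= 1 -> tau < s < t ->
  (t - s) `^ (p - 1) * (s - tau) `^ (q - 1) <=
  endpoint_bound (((t - tau) / 2) `^ (p - 1)) (((t - tau) / 2) `^ (q - 1)) p q tau t s.
Proof.
move=> p1 q1 st; rewrite /endpoint_bound.
have [h|h] := leP ((t - tau) / 2) (t - s).
  rewrite -[leLHS]addr0 lerD ?mulr_ge0 ?powR_ge0// ler_wpM2r ?powR_ge0//.
  by apply: le_powR_sub1 => //; lra.
rewrite -[leLHS]add0r lerD ?mulr_ge0 ?powR_ge0// mulrC ler_wpM2r ?powR_ge0//.
by apply: le_powR_sub1 => //; lra.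
Qed.

(* Majorant of the Beta function obtained by cutting the interval at its midpoint. *)
Definition beta_bound (p q : R) := 2 `^ (1 - p) / q + 2 `^ (1 - q) / p.

Lemma beta_bound_gt0 p q : 0 < p -> 0 < q -> 0 < beta_bound p q.
Proof. by move=> p0 q0; rewrite addr_gt0// divr_gt0// powR_gt0. Qed.

Lemma integral_prod_endpoint (p q tau t : R) : 0 < p -> 0 < q -> tau < t ->
  \int[mu]_(s in `]tau, t[) endpoint_bound (((t - tau) / 2) `^ (p - 1))
    (((t - tau) / 2) `^ (q - 1)) p q tau t s = beta_bound p q * (t - tau) `^ (p + q - 1).
Proof.
move=> p0 q0 tt; have [_ ->] := integral_endpoint_bound
  (((t - tau) / 2) `^ (p - 1)) (((t - tau) / 2) `^ (q - 1)) tt p0 q0.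
have s0 : 0 < t - tau by lra.
move: (t - tau) s0 => u u0.
have h r : (u / 2) `^ (r - 1) = u `^ (r - 1) * 2 `^ (1 - r).
  rewrite powRM ?invr_ge0 ?(ltW u0)//; congr (_ * _).
  by rewrite -powR_inv1// -powRrM mulN1r opprB.
rewrite !h.
rewrite (_ : p + q - 1 = (p - 1) + q); last by ring.
rewrite powRDp// /beta_bound mulrDl.
rewrite (_ : u `^ (q - 1) * _ * _ = 2 `^ (1 - q) / p * (u `^ (q - 1) * u `^ p)); last by ring.
rewrite -(powRDp (q - 1) p u0) -(powRDp (p - 1) q u0) (_ : q - 1 + p = p - 1 + q); last by ring.
by rewrite powRDp//; ring.
Qed.

Lemma conv_pb (N D p q tau t : R) (Iv Iw : R -> R) : 0 <= N -> 0 <= D ->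
  0 < p -> 0 < q -> p <= 1 -> q <= 1 -> tau < t ->
  measurable_fun setT Iv -> measurable_fun setT Iw ->
  (forall s : R, tau < s < t ->
    pb N (D * ((t - s) `^ (p - 1) * (s - tau) `^ (q - 1))) (Iv s) (Iw s)) ->
  [/\ mu.-integrable `]tau, t[ (EFin \o Iv), mu.-integrable `]tau, t[ (EFin \o Iw) &
  pb N (D * beta_bound p q * (t - tau) `^ (p + q - 1))
    (\int[mu]_(s in `]tau, t[) Iv s) (\int[mu]_(s in `]tau, t[) Iw s)].
Proof.
move=> N0 D0 p0 q0 p1 q1 tt mIv mIw hI.
pose bd := endpoint_bound (((t - tau) / 2) `^ (p - 1)) (((t - tau) / 2) `^ (q - 1)) p q tau t.
have [ibd _] := integral_endpoint_bound
  (((t - tau) / 2) `^ (p - 1)) (((t - tau) / 2) `^ (q - 1)) tt p0 q0.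
have iD : mu.-integrable `]tau, t[ (EFin \o (fun s => D * bd s)) by exact: integrable_scale.
have hI' (s : R) : `]tau, t[%classic s -> pb N (D * bd s) (Iv s) (Iw s).
  rewrite set_ooE => st; apply: pb_le (hI _ st) => //.
  by rewrite ler_wpM2l// prod_endpoint_le.
have mIv' : measurable_fun `]tau, t[ Iv by exact: measurable_funTS.
have mIw' : measurable_fun `]tau, t[ Iw by exact: measurable_funTS.
split.
- by apply: (@integrable_le _ _ _ (fun s => D * bd s)) => // s /hI'[].
- by apply: (@integrable_le _ _ _ (fun s => D * bd s)) => // s /hI'[].
- apply: (@pb_integral _ _ _ _ _ (fun s => D * bd s)) => //.
  rewrite RintegralZl// /bd integral_prod_endpoint//.
  by rewrite mulrA.
Qed.

(** Near [0] the power is small by itself; away from [0] the exponential is at most [(mu * dl)^-1],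
    and [mu] is taken large enough to beat [S^p]. *)
Lemma exp_damping (p eps S : R) : 0 < p -> 0 < eps -> 0 < S ->
  exists2 mu : R, 0 < mu & forall r : R, 0 < r -> r <= S -> r `^ p * expR (- (mu * r)) <= eps.
Proof.
move=> p0 e0 S0; have [dl dl0 hdl] := powR_small p0 e0.
have Sp : 0 < S `^ p by exact: powR_gt0.
exists (S `^ p / (eps * dl)); first by rewrite divr_gt0// mulr_gt0.
move=> r r0 rS; set m := _ / _.
have m0 : 0 < m by rewrite divr_gt0// mulr_gt0.
have mr0 : 0 < m * r by rewrite mulr_gt0.
have [rd|rd] := leP r dl.
  apply: (@le_trans _ _ (r `^ p)); last by apply: hdl; rewrite rd ltW.
  by rewrite ler_piMr ?powR_ge0// expR_le1 oppr_le0 ltW.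
apply: (@le_trans _ _ (S `^ p * (m * dl)^-1)).
  apply: ler_pM; rewrite ?powR_ge0 ?expR_ge0//.
    by apply: ge0_ler_powR; rewrite ?nnegrE ?(ltW r0) ?(ltW S0) ?(ltW p0).
  have md0 : 0 < m * dl := mulr_gt0 m0 dl0.
  rewrite expRN lef_pV2 ?posrE ?expR_gt0//.
  have := expR_ge1Dx (m * r); have : m * dl <= m * r by rewrite ler_wpM2l ?ltW.
  lra.
by rewrite le_eqVlt; apply/orP; left; apply/eqP; rewrite /m; field; rewrite !gt_eqF.
Qed.

Lemma pb_series (N B : R) (f g : nat -> R) : 0 <= N ->
  (forall m, pb N (B * (1/2) ^+ m) (f m) (g m)) ->
  [/\ cvgn (series f), cvgn (series g) &
    pb N (2 * B) (limn (series f)) (limn (series g))].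
Proof.
move=> N0 h; have B0 : 0 <= B by have := pb_ge0 (h 0%N); rewrite expr0 mulr1.
have cv (u : nat -> R) : (forall m, `|u m| <= B * (1/2) ^+ m) -> cvgn (series u).
  move=> hu; apply: (@normed_cvg R R^o u); apply: (series_le_cvg (v_ := geometric B (1/2))).
  - by move=> n; exact: normr_ge0.
  - by move=> n; rewrite /= mulr_ge0 ?exprn_ge0.
  - by move=> n; exact: hu.
  - by apply: is_cvg_geometric_series; rewrite ger0_norm; lra.
have cf : cvgn (series f) by apply: cv => m; case: (h m).
have cg : cvgn (series g) by apply: cv => m; case: (h m).
split => //; apply: (pb_cvg (f := series f) (g := series g)) => // n.
have hs : pb N (\sum_(0 <= k < n) B * (1/2) ^+ k) (series f n) (series g n).
  rewrite /series/=; elim: n => [|n IH]; last by rewrite !big_nat_recr//=; exact: pbD.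
  by rewrite !big_geq//; split; rewrite ?subrr ?normr0 ?mulr0.
apply: pb_le hs => //.
have -> : \sum_(0 <= k < n) B * (1 / 2) ^+ k = 2 * B * (1 - (1/2) ^+ n).
  elim: n => [|n IH]; first by rewrite big_geq// expr0 subrr mulr0.
  by rewrite big_nat_recr//= IH exprS; field.
by rewrite ler_piMr ?mulr_ge0// lerBlDr lerDl exprn_ge0.
Qed.

End convolution_bounds.

Ltac nonneg := lazymatch goal with
  | H : is_true (0 <= ?x) |- is_true (0 <= ?x) => exact: H
  | H : is_true (0 < ?x) |- is_true (0 <= ?x) => exact: (ltW H)
  | |- is_true (0 <= gk _ _ _) => exact: gk_ge0
  | |- is_true (0 <= tw _ _) => exact: tw_ge0
  | |- is_true (0 <= _ `^ _) => exact: powR_ge0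
  | |- is_true (0 <= expR _) => exact: expR_ge0
  | |- is_true (0 <= `|_|) => exact: normr_ge0
  | |- is_true (0 <= _ ^+ _) => apply: exprn_ge0; nonneg
  | |- is_true (0 <= _ * _) => apply: mulr_ge0; nonneg
  | |- is_true (0 <= _ + _) => apply: addr_ge0; nonneg
  | |- is_true (0 <= _^-1) => rewrite invr_ge0; nonneg
  | |- is_true (0 <= _ *+ _) => exact: ler0n
  | |- is_true (0 <= 1) => exact: ler01
  end.

Section iterated_kernels.
Context {R : realType}.
Let mu := @lebesgue_measure R.
Variables (al lam rho A S : R).
Hypotheses (al0 : 0 < al) (al1 : al <= 1) (lam0 : 0 < lam) (lamrho : lam <= rho)
  (A1 : 1 <= A) (S1 : 1 <= S).
Let c := ckn rho.

Lemma ckn_gt0 : 0 < c.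
Proof. by rewrite divr_gt0// (k0_gt0 lam0 lamrho). Qed.

Lemma gconst_gt0 : 0 < gconst c.
Proof. by rewrite sqrtr_gt0 divr_gt0 ?pi_gt0// ckn_gt0. Qed.

Lemma LZ_S v m x t xi tau : LZ v m.+1 x t xi tau =
  \int[mu]_(s in `]tau, t[) \int[mu]_(y in [set: R]) (LZ1 v x t y s * LZ v m y s xi tau).
Proof. by []. Qed.

Lemma measurable_LZ1_y N v w : coef_pair al lam rho A N v w -> forall x t s,
  measurable_fun setT (fun y : R => LZ1 v x t y s).
Proof.
move=> h x t s; apply: (measurable_LZ1 (coef_pair_measurable al0 h) (cp_ca_gt0 lam0 h)) => //.
Qed.

Lemma measurable_LZ_y N v w : coef_pair al lam rho A N v w -> forall m s xi tau,
  measurable_fun setT (fun y : R => LZ v m y s xi tau).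
Proof.
by move=> h m s xi tau; apply: (measurable_LZ _ (coef_pair_measurable al0 h) (cp_ca_gt0 lam0 h)).
Qed.

Lemma measurable_LZ_inner N v w : coef_pair al lam rho A N v w -> forall m x t xi tau,
  measurable_fun setT (fun s : R =>
    \int[mu]_(y in [set: R]) (LZ1 v x t y s * LZ v m y s xi tau)).
Proof.
move=> h m x t xi tau.
have mv := coef_pair_measurable al0 h; have v0 := cp_ca_gt0 lam0 h.
apply: (measurable_Rintegral_param
  (f := fun z : R * R => LZ1 v x t z.2 z.1 * LZ v m z.2 z.1 xi tau)).
apply: measurable_funM; first exact: measurable_LZ1.
exact: measurable_LZ.
Qed.

(* The factor [expR (am.2 * (t - tau))], with [am.2] large, makes each convolution contract
   by [1/2], in place of the usual decay of the constants through the Gamma function. *)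
Lemma LZ_bound : exists2 am : R * R, 0 < am.1 /\ 0 < am.2 &
  forall (N : R) v w, coef_pair al lam rho A N v w ->
  forall m (x t xi tau : R), tau < t -> t - tau <= S ->
  pb N (am.1 * (1/2) ^+ m * expR (am.2 * (t - tau)) * tw al (t - tau) * gk c (x - xi) (t - tau))
    (LZ v m x t xi tau) (LZ w m x t xi tau).
Proof.
have [K K0 hK] := LZ1_bound al0 al1 lam0 lamrho A1 S1.
have a0 := al0; have a1 := al1; have S1' := S1; have S0 : 0 < S by lra.
have g0 := gconst_gt0; have c0 := ckn_gt0.
pose p := al / 2; have p0 : 0 < p by rewrite /p; lra.
have p1 : p <= 1 by rewrite /p; lra.
have p20 : 0 < p / 2 by lra.
have p21 : p / 2 <= 1 by lra.
have b0 := beta_bound_gt0 p20 p0.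
(* The inductive step multiplies by [2 * K * gconst c * beta_bound (p / 2) p * S * eps], which the
   inverse of this number, taken as [eps], makes equal to [1 / 2]. *)
have KgS : 0 < 4 * (K * gconst c * beta_bound (p / 2) p * S) by rewrite !mulr_gt0.
have eps0 : 0 < (4 * (K * gconst c * beta_bound (p / 2) p * S))^-1 by rewrite invr_gt0.
have [m0 m00 hm] := exp_damping p20 eps0 S0.
set eps := _^-1 in eps0 hm.
exists (K, m0) => //= N v w h; have N0 := cp_N h.
have h_l := coef_pair_l h; have h_r := coef_pair_r h.
elim=> [|m IH] x t xi tau tt tS.
  rewrite expr0 mulr1; apply: pb_le (hK _ _ _ x _ xi _ h tt tS) => //.
  rewrite ler_wpM2r ?gk_ge0// ler_wpM2r ?tw_ge0// ler_peMr ?(ltW K0)//.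
  by rewrite -expR0 ler_expR mulr_ge0 ?(ltW m00)//; lra.
rewrite !LZ_S; set u := t - tau in tS *; have u0 : 0 < u by rewrite /u; lra.
pose D := 2 * K * (K * (1/2) ^+ m) * expR (m0 * u) * eps * gconst c * gk c (x - xi) u.
have D0 : 0 <= D by rewrite /D; nonneg.
have [] := @conv_pb R N D (p / 2) p tau t _ _ N0 D0 p20 p0 p21 p1 tt
  (measurable_LZ_inner h_l m x t xi tau) (measurable_LZ_inner h_r m x t xi tau).
  move=> s st; have ts0 : 0 < t - s by lra.
  have s0 : 0 < s - tau by lra.
  have tsS : t - s <= S by rewrite /u in tS; lra.
  have ssS : s - tau <= S by rewrite /u in tS; lra.
  have st1 : s < t by lra.
  have st2 : tau < s by lra.
  have [_ _] := inner_pb N0 c0 ts0 s0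
    (measurable_LZ1_y h_l x t s) (measurable_LZ1_y h_r x t s)
    (measurable_LZ_y h_l m s xi tau) (measurable_LZ_y h_r m s xi tau)
    (fun y => hK _ _ _ x _ y _ h st1 tsS) (fun y => IH y _ xi _ st2 ssS).
  apply: pb_le => //.
  rewrite (_ : t - s + (s - tau) = u); last by rewrite /u; ring.
  have := hm _ ts0 tsS.
  (* Half of the exponent [p] is kept for integrability at [s = t], the other half is used up by
     [exp_damping]; the exponential needed there is the part of [expR (m0 * u)] that the induction
     hypothesis at [s - tau] does not contain. *)
  have e : (t - s) `^ (p - 1) = (t - s) `^ (p / 2) * (t - s) `^ (p / 2 - 1).
    by rewrite -powRDp//; congr (_ `^ _); field.
  rewrite /D /tw -/p e.
  rewrite (_ : m0 * u = m0 * (s - tau) + m0 * (t - s)); last by rewrite /u; ring.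
  rewrite expRD expRN ler_pdivrMr ?expR_gt0//.
  move: ((t - s) `^ (p / 2)) ((t - s) `^ (p / 2 - 1)) ((s - tau) `^ (p - 1))
    (expR (m0 * (s - tau))) (expR (m0 * (t - s))) (gk c (x - xi) u)
    (powR_ge0 (t - s) (p / 2 - 1)) (powR_ge0 (s - tau) (p - 1))
    (expR_ge0 (m0 * (s - tau))) (gk_ge0 c (x - xi) u).
  move=> X Y Z E1 E2 G Y0 Z0 E10 G0 XE.
  rewrite -subr_ge0 (_ : _ - _ = 2 * K * (K * (1 / 2) ^+ m) * E1 * gconst c * G * Y * Z * (eps * E2 - X)); last by ring.
  apply: mulr_ge0; [nonneg|by rewrite subr_ge0].
move=> _ _; apply: pb_le => //.
have hS : u `^ (p / 2 + p - 1) <= S * tw al u by rewrite /tw -/p; apply: powR_ratio_le => //; lra.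
apply: (@le_trans _ _ (D * beta_bound (p / 2) p * (S * tw al u))).
  by rewrite ler_wpM2l// mulr_ge0// ltW.
rewrite le_eqVlt; apply/orP; left; apply/eqP; rewrite /D /eps exprS; field.
by rewrite !gt_eqF.
Qed.

End iterated_kernels.

Section spacetime_convolution.
Context {R : realType}.
Let mu := @lebesgue_measure R.
Variables (N c DF DG p q x x' t xi tau : R) (Fv Fw Gv Gw : R -> R -> R).
Hypotheses (N0 : 0 <= N) (c0 : 0 < c) (DF0 : 0 <= DF) (DG0 : 0 <= DG)
  (p0 : 0 < p) (p1 : p <= 1) (q0 : 0 < q) (q1 : q <= 1) (tt : tau < t).
Hypotheses (mFv : measurable_fun [set: R * R] (fun z => Fv z.1 z.2))
  (mFw : measurable_fun [set: R * R] (fun z => Fw z.1 z.2))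
  (mGv : measurable_fun [set: R * R] (fun z => Gv z.1 z.2))
  (mGw : measurable_fun [set: R * R] (fun z => Gw z.1 z.2)).

Lemma measurable_slice (F : R -> R -> R) : measurable_fun [set: R * R] (fun z => F z.1 z.2) ->
  forall s, measurable_fun setT (fun y => F y s).
Proof. by move=> mF s; apply: (measurable_pair_comp mF). Qed.

Lemma measurable_inner (F G : R -> R -> R) : measurable_fun [set: R * R] (fun z => F z.1 z.2) ->
  measurable_fun [set: R * R] (fun z => G z.1 z.2) ->
  measurable_fun setT (fun s : R => \int[mu]_(y in [set: R]) (F y s * G y s)).
Proof.
move=> mF mG; apply: (measurable_Rintegral_param
  (f := fun z : R * R => F z.2 z.1 * G z.2 z.1)).
by apply: measurable_funM; [apply: (measurable_pair_comp mF)|apply: (measurable_pair_comp mG)].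
Qed.

Lemma conv_bound2 :
  (forall y s : R, tau < s < t ->
    pb N (DF * (t - s) `^ (p - 1) * (gk c (x - y) (t - s) + gk c (x' - y) (t - s)))
      (Fv y s) (Fw y s)) ->
  (forall y s : R, tau < s < t ->
    pb N (DG * (s - tau) `^ (q - 1) * gk c (y - xi) (s - tau)) (Gv y s) (Gw y s)) ->
  [/\ forall s, tau < s < t -> mu.-integrable setT (EFin \o (fun y => Fv y s * Gv y s)) /\
        mu.-integrable setT (EFin \o (fun y => Fw y s * Gw y s)),
      mu.-integrable `]tau, t[ (EFin \o (fun s => \int[mu]_(y in [set: R]) (Fv y s * Gv y s))) /\
      mu.-integrable `]tau, t[ (EFin \o (fun s => \int[mu]_(y in [set: R]) (Fw y s * Gw y s))) &
  pb N (2 * DF * DG * gconst c * beta_bound p q * (t - tau) `^ (p + q - 1) *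
     (gk c (x - xi) (t - tau) + gk c (x' - xi) (t - tau)))
    (\int[mu]_(s in `]tau, t[) \int[mu]_(y in [set: R]) (Fv y s * Gv y s))
    (\int[mu]_(s in `]tau, t[) \int[mu]_(y in [set: R]) (Fw y s * Gw y s))].
Proof.
move=> hF hG.
have g0 : 0 <= gconst c by exact: sqrtr_ge0.
have inner s : tau < s < t -> [/\ mu.-integrable setT (EFin \o (fun y => Fv y s * Gv y s)),
   mu.-integrable setT (EFin \o (fun y => Fw y s * Gw y s)) &
   pb N (2 * (DF * (t - s) `^ (p - 1)) * (DG * (s - tau) `^ (q - 1)) * gconst c *
     (gk c (x - xi) (t - tau) + gk c (x' - xi) (t - tau)))
    (\int[mu]_(y in [set: R]) (Fv y s * Gv y s)) (\int[mu]_(y in [set: R]) (Fw y s * Gw y s))].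
  move=> st; have ts0 : 0 < t - s by lra.
  have s0 : 0 < s - tau by lra.
  have := inner_pb2 N0 c0 ts0 s0 (measurable_slice mFv s) (measurable_slice mFw s)
    (measurable_slice mGv s) (measurable_slice mGw s)
    (fun y => hF y s st) (fun y => hG y s st).
  by rewrite (_ : t - s + (s - tau) = t - tau); last by ring.
pose D := 2 * DF * DG * gconst c * (gk c (x - xi) (t - tau) + gk c (x' - xi) (t - tau)).
have D0 : 0 <= D by have DFp := DF0; have DGp := DG0; rewrite /D; nonneg.
have [] := @conv_pb R N D p q tau t _ _ N0 D0 p0 q0 p1 q1 tt
  (measurable_inner mFv mGv) (measurable_inner mFw mGw).
  move=> s st; have [_ _] := inner s st; apply: pb_le => //.
  by rewrite le_eqVlt; apply/orP; left; apply/eqP; rewrite /D; ring.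
move=> i1 i2 h; split => //.
  by move=> s /inner[].
apply: pb_le h => //.
by rewrite le_eqVlt; apply/orP; left; apply/eqP; rewrite /D; ring.
Qed.

Lemma conv_bound :
  (forall y s : R, tau < s < t ->
    pb N (DF * (t - s) `^ (p - 1) * gk c (x - y) (t - s)) (Fv y s) (Fw y s)) ->
  (forall y s : R, tau < s < t ->
    pb N (DG * (s - tau) `^ (q - 1) * gk c (y - xi) (s - tau)) (Gv y s) (Gw y s)) ->
  [/\ forall s, tau < s < t -> mu.-integrable setT (EFin \o (fun y => Fv y s * Gv y s)) /\
        mu.-integrable setT (EFin \o (fun y => Fw y s * Gw y s)),
      mu.-integrable `]tau, t[ (EFin \o (fun s => \int[mu]_(y in [set: R]) (Fv y s * Gv y s))) /\
      mu.-integrable `]tau, t[ (EFin \o (fun s => \int[mu]_(y in [set: R]) (Fw y s * Gw y s))) &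
  pb N (2 * DF * DG * gconst c * beta_bound p q * (t - tau) `^ (p + q - 1) *
     gk c (x - xi) (t - tau))
    (\int[mu]_(s in `]tau, t[) \int[mu]_(y in [set: R]) (Fv y s * Gv y s))
    (\int[mu]_(s in `]tau, t[) \int[mu]_(y in [set: R]) (Fw y s * Gw y s))].
Proof.
move=> hF hG.
have g0 : 0 <= gconst c by exact: sqrtr_ge0.
have inner s : tau < s < t -> [/\ mu.-integrable setT (EFin \o (fun y => Fv y s * Gv y s)),
   mu.-integrable setT (EFin \o (fun y => Fw y s * Gw y s)) &
   pb N (2 * (DF * (t - s) `^ (p - 1)) * (DG * (s - tau) `^ (q - 1)) * gconst c *
     gk c (x - xi) (t - tau))
    (\int[mu]_(y in [set: R]) (Fv y s * Gv y s)) (\int[mu]_(y in [set: R]) (Fw y s * Gw y s))].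
  move=> st; have ts0 : 0 < t - s by lra.
  have s0 : 0 < s - tau by lra.
  have := inner_pb N0 c0 ts0 s0 (measurable_slice mFv s) (measurable_slice mFw s)
    (measurable_slice mGv s) (measurable_slice mGw s)
    (fun y => hF y s st) (fun y => hG y s st).
  by rewrite (_ : t - s + (s - tau) = t - tau); last by ring.
pose D := 2 * DF * DG * gconst c * gk c (x - xi) (t - tau).
have D0 : 0 <= D by have DFp := DF0; have DGp := DG0; rewrite /D; nonneg.
have [] := @conv_pb R N D p q tau t _ _ N0 D0 p0 q0 p1 q1 tt
  (measurable_inner mFv mGv) (measurable_inner mFw mGw).
  move=> s st; have [_ _] := inner s st; apply: pb_le => //.
  by rewrite le_eqVlt; apply/orP; left; apply/eqP; rewrite /D; ring.
move=> i1 i2 h; split => //.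
  by move=> s /inner[].
apply: pb_le h => //.
by rewrite le_eqVlt; apply/orP; left; apply/eqP; rewrite /D; ring.
Qed.

End spacetime_convolution.

(** * Hoelder continuity of the iterates in space *)

Section iterated_kernels_hoelder.
Context {R : realType}.
Let mu := @lebesgue_measure R.
Variables (al lam rho A S : R).
Hypotheses (al0 : 0 < al) (al1 : al <= 1) (lam0 : 0 < lam) (lamrho : lam <= rho)
  (A1 : 1 <= A) (S1 : 1 <= S).
Let c := ckn rho.

Lemma hoelder_weight (d s : R) : 0 <= d -> 0 < s ->
  (d * isp s) `^ (al / 2) * tw al s = d `^ (al / 2) * s `^ (al / 4 - 1).
Proof.
move=> d0 s0; rewrite powRM// ?(ltW (isp_gt0 s0))// -mulrA; congr (_ * _).
by rewrite isp_powR// -powRrM /tw -powRDp//; congr (_ `^ _); field.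
Qed.

(** No induction: in a convolution only the first factor [LZ1] depends on [x], so its Hoelder bound
    is convolved with the bound of the remaining factor, which also supplies the decay [(1/2)^m]. *)
Lemma LZ_hoelder : exists2 K : R, 0 < K &
  forall (N : R) v w, coef_pair al lam rho A N v w ->
  forall m (x x' t xi tau : R), tau < t -> t - tau <= S ->
  pb N (K * (1/2) ^+ m * (`|x - x'| `^ (al / 2) * (t - tau) `^ (al / 4 - 1)) *
      (gk c (x - xi) (t - tau) + gk c (x' - xi) (t - tau)))
    (LZ v m x t xi tau - LZ v m x' t xi tau) (LZ w m x t xi tau - LZ w m x' t xi tau).
Proof.
have [[a m0] /= [a0 m00] hLZ] := LZ_bound al0 al1 lam0 lamrho A1 S1.
have [K K0 hK] := LZ1_hoelder al0 al1 lam0 lamrho A1 S1.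
have [K1 K10 hK1] := LZ1_bound al0 al1 lam0 lamrho A1 S1.
have a0' := al0; have a1' := al1; have S1' := S1; have S0 : 0 < S by lra.
have g0 := gconst_gt0 lam0 lamrho; have c0 := ckn_gt0 lam0 lamrho.
have q0 : 0 < al / 2 by lra.
have q1 : al / 2 <= 1 by lra.
have p0 : 0 < al / 4 by lra.
have p1 : al / 4 <= 1 by lra.
have b0 := beta_bound_gt0 p0 q0.
pose K' := 2 * K * (2 * a * expR (m0 * S)) * gconst c * beta_bound (al / 4) (al / 2) * S.
have K'0 : 0 <= K' by rewrite /K'; nonneg.
exists (K + K') => [|N v w h m x x' t xi tau tt tS]; first lra.
have N0 := cp_N h.
have h_l := coef_pair_l h; have h_r := coef_pair_r h.
have s0 : 0 < t - tau by lra.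
case: m => [|m].
  apply: pb_le (hK _ _ _ x x' _ xi _ h tt tS) => //.
  rewrite hoelder_weight// expr0 mulr1 ler_wpM2r//; first nonneg.
  by rewrite ler_wpM2r ?lerDl// mulr_ge0 ?powR_ge0.
have mv := coef_pair_measurable al0 h_l; have v0 := cp_ca_gt0 lam0 h_l.
have mw := coef_pair_measurable al0 h_r; have w0 := cp_ca_gt0 lam0 h_r.
have mLZ1 u z : mcoef u -> (forall x t, 0 < ca u x t) ->
    measurable_fun [set: R * R] (fun y => LZ1 u z t y.1 y.2).
  by move=> mu_ u0; apply: measurable_LZ1.
have mLZ u : mcoef u -> (forall x t, 0 < ca u x t) ->
    measurable_fun [set: R * R] (fun y => LZ u m y.1 y.2 xi tau).
  by move=> mu_ u0; apply: measurable_LZ.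
have DG0 : 0 <= a * (1/2) ^+ m * expR (m0 * S) by nonneg.
have hG N' v' w' (h' : coef_pair al lam rho A N' v' w') (y s : R) : tau < s < t ->
    pb N' (a * (1/2) ^+ m * expR (m0 * S) * (s - tau) `^ (al / 2 - 1) * gk c (y - xi) (s - tau))
      (LZ v' m y s xi tau) (LZ w' m y s xi tau).
  move=> st; have st2 : tau < s by lra.
  have ssS : s - tau <= S by lra.
  apply: pb_le (hLZ _ _ _ h' m y s xi tau st2 ssS); first exact: cp_N h'.
  rewrite ler_wpM2r ?gk_ge0// ler_wpM2r ?powR_ge0// ler_wpM2l//; first nonneg.
  by rewrite ler_expR ler_wpM2l// ltW.
(* Linearity of the integrals requires integrability at both [x] and [x'], supplied by the case
   [N = 0] of [conv_bound]. *)
have subE u (hu : coef_pair al lam rho A 0 u u) (mu_ : mcoef u) (u0 : forall x t, 0 < ca u x t) :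
    LZ u m.+1 x t xi tau - LZ u m.+1 x' t xi tau =
    \int[mu]_(s in `]tau, t[) \int[mu]_(y in [set: R])
      ((LZ1 u x t y s - LZ1 u x' t y s) * LZ u m y s xi tau).
  have hF z (y s : R) : tau < s < t ->
      pb 0 (K1 * (t - s) `^ (al / 2 - 1) * gk c (z - y) (t - s)) (LZ1 u z t y s) (LZ1 u z t y s).
    by move=> st; apply: (hK1 _ _ _ _ _ _ _ hu); lra.
  have cb z := conv_bound (lexx 0) c0 (ltW K10) DG0 q0 q1 q0 q1 tt (mLZ1 u z mu_ u0)
    (mLZ1 u z mu_ u0) (mLZ u mu_ u0) (mLZ u mu_ u0) (hF z) (hG _ _ _ hu).
  have [j1 [i1 _] _] := cb x; have [j2 [i2 _] _] := cb x'.
  rewrite !LZ_S; apply: etrans; first exact/esym/(RintegralB _ i1 i2).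
  apply: eq_Rintegral => s; rewrite inE set_ooE => st.
  rewrite -RintegralB//; [|by have [] := j1 _ st|by have [] := j2 _ st].
  by apply: eq_Rintegral => y _; rewrite mulrBl.
rewrite !subE//.
have hF (y s : R) : tau < s < t ->
    pb N (K * `|x - x'| `^ (al / 2) * (t - s) `^ (al / 4 - 1) *
        (gk c (x - y) (t - s) + gk c (x' - y) (t - s)))
      (LZ1 v x t y s - LZ1 v x' t y s) (LZ1 w x t y s - LZ1 w x' t y s).
  move=> st; have ts0 : 0 < t - s by lra.
  have st1 : s < t by lra.
  have tsS : t - s <= S by lra.
  have := hK _ _ _ x x' _ y _ h st1 tsS.
  by rewrite hoelder_weight// mulrA.
have Kd : 0 <= K * `|x - x'| `^ (al / 2) by nonneg.
have [_ _] := conv_bound2 N0 c0 Kd DG0 p0 p1 q0 q1 tt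
  (measurable_funB (mLZ1 v x mv v0) (mLZ1 v x' mv v0))
  (measurable_funB (mLZ1 w x mw w0) (mLZ1 w x' mw w0)) (mLZ v mv v0) (mLZ w mw w0) hF (hG _ _ _ h).
apply: pb_le => //.
have g2 : 0 <= gk c (x - xi) (t - tau) + gk c (x' - xi) (t - tau) by nonneg.
rewrite ler_wpM2r//.
have hS : (t - tau) `^ (al / 4 + al / 2 - 1) <= S * (t - tau) `^ (al / 4 - 1).
  by apply: powR_ratio_le => //; lra.
apply: (@le_trans _ _ (K' * (1 / 2) ^+ m.+1 * (`|x - x'| `^ (al / 2) * (t - tau) `^ (al / 4 - 1)))).
  have Q0 : 0 <= 2 * (K * `|x - x'| `^ (al / 2)) * (a * (1 / 2) ^+ m * expR (m0 * S)) *
    gconst c * beta_bound (al / 4) (al / 2) by nonneg.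
  apply: (le_trans (ler_wpM2l Q0 hS)).
  by rewrite le_eqVlt; apply/orP; left; apply/eqP; rewrite /K' exprS; field.
have W0 : 0 <= `|x - x'| `^ (al / 2) * (t - tau) `^ (al / 4 - 1) by nonneg.
have h12 : 0 <= (1 / 2 : R) ^+ m.+1 by rewrite exprn_ge0.
by rewrite ler_wpM2r// ler_wpM2r// lerDr ltW.
Qed.

End iterated_kernels_hoelder.

(** * The series [parametrix_phi]: bounds, regularity, measurability *)

Section phi_bounds.
Context {R : realType}.
Let mu := @lebesgue_measure R.
Variables (al lam rho A S : R).
Hypotheses (al0 : 0 < al) (al1 : al <= 1) (lam0 : 0 < lam) (lamrho : lam <= rho)
  (A1 : 1 <= A) (S1 : 1 <= S).
Let c := ckn rho.

Definition phi_term (v : coeffs R) x t xi tau (m : nat) : R :=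
  (-1) ^+ m.+1 * LZ v m x t xi tau.

Lemma phiE v x t xi tau :
  parametrix_phi v x t xi tau = limn (series (phi_term v x t xi tau)).
Proof. by []. Qed.

Lemma pb_sign (N B f g : R) m : pb N B f g -> pb N B ((-1) ^+ m * f) ((-1) ^+ m * g).
Proof. by move=> /(pbZ ((-1) ^+ m)); rewrite normrX normrN1 expr1n mul1r. Qed.

Lemma phi_bound : exists2 K : R, 0 < K & forall (N : R) v w, coef_pair al lam rho A N v w ->
  forall (x t xi tau : R), tau < t -> t - tau <= S ->
  [/\ cvgn (series (phi_term v x t xi tau)), cvgn (series (phi_term w x t xi tau)) &
  pb N (K * tw al (t - tau) * gk c (x - xi) (t - tau))
    (parametrix_phi v x t xi tau) (parametrix_phi w x t xi tau)].
Proof.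
have [[a m0] /= [a0 m00] hLZ] := LZ_bound al0 al1 lam0 lamrho A1 S1.
exists (2 * (a * expR (m0 * S))) => [|N v w h x t xi tau tt tS].
  by rewrite !mulr_gt0 ?expR_gt0.
have N0 := cp_N h.
have hm m : pb N (a * expR (m0 * S) * tw al (t - tau) * gk c (x - xi) (t - tau) * (1/2) ^+ m)
    (phi_term v x t xi tau m) (phi_term w x t xi tau m).
  apply: pb_sign; apply: pb_le (hLZ _ _ _ h m x t xi tau tt tS) => //.
  rewrite [leRHS](_ : _ = a * (1/2) ^+ m * expR (m0 * S) * tw al (t - tau) * gk c (x - xi) (t - tau)); last by ring.
  rewrite ler_wpM2r ?gk_ge0// ler_wpM2r ?tw_ge0// ler_wpM2l//; first nonneg.
  by rewrite ler_expR ler_wpM2l// ltW.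
have [cv cw hp] := pb_series N0 hm.
by split => //; rewrite !phiE; apply: pb_le hp => //; rewrite !mulrA.
Qed.

Lemma phi_hoelder : exists2 K : R, 0 < K & forall (N : R) v w, coef_pair al lam rho A N v w ->
  forall (x x' t xi tau : R), tau < t -> t - tau <= S ->
  pb N (K * (`|x - x'| `^ (al / 2) * (t - tau) `^ (al / 4 - 1)) *
      (gk c (x - xi) (t - tau) + gk c (x' - xi) (t - tau)))
    (parametrix_phi v x t xi tau - parametrix_phi v x' t xi tau)
    (parametrix_phi w x t xi tau - parametrix_phi w x' t xi tau).
Proof.
have [K K0 hK] := LZ_hoelder al0 al1 lam0 lamrho A1 S1.
have [K1 K10 hp] := phi_bound.
exists (2 * K) => [|N v w h x x' t xi tau tt tS]; first by rewrite mulr_gt0.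
have N0 := cp_N h.
have hm m : pb N (K * (`|x - x'| `^ (al / 2) * (t - tau) `^ (al / 4 - 1)) *
      (gk c (x - xi) (t - tau) + gk c (x' - xi) (t - tau)) * (1/2) ^+ m)
    (phi_term v x t xi tau m - phi_term v x' t xi tau m)
    (phi_term w x t xi tau m - phi_term w x' t xi tau m).
  rewrite -!mulrBr; apply: pb_sign; apply: pb_le (hK _ _ _ h m x x' t xi tau tt tS) => //.
  by rewrite le_eqVlt; apply/orP; left; apply/eqP; ring.
have [cv cw] := pb_series N0 hm.
have subE u : cvgn (series (phi_term u x t xi tau)) -> cvgn (series (phi_term u x' t xi tau)) ->
    limn (series (fun m => phi_term u x t xi tau m - phi_term u x' t xi tau m)) =
    parametrix_phi u x t xi tau - parametrix_phi u x' t xi tau.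
  move=> c1 c2; apply: cvg_lim => //.
  rewrite (_ : series _ = (fun n => series (phi_term u x t xi tau) n - series (phi_term u x' t xi tau) n)).
    by apply: cvgB.
  by apply/funext => n; rewrite /series/= sumrB.
have [cx cwx _] := hp _ _ _ h x t xi tau tt tS.
have [cx' cwx' _] := hp _ _ _ h x' t xi tau tt tS.
rewrite subE// subE//; apply: pb_le => //.
by rewrite !mulrA.
Qed.

End phi_bounds.

Section phi_measurability.
Context {R : realType}.
Variables (al lam rho A : R).
Hypotheses (al0 : 0 < al) (al1 : al <= 1) (lam0 : 0 < lam) (lamrho : lam <= rho)
  (A1 : 1 <= A).

Lemma LZ_eq0 v m (x t xi tau : R) : (forall x t, 0 < ca v x t) -> t <= tau ->
  LZ v m x t xi tau = 0.
Proof.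
move=> v0 tt; case: m => [|m]; first exact: LZ1_eq0.
by rewrite LZ_S set_itv_ge ?Rintegral_set0// bnd_simp -leNgt.
Qed.

Lemma phi_eq0 v (x t xi tau : R) : (forall x t, 0 < ca v x t) -> t <= tau ->
  parametrix_phi v x t xi tau = 0.
Proof.
move=> v0 tt; rewrite phiE; apply: cvg_lim => //.
rewrite (_ : series _ = cst 0); first exact: cvg_cst.
by apply/funext => n; rewrite /series/= big1// => i _; rewrite /phi_term LZ_eq0// mulr0.
Qed.

(** Convergence is wanted at all points, since measurability is obtained from an everywhere
    pointwise limit. For [t <= tau] all terms vanish; otherwise the bound on elapsed times is
    adapted to the point. *)
Lemma phi_cvg v (x t xi tau : R) : coef_pair al lam rho A 0 v v ->
  series (phi_term v x t xi tau) @ \oo --> parametrix_phi v x t xi tau.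
Proof.
move=> h; have [tt|tt] := leP t tau.
  rewrite phi_eq0//; last exact: (cp_ca_gt0 lam0 h).
  rewrite (_ : series _ = cst 0); first exact: cvg_cst.
  apply/funext => n; rewrite /series/= big1// => i _.
  by rewrite /phi_term LZ_eq0 ?mulr0//; exact: (cp_ca_gt0 lam0 h).
have S1 : 1 <= Num.max 1 (t - tau) by rewrite le_max lexx.
have [K K0 hK] := phi_bound al0 al1 lam0 lamrho A1 S1.
have [cv _ _] := hK _ _ _ h x t xi tau tt ltac:(by rewrite le_max lexx orbT).
exact: cv.
Qed.

Lemma measurable_phi v d (T0 : measurableType d) (X T : T0 -> R) xi tau :
  coef_pair al lam rho A 0 v v -> measurable_fun setT X -> measurable_fun setT T ->
  measurable_fun setT (fun q => parametrix_phi v (X q) (T q) xi tau).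
Proof.
move=> h mX mT.
apply: (measurable_fun_cvg (h := fun n q => series (phi_term v (X q) (T q) xi tau) n)).
  move=> n; rewrite /series/=; elim: n => [|n IH].
    by under eq_fun do rewrite big_geq//; exact: measurable_cst.
  under eq_fun do rewrite big_nat_recr//=.
  apply: measurable_funD => //; apply: measurable_funM => //.
  by apply: (measurable_LZ _ (coef_pair_measurable al0 h) (cp_ca_gt0 lam0 h)).
by move=> q _; exact: phi_cvg.
Qed.

End phi_measurability.

Section densities.
Context {R : realType}.
Variables (al lam rho A S : R).
Hypotheses (al0 : 0 < al) (al1 : al <= 1) (lam0 : 0 < lam) (lamrho : lam <= rho)
  (A1 : 1 <= A) (S1 : 1 <= S).
Let c := ckn rho.

(** The hypotheses under which heat kernels are convolved with a function. They are met by [phi],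
    and by [a * phi], which appears when a time derivative falls on the kernel. *)
Record density (K N xi tau : R) (f g : R -> R -> R) : Prop := Density {
  dn_mf : measurable_fun [set: R * R] (fun z => f z.1 z.2);
  dn_mg : measurable_fun [set: R * R] (fun z => g z.1 z.2);
  dn_bound : forall y s : R, tau < s -> s - tau <= S ->
    pb N (K * tw al (s - tau) * gk c (y - xi) (s - tau)) (f y s) (g y s);
  dn_hoelder : forall y y' s : R, tau < s -> s - tau <= S ->
    pb N (K * (`|y - y'| `^ (al / 2) * (s - tau) `^ (al / 4 - 1)) *
      (gk c (y - xi) (s - tau) + gk c (y' - xi) (s - tau))) (f y s - f y' s) (g y s - g y' s)
}.

Lemma phi_density : exists2 K : R, 0 < K & forall (N : R) v w, coef_pair al lam rho A N v w ->
  forall xi tau : R,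
  density K N xi tau (fun y s => parametrix_phi v y s xi tau)
    (fun y s => parametrix_phi w y s xi tau) /\
  density K N xi tau (fun y s => ca v y s * parametrix_phi v y s xi tau)
    (fun y s => ca w y s * parametrix_phi w y s xi tau).
Proof.
have [K K0 hK] := phi_bound al0 al1 lam0 lamrho A1 S1.
have [K' K'0 hK'] := phi_hoelder al0 al1 lam0 lamrho A1 S1.
have A1' := A1; have S1' := S1; have a0 := al0; have a1 := al1.
have A0 : 0 < A by lra.
have S0 : 0 < S by lra.
have KA : 0 < K * A * S by rewrite !mulr_gt0.
have K'A : 0 < K' * A by rewrite !mulr_gt0.
have KA0 : K * A <= K * A * S by rewrite ler_peMr// mulr_ge0 ?ltW.
have KA1 : K <= K * A by rewrite ler_peMr ?(ltW K0).
have K'A1 : K' <= K' * A by rewrite ler_peMr ?(ltW K'0).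
pose Kd := 4 * (K * A * S) + 2 * (K' * A).
have [KKd KKd' KAd KAd'] : [/\ K <= Kd, K' <= Kd, 2 * A * K <= Kd & 0 <= Kd].
  by rewrite /Kd; split; lra.
exists Kd => [|N v w h xi tau]; first by rewrite /Kd; lra.
have N0 := cp_N h; have h_l := coef_pair_l h; have h_r := coef_pair_r h.
have mphi u : coef_pair al lam rho A 0 u u ->
    measurable_fun [set: R * R] (fun z => parametrix_phi u z.1 z.2 xi tau).
  by move=> hu; apply: (measurable_phi al0 al1 lam0 lamrho A1).
have b (y s : R) : tau < s -> s - tau <= S ->
    pb N (K * tw al (s - tau) * gk c (y - xi) (s - tau))
      (parametrix_phi v y s xi tau) (parametrix_phi w y s xi tau).
  by move=> ts sS; have [] := hK _ _ _ h y s xi tau ts sS.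
split; split.
- exact: mphi.
- exact: mphi.
- move=> y s ts sS; apply: pb_le (b y s ts sS) => //.
  by rewrite ler_wpM2r ?gk_ge0// ler_wpM2r ?tw_ge0.
- move=> y y' s ts sS; apply: pb_le (hK' _ _ _ h y y' s xi tau ts sS) => //.
  rewrite ler_wpM2r//; first nonneg.
  by rewrite ler_wpM2r//; nonneg.
- by apply: measurable_funM; [have [] := coef_pair_measurable al0 h_l|exact: mphi].
- by apply: measurable_funM; [have [] := coef_pair_measurable al0 h_r|exact: mphi].
- move=> y s ts sS; apply: pb_le (pbM N0 (cp_a h y s) (b y s ts sS)) => //.
  rewrite (_ : 2 * A * _ = 2 * A * K * tw al (s - tau) * gk c (y - xi) (s - tau)); last by ring.
  by rewrite ler_wpM2r ?gk_ge0// ler_wpM2r ?tw_ge0.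
- move=> y y' s ts sS; have s0 : 0 < s - tau by lra.
  (* The coefficient is Hoelder of order [al]. At distances up to [1] this implies order [al / 2];
     at larger distances the bound on its size replaces the increment. *)
  have hd2 : pb N (2 * A * `|y - y'| `^ (al / 2)) (ca v y s - ca v y' s) (ca w y s - ca w y' s).
    have [d1|d1] := leP `|y - y'| 1.
      have := cp_ah h y y' s s; rewrite hd_space//; apply: pb_le => //.
      apply: (@le_trans _ _ (A * `|y - y'| `^ (al / 2))).
        rewrite ler_wpM2l ?(ltW A0)//.
        have [->|dn0] := eqVneq `|y - y'| 0; first by rewrite !powR0 ?gt_eqF//; lra.
        by apply: ger_powR; [rewrite lt0r dn0 normr_ge0|lra].
      by rewrite ler_wpM2r ?powR_ge0//; lra.
    apply: pb_le (pbB (cp_a h y s) (cp_a h y' s)) => //.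
    rewrite -mulr2n -[A *+ 2]mulr_natl ler_peMr//; first lra.
    by rewrite -[leLHS](powRr0 `|y - y'|); apply: ler_powR; lra.
  have := pbD (pbM N0 hd2 (b y s ts sS)) (pbM N0 (cp_a h y' s) (hK' _ _ _ h y y' s xi tau ts sS)).
  have E (p q f g : R) : (p - q) * f + q * (f - g) = p * f - q * g by ring.
  rewrite !E; apply: pb_le => //.
  have hS : tw al (s - tau) <= S * (s - tau) `^ (al / 4 - 1).
    by apply: powR_ratio_le => //; lra.
  have d0 := powR_ge0 `|y - y'| (al / 2); have q0 := powR_ge0 (s - tau) (al / 4 - 1).
  have g0 := gk_ge0 c (y - xi) (s - tau); have g0' := gk_ge0 c (y' - xi) (s - tau).
  move: (`|y - y'| `^ _) ((s - tau) `^ _) (gk c (y - xi) _) (gk c (y' - xi) _) (tw al _) d0 q0 g0 g0' hS.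
  move=> d q g g' W d0 q0 g0 g0' hS.
  have p1 : 2 * (2 * A * d) * (K * W * g) <= 4 * (K * A * S) * (d * q) * (g + g').
    rewrite (_ : 2 * _ * _ = 4 * (K * A) * d * (W * g)); last by ring.
    rewrite (_ : 4 * (K * A * S) * (d * q) * _ = 4 * (K * A) * d * (S * q * (g + g'))); last by ring.
    have KAp : 0 < K * A by rewrite mulr_gt0.
    apply: ler_wpM2l; first nonneg.
    apply: (@le_trans _ _ (S * q * g)); first by rewrite ler_wpM2r.
    by rewrite ler_wpM2l ?lerDl//; nonneg.
  rewrite (_ : Kd * _ * _ = 4 * (K * A * S) * (d * q) * (g + g') +
     2 * A * (K' * (d * q) * (g + g'))); last by rewrite /Kd; ring.
  by rewrite lerD2r.
Qed.

End densities.

(** * Volume potentials *)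

Section kernel_integrals.
Context {R : realType}.
Let mu := @lebesgue_measure R.
Implicit Types (c k x z s r : R).

Lemma integral_gk c x s : 0 < c -> 0 < s ->
  mu.-integrable setT (EFin \o (fun y => gk c (x - y) s)) /\
  \int[mu]_(y in [set: R]) gk c (x - y) s = gconst c.
Proof.
move=> c0 s0; have cs0 : 0 < c / s by rewrite divr_gt0.
have [i e] := integral_gauss_shift x cs0.
have E : (fun y => gk c (x - y) s) = (fun y => isp s * expR (- (c / s * (y - x) ^+ 2))).
  by apply/funext => y; rewrite gkE//; congr (_ * expR _); ring.
rewrite E; split; first exact: integrable_scale.
rewrite RintegralZl// e /gconst /isp.
rewrite (_ : pi / (c / s) = pi / c * s); last by field; rewrite !gt_eqF.
rewrite sqrtrM ?divr_ge0 ?pi_ge0 ?ltW//.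
by rewrite mulrCA mulVf ?mulr1// gt_eqF// sqrtr_gt0.
Qed.

Lemma h0_gk k z s : 0 < k -> 0 < s -> h0 k z s = ipi * Num.sqrt k * gk k z s.
Proof.
move=> k0 s0; rewrite gkE// /h0 /Fr expRD.
by rewrite expR_half_ln//; ring.
Qed.

Lemma integral_h0 k x s : 0 < k -> 0 < s ->
  mu.-integrable setT (EFin \o (fun y => h0 k (x - y) s)) /\
  \int[mu]_(y in [set: R]) h0 k (x - y) s = 1.
Proof.
move=> k0 s0; have [i e] := integral_gk x k0 s0.
have E : (fun y => h0 k (x - y) s) = (fun y => ipi * Num.sqrt k * gk k (x - y) s).
  by apply/funext => y; rewrite h0_gk.
rewrite E; split; first exact: integrable_scale.
rewrite RintegralZl// e /gconst /ipi sqrtrM ?pi_ge0// sqrtrV ?(ltW k0)//.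
by field; rewrite !gt_eqF ?sqrtr_gt0 ?pi_gt0.
Qed.

(** Bounding the weight at all times of [[r, s']] by the one at the latest time yields a majorant in
    [y] when differentiating in time. *)
Lemma gk_time_le c z r s s' : 0 <= c -> 0 < r -> r <= s -> s <= s' ->
  gk c z s <= r `^ (- 2^-1) * s' `^ (2^-1) * gk c z s'.
Proof.
move=> c0 r0 rs ss.
have s0 : 0 < s by lra.
have s'0 : 0 < s' by lra.
have -> : r `^ (- 2^-1) * s' `^ 2^-1 * gk c z s' = r `^ (- 2^-1) * expR (- (c * (z ^+ 2 / s'))).
  by rewrite /gk -mulrA [X in _ * X]mulrA -powRDp// subrr powRr0 mul1r.
apply: ler_pM; rewrite ?powR_ge0 ?expR_ge0//.
  by apply: le_powR_neg => //; rewrite oppr_le0 invr_ge0.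
rewrite ler_expR lerN2 ler_wpM2l// ler_wpM2l ?sqr_ge0//.
by rewrite lef_pV2 ?posrE.
Qed.

Lemma hxx_single k : 0 < k -> exists2 C : R, 0 < C & forall z s : R, 0 < s ->
  `|hxx k z s| <= C * isp s ^+ 2 * gk (k / 2) z s.
Proof.
move=> k0; have [C C0 hC] := @ker_bounds R k k 0 k0 (lexx k) (lexx 0).
exists C => // z s s0.
have kp : kpair k k 0 0 k k by split; rewrite ?lexx ?subrr ?normr0 ?mulr0.
have [_ _ [h _ _] _] := hC 0 k k z s kp s0.
exact: h.
Qed.

Lemma measurable_kernel_y (F : R -> R -> R -> R) k x s :
  F = h0 \/ F = hx \/ F = hxx -> measurable_fun setT (fun y : R => F k (x - y) s).
Proof.
have mxy : measurable_fun setT (fun y : R => x - y) by exact: measurable_funB.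
have [m0 m1 m2] := measurable_kernels (@measurable_cst _ _ _ _ setT k) mxy (@measurable_cst _ _ _ _ setT s).
by move=> [->|[->|->]].
Qed.

(** The mass of [h0] is [1] at every time, and by the heat equation its derivative in [s] is
    [(4 * k)^-1] times the integral of [hxx]. *)
Lemma integral_hxx k x s : 0 < k -> 0 < s ->
  mu.-integrable setT (EFin \o (fun y => hxx k (x - y) s)) /\
  \int[mu]_(y in [set: R]) hxx k (x - y) s = 0.
Proof.
move=> k0 s0; have [C C0 hC] := hxx_single k0.
have k20 : 0 < k / 2 by lra.
have ks : 0 < (4 * k)^-1 by rewrite invr_gt0; lra.
have s20 : 0 < s / 2 by lra.
have mh r : measurable_fun setT (fun y : R => hxx k (x - y) r).
  by apply: measurable_kernel_y; right; right.
have ih : mu.-integrable setT (EFin \o (fun y => hxx k (x - y) s)).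
  have [i _] := integral_gk x k20 s0.
  apply: (@integrable_le _ _ _ (fun y => C * isp s ^+ 2 * gk (k / 2) (x - y) s)) => //.
    by move=> y _; exact: hC.
  exact: integrable_scale.
split => //.
pose G (y : R) := (4 * k)^-1 * (C * isp (s / 2) ^+ 2 *
  ((s / 2) `^ (- 2^-1) * (2 * s) `^ 2^-1 * gk (k / 2) (x - y) (2 * s))).
have iG : mu.-integrable setT (EFin \o G).
  have s2 : 0 < 2 * s by lra.
  have [i _] := integral_gk x k20 s2.
  rewrite /G; apply: integrable_scale => //; apply: integrable_scale => //.
  exact: integrable_scale.
have near_s (r : R) : `|r - s| < s / 2 -> s / 2 <= r <= 2 * s /\ 0 < r.
  by rewrite ltr_norml; lra.
have D : is_derive s 1 (fun r => \int[mu]_(y in [set: R]) h0 k (x - y) r)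
    (\int[mu]_(y in [set: R]) ((4 * k)^-1 * hxx k (x - y) s)).
  apply: (@is_derive_integral R setT (fun r y => h0 k (x - y) r)
    (fun r y => (4 * k)^-1 * hxx k (x - y) r) G s (s / 2)) => //.
  - by move=> r /near_s[_ r0]; have [] := integral_h0 x k0 r0.
  - by move=> r y /near_s[_ r0] _; apply: der_h0_s.
  - move=> r y /near_s[/andP[r1 r2] r0] _.
    rewrite normrM gtr0_norm// /G ler_wpM2l ?(ltW ks)//.
    apply: (le_trans (hC _ _ r0)).
    have e1 : isp r ^+ 2 <= isp (s / 2) ^+ 2.
      by rewrite !sqr_isp// lef_pV2 ?posrE.
    have e2 := gk_time_le (x - y) (ltW k20) s20 r1 r2.
    apply: ler_pM => //; rewrite ?gk_ge0//.
      by rewrite mulr_ge0 ?exprn_ge0 ?(ltW C0) ?(ltW (isp_gt0 r0)).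
    by rewrite ler_wpM2l// ltW.
have D1 : is_derive s 1 (fun r => \int[mu]_(y in [set: R]) h0 k (x - y) r) 0.
  apply: is_derive_near (dercst s 1).
  near=> r; have r0 : 0 < r by near: r; exact: lt_nbhsr.
  by have [_ ->] := integral_h0 x k0 r0.
have E : \int[mu]_(y in [set: R]) ((4 * k)^-1 * hxx k (x - y) s) = 0.
  by have [_ <-] := D; have [_ ->] := D1.
move: E; rewrite RintegralZl// => /eqP; rewrite mulf_eq0 gt_eqF//=.
by move=> /eqP.
Unshelve. all: by end_near. Qed.

End kernel_integrals.

(** * Time slices of the volume potential *)

Section potentials.
Context {R : realType}.
Let mu := @lebesgue_measure R.
Variables (al lam rho A S : R).
Hypotheses (al0 : 0 < al) (al1 : al <= 1) (lam0 : 0 < lam) (lamrho : lam <= rho)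
  (A1 : 1 <= A) (S1 : 1 <= S).
Let c := ckn rho.
Let k0 := (4 * rho)^-1.
Let k1 := (4 * lam)^-1.
Let k00 : 0 < k0 := k0_gt0 lam0 lamrho.
Let k01 : k0 <= k1 := k0_le_k1 lam0 lamrho.

(** The kernel coefficient is taken at the integration point [y], so the kernel is not a function of
    [x - y] alone and has no exact cancellation; hence the later freezing of [kap]. *)
Definition pot (ker : R -> R -> R -> R) (v : coeffs R) (f : R -> R -> R) (x t s : R) :=
  \int[mu]_(y in [set: R]) (ker (kap v y s) (x - y) (t - s) * f y s).

Lemma measurable_kernels_joint v x t : mcoef v ->
  [/\ measurable_fun [set: R * R] (fun z => h0 (kap v z.1 z.2) (x - z.1) (t - z.2)),
      measurable_fun [set: R * R] (fun z => hx (kap v z.1 z.2) (x - z.1) (t - z.2)) &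
      measurable_fun [set: R * R] (fun z => hxx (kap v z.1 z.2) (x - z.1) (t - z.2))].
Proof.
by move=> mv; apply: measurable_kernels; [exact: measurable_kap|
  exact: measurable_funB|exact: measurable_funB].
Qed.

Definition admissible_kernel (ker : R -> R -> R -> R) := ker = h0 \/ ker = hx \/ ker = hxx.

Lemma measurable_kernel_joint ker v x t : admissible_kernel ker -> mcoef v ->
  measurable_fun [set: R * R] (fun z => ker (kap v z.1 z.2) (x - z.1) (t - z.2)).
Proof. by move=> [->|[->|->]] mv; have [] := measurable_kernels_joint x t mv. Qed.

Lemma measurable_pot ker v f x t : admissible_kernel ker -> mcoef v ->
  measurable_fun [set: R * R] (fun z => f z.1 z.2) ->
  measurable_fun setT (pot ker v f x t).
Proof.
move=> hk mv mf.
exact: (measurable_inner (F := fun y s => ker (kap v y s) (x - y) (t - s))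
  (measurable_kernel_joint x t hk mv) mf).
Qed.

Lemma gk_half (c' z s s' : R) : 0 <= c' -> 0 < s -> s / 2 <= s' -> s' <= s ->
  gk c' z s' <= 2 * gk c' z s.
Proof.
move=> c'0 s0 h1 h2; have s20 : 0 < s / 2 by lra.
apply: le_trans (gk_time_le z c'0 s20 h1 h2) _.
rewrite ler_wpM2r ?gk_ge0//.
have -> : s `^ 2^-1 = (s / 2) `^ 2^-1 * 2 `^ 2^-1.
  by rewrite -powRM//; [congr (_ `^ _); field|lra].
rewrite mulrA -powRDp// addNr powRr0 mul1r.
by apply: ler1_powR; lra.
Qed.

Lemma powR_half (s s' r : R) : 0 < s -> s / 2 <= s' -> 0 < r -> r <= 1 ->
  s' `^ (r - 1) <= 2 * s `^ (r - 1).
Proof.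
move=> s0 h1 r0 r1; have s20 : 0 < s / 2 by lra.
apply: le_trans (le_powR_sub1 s20 h1 r1) _.
rewrite powRM ?(ltW s0)// mulrC ler_wpM2r ?powR_ge0//.
rewrite -powR_inv1// -powRrM mulN1r opprB.
by apply: ler1_powR; lra.
Qed.

(** These bounds ignore cancellation; the last one is singular like [(t - s)^-1] and useful only
    away from [s = t]. *)
Lemma pot_bounds01 (Kd : R) : 0 < Kd -> exists2 K : R, 0 < K & forall (N : R) v w,
  coef_pair al lam rho A N v w -> forall (xi tau : R) f g,
  density al rho S Kd N xi tau f g -> forall x t s : R, tau < s < t -> t - tau <= S ->
  [/\ (forall ker, admissible_kernel ker ->
       mu.-integrable setT (EFin \o (fun y => ker (kap v y s) (x - y) (t - s) * f y s))),
      pb N (K * (s - tau) `^ (al / 2 - 1) * gk c (x - xi) (t - tau)) (pot h0 v f x t s) (pot h0 w g x t s),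
      pb N (K * ((t - s) `^ (1/2 - 1) * (s - tau) `^ (al / 2 - 1)) * gk c (x - xi) (t - tau))
        (pot hx v f x t s) (pot hx w g x t s) &
      pb N (K * ((t - s)^-1 * (s - tau) `^ (al / 2 - 1)) * gk c (x - xi) (t - tau))
        (pot hxx v f x t s) (pot hxx w g x t s)].
Proof.
move=> Kd0; have k00p := k00.
have [M M0 hM] := kap_pairs al lam0 lamrho A1.
have [C C0 hC] := ker_bounds k00 k01 M0.
have g0 := gconst_gt0 lam0 lamrho; have c0 := ckn_gt0 lam0 lamrho.
have ck : c <= k0 / 2 by rewrite /c /ckn -/k0; lra.
exists (2 * C * Kd * gconst c); first by rewrite !mulr_gt0.
move=> N v w h xi tau f g hd x t s st tS; have N0 := cp_N h.
have ts0 : 0 < t - s by lra.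
have s0 : 0 < s - tau by lra.
have ts1 : tau < s by lra.
have sS : s - tau <= S by lra.
have mv := coef_pair_measurable al0 (coef_pair_l h).
have mw := coef_pair_measurable al0 (coef_pair_r h).
have i0 := isp_gt0 ts0.
have [hk _] := hM _ _ _ h.
have inner ker B : admissible_kernel ker -> 0 <= B ->
    (forall y : R, pb N (B * gk (k0 / 2) (x - y) (t - s)) (ker (kap v y s) (x - y) (t - s))
      (ker (kap w y s) (x - y) (t - s))) ->
    mu.-integrable setT (EFin \o (fun y => ker (kap v y s) (x - y) (t - s) * f y s)) /\
    pb N (2 * B * (Kd * (s - tau) `^ (al / 2 - 1)) * gconst c * gk c (x - xi) (t - tau))
      (pot ker v f x t s) (pot ker w g x t s).
  move=> hker B0 hB.
  have hB' (y : R) : pb N (B * gk c (x - y) (t - s)) (ker (kap v y s) (x - y) (t - s))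
      (ker (kap w y s) (x - y) (t - s)).
    by apply: pb_le (hB y) => //; rewrite ler_wpM2l// gk_le.
  have [i1 _] := inner_pb N0 c0 ts0 s0
    (measurable_slice (F := fun y s => ker (kap v y s) (x - y) (t - s)) (measurable_kernel_joint x t hker mv) s)
    (measurable_slice (F := fun y s => ker (kap w y s) (x - y) (t - s)) (measurable_kernel_joint x t hker mw) s)
    (measurable_slice (dn_mf hd) s) (measurable_slice (dn_mg hd) s) hB'
    (fun y => dn_bound hd y ts1 sS).
  by rewrite (_ : t - s + (s - tau) = t - tau); last by ring.
have Kp0 : 0 <= Kd * (s - tau) `^ (al / 2 - 1) by nonneg.
have [j0 p0] := inner h0 C (or_introl erefl) (ltW C0)
  (fun y => let: And4 e _ _ _ := hC _ _ _ (x - y) _ (hk y s) ts0 in e).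
have [j1 p1] := inner hx (C * isp (t - s)) (or_intror (or_introl erefl)) (mulr_ge0 (ltW C0) (ltW i0))
  (fun y => let: And4 _ e _ _ := hC _ _ _ (x - y) _ (hk y s) ts0 in e).
have [j2 p2] := inner hxx (C * isp (t - s) ^+ 2) (or_intror (or_intror erefl))
  (mulr_ge0 (ltW C0) (exprn_ge0 2 (ltW i0)))
  (fun y => let: And4 _ _ e _ := hC _ _ _ (x - y) _ (hk y s) ts0 in e).
split.
- by move=> ker [->|[->|->]].
- by apply: pb_le p0 => //; rewrite le_eqVlt; apply/orP; left; apply/eqP; ring.
- apply: pb_le p1 => //; rewrite isp_powR// (_ : - (1/2) = 1/2 - 1 :> R); last lra.
  by rewrite le_eqVlt; apply/orP; left; apply/eqP; ring.
- apply: pb_le p2 => //; rewrite sqr_isp//.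
  by rewrite le_eqVlt; apply/orP; left; apply/eqP; ring.
Qed.

(* Subtracting [f x s] and freezing [kap] at [x] is free because [hxx] has integral [0]. *)
Lemma pot_hxx_near (Kd : R) : 0 < Kd -> exists2 K : R, 0 < K & forall (N : R) v w,
  coef_pair al lam rho A N v w -> forall (xi tau : R) f g,
  density al rho S Kd N xi tau f g -> forall x t s : R, tau < s < t -> t - tau <= S ->
  (t - tau) / 2 <= s - tau ->
  pb N (K * ((t - s) `^ (al / 4 - 1) * (t - tau) `^ (al / 4 - 1)) * gk c (x - xi) (t - tau))
    (pot hxx v f x t s) (pot hxx w g x t s).
Proof.
move=> Kd0; have k00p := k00; have S1p := S1; have a0 := al0; have a1 := al1.
have S0 : 0 < S by lra.
have [p41 p40 p21 p20] : [/\ al / 4 <= 1, 0 < al / 4, al / 2 <= 1 & 0 < al / 2] by split; lra.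
have e1 : al / 4 - 1 <= al / 2 - 1 by lra.
have e2 : al / 2 - 1 - (al / 4 - 1) <= 1 by lra.
have [M M0 hM] := kap_pairs al lam0 lamrho A1.
have [C C0 hC] := ker_bounds k00 k01 M0.
have [C2 C20 hC2] := ker_incr_bounds k00 k01 M0.
have [K1 K10 hK1] := pot_bounds01 Kd0.
have g0 := gconst_gt0 lam0 lamrho; have c0 := ckn_gt0 lam0 lamrho.
have ck : c < k0 / 2 by rewrite /c /ckn -/k0; lra.
have [C' C'0 hC'] := gk_absorb 1 ck.
(* Weights at [s - tau] are traded for those at [t - tau] at the price of a factor [2] each. So [6]
   is [2 * (1 + 2)], with [1 + 2] for the convolved and the pointwise Gaussian of the Hoelder bound,
   and [4] is [2 * 2]. *)
exists (2 * C * C' * Kd * gconst c * 6 + 2 * Kd * (C2 * C') * gconst c * 4 * (S * S)).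
  by rewrite addr_gt0// !mulr_gt0.
move=> N v w h xi tau f g hd x t s st tS hs; have N0 := cp_N h.
have ts0 : 0 < t - s by lra.
have s0 : 0 < s - tau by lra.
have tt0 : 0 < t - tau by lra.
have ts1 : tau < s by lra.
have sS : s - tau <= S by lra.
have tsS : t - s <= S by lra.
have sst : s - tau <= t - tau by lra.
have hv := coef_pair_l h; have hw := coef_pair_r h.
have mv := coef_pair_measurable al0 hv.
have mw := coef_pair_measurable al0 hw.
have [hk hinc] := hM _ _ _ h.
have ir0 := isp_gt0 ts0.
set r := t - s in ts0 tsS ir0 *.
pose Sq := (s - tau) `^ (al / 4 - 1); pose gx := gk c (x - xi) (s - tau).
pose Q1 := 2 * C * C' * Kd * Sq * r `^ (al / 4 - 1).
pose B1 (y : R) := Q1 * (gk c (x - y) r * gk c (y - xi) (s - tau) + gx * gk c (x - y) r).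
pose Q2 := C2 * C' * r `^ (al / 2 - 1).
pose B2 (y : R) := Q2 * gk c (x - y) r.
have Sq0 : 0 <= Sq by exact: powR_ge0.
have gx0 : 0 <= gx by exact: gk_ge0.
have Q10 : 0 <= Q1 by rewrite /Q1; nonneg.
have Q20 : 0 <= Q2 by rewrite /Q2; nonneg.
have [ig eg] := integral_gk x c0 ts0.
have [igg egg] := gk_conv x xi c0 ts0 s0.
have iB1 : mu.-integrable setT (EFin \o B1).
  by apply: integrable_scale => //; apply: integrable_add => //; exact: integrable_scale.
have iB2 : mu.-integrable setT (EFin \o B2) by exact: integrable_scale.
have eB1 : \int[mu]_(y in [set: R]) B1 y = Q1 * (gconst c * gk c (x - xi) (t - tau) + gx * gconst c).
  rewrite /B1 RintegralZl//; last by apply: integrable_add => //; exact: integrable_scale.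
  rewrite RintegralD//; last exact: integrable_scale.
  rewrite RintegralZl// egg eg (_ : r + (s - tau) = t - tau)//.
  by rewrite /r; ring.
have eB2 : \int[mu]_(y in [set: R]) B2 y = Q2 * gconst c by rewrite /B2 RintegralZl// eg.
(* The integrand is [D1 y + e x s * D2 y] plus [e x s] times the kernel frozen at [x], which
   integrates to zero. [D1] gains from the Hoelder bound of the density, [D2] from that of the
   coefficient. *)
pose D1 u (e : R -> R -> R) (y : R) := hxx (kap u y s) (x - y) r * (e y s - e x s).
pose D2 u (y : R) := hxx (kap u y s) (x - y) r - hxx (kap u x s) (x - y) r.
have absorb (b y : R) : 0 < b -> b <= 1 ->
    isp r ^+ 2 * `|y - x| `^ b * gk (k0 / 2) (x - y) r <= C' * r `^ (b / 2 - 1) * gk c (x - y) r.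
  move=> b0 b1; rewrite (distrC y).
  have hA := hC' (x - y) _ ts0; rewrite expr1 in hA.
  have hP := powR_abs_le (x - y) b0 b1 ts0.
  rewrite -/(tw b r) -(twE b ts0).
  apply: (@le_trans _ _ (isp r ^+ 2 * (r `^ (b / 2) * (1 + (x - y) ^+ 2 / r)) * gk (k0 / 2) (x - y) r)).
    by rewrite ler_wpM2r ?gk_ge0// ler_wpM2l//; nonneg.
  rewrite [leLHS](_ : _ = isp r ^+ 2 * r `^ (b / 2) * ((1 + (x - y) ^+ 2 / r) * gk (k0 / 2) (x - y) r)); last by ring.
  rewrite [leRHS](_ : _ = isp r ^+ 2 * r `^ (b / 2) * (C' * gk c (x - y) r)); last by ring.
  by rewrite ler_wpM2l//; nonneg.
have pD1 (y : R) : pb N (B1 y) (D1 v f y) (D1 w g y).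
  have [_ _ e2' _] := hC _ _ _ (x - y) _ (hk y s) ts0.
  apply: pb_le (pbM N0 e2' (dn_hoelder hd y x ts1 sS)) => //.
  have := absorb (al / 2) y p20 p21.
  rewrite (_ : al / 2 / 2 = al / 4); last by field.
  move=> ab; rewrite -/Sq -/gx /B1.
  rewrite [leLHS](_ : _ = 2 * C * Kd * Sq * (gk c (y - xi) (s - tau) + gx) *
    (isp r ^+ 2 * `|y - x| `^ (al / 2) * gk (k0 / 2) (x - y) r)); last by ring.
  rewrite [leRHS](_ : _ = 2 * C * Kd * Sq * (gk c (y - xi) (s - tau) + gx) *
    (C' * r `^ (al / 4 - 1) * gk c (x - y) r)); last by rewrite /Q1; ring.
  by rewrite ler_wpM2l//; nonneg.
have pD2 (y : R) : pb N (B2 y) (D2 v y) (D2 w y).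
  have d0 : 0 <= `|y - x| `^ al by exact: powR_ge0.
  have hi := hinc y x s s; rewrite (hd_space al0) in hi.
  have [_ e2'] := hC2 _ _ _ _ _ (x - y) _ _ (hk y s) (hk x s) hi d0 ts0.
  apply: pb_le e2' => //; rewrite /B2 /Q2.
  have := absorb al y a0 a1 => ab.
  rewrite [leLHS](_ : _ = C2 * (isp r ^+ 2 * `|y - x| `^ al * gk (k0 / 2) (x - y) r)); last by ring.
  rewrite [leRHS](_ : _ = C2 * (C' * r `^ (al / 2 - 1) * gk c (x - y) r)); last by ring.
  by rewrite ler_wpM2l// ltW.
have mD u (e : R -> R -> R) : mcoef u -> measurable_fun [set: R * R] (fun z => e z.1 z.2) ->
    measurable_fun setT (D1 u e) /\ measurable_fun setT (D2 u).
  move=> mu_ me.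
  have m1 := measurable_slice (F := fun y s => hxx (kap u y s) (x - y) (t - s))
    (measurable_kernel_joint x t (or_intror (or_intror erefl)) mu_) s.
  have m2 := measurable_slice (F := e) me s.
  have m3 : measurable_fun setT (fun y : R => hxx (kap u x s) (x - y) r).
    by apply: measurable_kernel_y; right; right.
  split; last exact: measurable_funB.
  by apply: measurable_funM => //; exact: measurable_funB.
have [mD1v mD2v] := mD v f mv (dn_mf hd); have [mD1w mD2w] := mD w g mw (dn_mg hd).
have P1 := pb_integral measurableT mD1v mD1w (fun y _ => pD1 y) iB1 N0 (lexx _).
have P2 := pb_integral measurableT mD2v mD2w (fun y _ => pD2 y) iB2 N0 (lexx _).
have potE u (e : R -> R -> R) : (forall x t, 0 < ca u x t) ->
    mu.-integrable setT (EFin \o D1 u e) -> mu.-integrable setT (EFin \o D2 u) ->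
    pot hxx u e x t s = \int[mu]_(y in [set: R]) D1 u e y + e x s * \int[mu]_(y in [set: R]) D2 u y.
  move=> u0 i1 i2; have kx : 0 < kap u x s by rewrite invr_gt0 mulr_gt0.
  have [i3 e3] := integral_hxx x kx ts0.
  have i2' : mu.-integrable setT (EFin \o (fun y => e x s * D2 u y)) by exact: integrable_scale.
  have i3' : mu.-integrable setT (EFin \o (fun y => e x s * hxx (kap u x s) (x - y) r)) by exact: integrable_scale.
  have -> : pot hxx u e x t s = \int[mu]_(y in [set: R])
      ((D1 u e y + e x s * D2 u y) + e x s * hxx (kap u x s) (x - y) r).
    by apply: eq_Rintegral => y _; rewrite /D1 /D2 -/r; ring.
  rewrite RintegralD//; last exact: integrable_add.
  by rewrite RintegralD// !RintegralZl// e3 mulr0 addr0.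
have integ (e B : R -> R) (me : measurable_fun setT e) (iB : mu.-integrable setT (EFin \o B))
    (eB : forall y : R, `|e y| <= B y) : mu.-integrable setT (EFin \o e).
  by apply: (@integrable_le _ _ _ B) => // y _.
rewrite (potE v f); last 3 first.
- exact: (cp_ca_gt0 lam0 hv).
- by apply: (integ _ _ mD1v iB1) => y; case: (pD1 y).
- by apply: (integ _ _ mD2v iB2) => y; case: (pD2 y).
rewrite (potE w g); last 3 first.
- exact: (cp_ca_gt0 lam0 hw).
- by apply: (integ _ _ mD1w iB1) => y; case: (pD1 y).
- by apply: (integ _ _ mD2w iB2) => y; case: (pD2 y).
apply: pb_le (pbD P1 (pbM N0 (dn_bound hd x ts1 sS) P2)) => //.
rewrite eB1 eB2 -/gx.
have gxG : gx <= 2 * gk c (x - xi) (t - tau) by apply: gk_half => //; exact: ltW.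
have SqT : Sq <= 2 * (t - tau) `^ (al / 4 - 1) by exact: powR_half.
have twT : tw al (s - tau) <= 2 * (S * (t - tau) `^ (al / 4 - 1)).
  apply: (@le_trans _ _ (2 * (t - tau) `^ (al / 2 - 1))); first exact: powR_half.
  by rewrite ler_wpM2l//; exact: powR_ratio_le.
have rT : r `^ (al / 2 - 1) <= S * r `^ (al / 4 - 1) by exact: powR_ratio_le.
have G0 := gk_ge0 c (x - xi) (t - tau).
have r0 := powR_ge0 r (al / 4 - 1); have r0' := powR_ge0 r (al / 2 - 1).
have T0 := powR_ge0 (t - tau) (al / 4 - 1); have w0 := tw_ge0 al (s - tau).
rewrite [in leRHS]mulrDl [in leRHS]mulrDl; apply: lerD.
  rewrite /Q1 [leLHS](_ : _ = 2 * C * C' * Kd * gconst c * r `^ (al / 4 - 1) *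
    (Sq * (gk c (x - xi) (t - tau) + gx))); last by ring.
  rewrite [leRHS](_ : _ = 2 * C * C' * Kd * gconst c * r `^ (al / 4 - 1) *
    ((2 * (t - tau) `^ (al / 4 - 1)) * (3 * gk c (x - xi) (t - tau)))); last by ring.
  apply: ler_wpM2l; first nonneg.
  apply: ler_pM => //; first nonneg.
  by rewrite (_ : 3 * _ = gk c (x - xi) (t - tau) + 2 * gk c (x - xi) (t - tau)) ?lerD2l//; ring.
rewrite /Q2 [leLHS](_ : _ = 2 * Kd * (C2 * C') * gconst c * ((tw al (s - tau) * r `^ (al / 2 - 1)) * gx)); last by ring.
rewrite [leRHS](_ : _ = 2 * Kd * (C2 * C') * gconst c *
  (((2 * (S * (t - tau) `^ (al / 4 - 1))) * (S * r `^ (al / 4 - 1))) * (2 * gk c (x - xi) (t - tau)))); last by ring.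
apply: ler_wpM2l; first nonneg.
apply: ler_pM => //; first nonneg.
exact: ler_pM.
Qed.

End potentials.

Section volume_potential.
Context {R : realType}.
Let mu := @lebesgue_measure R.
Variables (al lam rho A S : R).
Hypotheses (al0 : 0 < al) (al1 : al <= 1) (lam0 : 0 < lam) (lamrho : lam <= rho)
  (A1 : 1 <= A) (S1 : 1 <= S).
Let c := ckn rho.
Let k0 := (4 * rho)^-1.
Let k1 := (4 * lam)^-1.
Let k00 : 0 < k0 := k0_gt0 lam0 lamrho.
Let k01 : k0 <= k1 := k0_le_k1 lam0 lamrho.

(* The kernel bound suffices for [s] in the first half of the interval; in the second half
   the cancellation in [pot_hxx_near] is needed. *)
Lemma pot_hxx_bound (Kd : R) : 0 < Kd -> exists2 K : R, 0 < K & forall (N : R) v w,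
  coef_pair al lam rho A N v w -> forall (xi tau : R) f g,
  density al rho S Kd N xi tau f g -> forall x t s : R, tau < s < t -> t - tau <= S ->
  pb N (gk c (x - xi) (t - tau) * endpoint_bound (K * (t - tau)^-1)
      (K * (t - tau) `^ (al / 4 - 1)) (al / 4) (al / 2) tau t s)
    (pot hxx v f x t s) (pot hxx w g x t s).
Proof.
move=> Kd0.
have [K1 K10 h1] := pot_bounds01 S al0 lam0 lamrho A1 Kd0.
have [K2 K20 h2] := pot_hxx_near al0 al1 lam0 lamrho A1 S1 Kd0.
have K120 : 0 < 2 * K1 + K2 by lra.
have [K12 K21] : K1 * 2 <= 2 * K1 + K2 /\ K2 <= 2 * K1 + K2 by lra.
exists (2 * K1 + K2) => // N v w h xi tau f g hd x t s st tS; have N0 := cp_N h.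
have G0 := gk_ge0 c (x - xi) (t - tau).
have P0 := powR_ge0 (s - tau) (al / 2 - 1).
have Q0 := powR_ge0 (t - s) (al / 4 - 1).
have T0 := powR_ge0 (t - tau) (al / 4 - 1).
have tt0 : 0 < t - tau by lra.
have ti0 : 0 < (t - tau)^-1 by rewrite invr_gt0.
have [hs|hs] := leP ((t - tau) / 2) (s - tau).
  apply: pb_le (h2 _ _ _ h _ _ _ _ hd x t s st tS hs) => //.
  rewrite mulrC ler_wpM2l// /endpoint_bound.
  rewrite -[leLHS]add0r; apply: lerD; first nonneg.
  by rewrite -[leRHS]mulrA [X in _ <= _ * X]mulrC; apply: ler_wpM2r => //; nonneg.
have [_ _ _ h3] := h1 _ _ _ h _ _ _ _ hd x t s st tS.
apply: pb_le h3 => //.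
rewrite mulrC ler_wpM2l// /endpoint_bound.
rewrite -[leLHS]addr0; apply: lerD; last nonneg.
rewrite mulrA; apply: ler_wpM2r => //.
have ts : (t - s)^-1 <= 2 * (t - tau)^-1.
  rewrite (_ : 2 * _ = ((t - tau) / 2)^-1); last by field; rewrite gt_eqF.
  by rewrite lef_pV2 ?posrE; lra.
apply: (le_trans (ler_wpM2l (ltW K10) ts)).
by rewrite mulrA ler_wpM2r// ltW.
Qed.

Definition vpot ker v f (tau x t : R) := \int[mu]_(s in `]tau, t[) pot ker v f x t s.

Lemma vpot_bounds (Kd : R) : 0 < Kd -> exists2 K : R, 0 < K & forall (N : R) v w,
  coef_pair al lam rho A N v w -> forall (xi tau : R) f g,
  density al rho S Kd N xi tau f g -> forall x t : R, tau < t -> t - tau <= S ->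
  [/\ pb N (K * gk c (x - xi) (t - tau)) (vpot h0 v f tau x t) (vpot h0 w g tau x t),
      pb N (K * (t - tau) `^ (- (1/2)) * gk c (x - xi) (t - tau))
        (vpot hx v f tau x t) (vpot hx w g tau x t) &
      pb N (K * (t - tau)^-1 * gk c (x - xi) (t - tau))
        (vpot hxx v f tau x t) (vpot hxx w g tau x t)].
Proof.
move=> Kd0.
have [K1 K10 h1] := pot_bounds01 S al0 lam0 lamrho A1 Kd0.
have [K2 K20 h2] := pot_hxx_bound Kd0.
have [a0 a1 S1'] : [/\ 0 < al, al <= 1 & 1 <= S] by [].
have [[p41 p40 p21 p20] S0] : [/\ al / 4 <= 1, 0 < al / 4, al / 2 <= 1 & 0 < al / 2] /\ 0 < S.
  by split; [split|]; lra.
have [h20 h21] : 0 < (1/2 : R) /\ (1/2 : R) <= 1 by lra.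
have b0 := beta_bound_gt0 h20 p20.
pose L1 := K1 * S * (al / 2)^-1; pose L2 := K1 * beta_bound (1/2) (al / 2) * S.
pose L3 := K2 * S * (al / 2)^-1 + K2 * S * (al / 4)^-1.
have L10 : 0 <= L1 by rewrite /L1; apply: mulr_ge0; [nonneg|rewrite invr_ge0 ltW].
have L20 : 0 <= L2 by rewrite /L2; nonneg.
have L30 : 0 <= L3.
  by rewrite /L3; apply: addr_ge0; apply: mulr_ge0; rewrite ?invr_ge0 ?(ltW p20) ?(ltW p40)//; nonneg.
have [e1 e2 e3] : [/\ L1 <= L1 + L2 + L3 + 1, L2 <= L1 + L2 + L3 + 1 & L3 <= L1 + L2 + L3 + 1].
  by split; lra.
exists (L1 + L2 + L3 + 1); first lra.
have [r1 r2] : al / 2 - 0 <= 1 /\ 0 <= al / 2 by split; lra.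
have [r3 r4] : - (1/2) <= 1/2 + al / 2 - 1 /\ 1/2 + al/2 - 1 - - (1/2) <= 1 by split; lra.
have [r5 r6] : -1 <= al / 2 - 1 /\ al / 2 - 1 - - 1 <= 1 by split; lra.
move=> N v w h xi tau f g hd x t tt tS; have N0 := cp_N h.
have mv := coef_pair_measurable al0 (coef_pair_l h).
have mw := coef_pair_measurable al0 (coef_pair_r h).
have G0 := gk_ge0 c (x - xi) (t - tau).
have u0 : 0 < t - tau by lra.
have mpv ker : admissible_kernel ker -> measurable_fun setT (pot ker v f x t).
  by move=> hk; apply: measurable_pot => //; exact: dn_mf hd.
have mpw ker : admissible_kernel ker -> measurable_fun setT (pot ker w g x t).
  by move=> hk; apply: measurable_pot => //; exact: dn_mg hd.
have [a_0 a_1 a_2] : [/\ admissible_kernel (@h0 R), admissible_kernel (@hx R) & admissible_kernel (@hxx R)].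
  by split; [left|right; left|right; right].
have mi : measurable `]tau, t[%classic by exact: measurable_itv.
split.
- have [i e] := integral_powR_left tt p20.
  apply: (@pb_integral _ _ _ _ _ (fun s => K1 * gk c (x - xi) (t - tau) * (s - tau) `^ (al / 2 - 1))) => //.
  + by apply: measurable_funTS; exact: mpv.
  + by apply: measurable_funTS; exact: mpw.
  + move=> s; rewrite set_ooE => st.
    have [_ hs _ _] := h1 _ _ _ h _ _ _ _ hd x t s st tS.
    by apply: pb_le hs => //; rewrite mulrAC.
  + exact: integrable_scale.
  + rewrite RintegralZl// e mulrAC ler_wpM2r//.
    apply: le_trans e1; rewrite /L1 mulrA ler_wpM2r ?invr_ge0 ?(ltW p20)// ler_wpM2l ?(ltW K10)//.
    by rewrite -[leRHS]mulr1 -[X in _ <= S * X](powRr0 (t - tau)); apply: powR_ratio_le.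
- have KG0 : 0 <= K1 * gk c (x - xi) (t - tau) by nonneg.
  have [_ _] := @conv_pb R N _ (1/2) (al/2) tau t (pot hx v f x t) (pot hx w g x t) N0 KG0 h20 p20 h21 p21 tt
    (mpv _ a_1) (mpw _ a_1) (fun s st => let: And4 _ _ e _ := h1 _ _ _ h _ _ _ _ hd x t s st tS in
      eq_ind _ (fun B => pb N B _ _) e _ (mulrAC _ _ _)).
  apply: pb_le => //.
  rewrite [leRHS]mulrAC (_ : _ * gk c _ _ * beta_bound _ _ = K1 * beta_bound (1/2) (al/2) * gk c (x - xi) (t - tau)); last by ring.
  rewrite [leLHS]mulrAC [leRHS]mulrAC; apply: ler_wpM2r => //.
  apply: (@le_trans _ _ (L2 * (t - tau) `^ (- (1/2)))); last by rewrite ler_wpM2r ?powR_ge0.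
  rewrite /L2 -[leRHS]mulrA ler_wpM2l//; first nonneg.
  exact: powR_ratio_le.
- have [i e] := integral_endpoint_bound (K2 * (t - tau)^-1) (K2 * (t - tau) `^ (al / 4 - 1)) tt p40 p20.
  apply: (@pb_integral _ _ _ _ _ (fun s => gk c (x - xi) (t - tau) * endpoint_bound (K2 * (t - tau)^-1)
      (K2 * (t - tau) `^ (al / 4 - 1)) (al / 4) (al / 2) tau t s)) => //.
  + by apply: measurable_funTS; exact: mpv.
  + by apply: measurable_funTS; exact: mpw.
  + by move=> s; rewrite set_ooE => st; apply: h2.
  + exact: integrable_scale.
  + rewrite RintegralZl// e mulrC ler_wpM2r//.
    apply: (@le_trans _ _ (L3 * (t - tau)^-1)); last by rewrite ler_wpM2r ?invr_ge0 ?(ltW u0).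
    (* Both terms of the majorant contribute [(t - tau)^(al/2 - 1)]; the cruder [(t - tau)^-1] is
       the rate of the parametrix itself, so nothing is lost in the sum. *)
    have E1 : (t - tau)^-1 * (t - tau) `^ (al / 2) = (t - tau) `^ (al / 2 - 1).
      by rewrite -(powR_inv1 (ltW u0)) -powRDp//; congr (_ `^ _); ring.
    have E2 : (t - tau) `^ (al / 4 - 1) * (t - tau) `^ (al / 4) = (t - tau) `^ (al / 2 - 1).
      by rewrite -powRDp//; congr (_ `^ _); field.
    rewrite [leLHS](_ : _ = K2 * ((t - tau)^-1 * (t - tau) `^ (al / 2)) * (al / 2)^-1 +
      K2 * ((t - tau) `^ (al / 4 - 1) * (t - tau) `^ (al / 4)) * (al / 4)^-1); last by ring.
    rewrite E1 E2.
    have hS : (t - tau) `^ (al / 2 - 1) <= S * (t - tau)^-1.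
      by rewrite -(powR_inv1 (ltW u0)); apply: powR_ratio_le.
    rewrite /L3 mulrDl; apply: lerD.
      rewrite (mulrAC _ _ (t - tau)^-1) ler_wpM2r ?invr_ge0 ?(ltW p20)//.
      by rewrite -[leRHS]mulrA ler_wpM2l ?(ltW K20).
    rewrite (mulrAC _ _ (t - tau)^-1) ler_wpM2r ?invr_ge0 ?(ltW p40)//.
    by rewrite -[leRHS]mulrA ler_wpM2l ?(ltW K20).
Qed.

End volume_potential.

(** * Differentiation of the volume potential *)

Section potential_derivatives.
Context {R : realType}.
Let mu := @lebesgue_measure R.
Variables (al lam rho A S : R).
Hypotheses (al0 : 0 < al) (al1 : al <= 1) (lam0 : 0 < lam) (lamrho : lam <= rho)
  (A1 : 1 <= A) (S1 : 1 <= S).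
Let c := ckn rho.
Let k0 := (4 * rho)^-1.
Let k1 := (4 * lam)^-1.
Let k00 : 0 < k0 := k0_gt0 lam0 lamrho.
Let k01 : k0 <= k1 := k0_le_k1 lam0 lamrho.
Variables (Kd : R) (v : coeffs R) (f : R -> R -> R) (xi tau : R).
Hypotheses (Kd0 : 0 < Kd) (hv : coef_pair al lam rho A 0 v v)
  (hd : density al rho S Kd 0 xi tau f f).

Let c0 : 0 <= c := ltW (ckn_gt0 lam0 lamrho).
Let mv : mcoef v := coef_pair_measurable al0 hv.

Lemma gk_isp (c' z s : R) : 0 <= c' -> 0 < s -> gk c' z s <= isp s.
Proof.
move=> c'0 s0; rewrite gkE// ler_piMr ?(ltW (isp_gt0 s0))//.
rewrite -expR0 ler_expR oppr_le0; apply: mulr_ge0 => //.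
by rewrite divr_ge0 ?sqr_ge0// ltW.
Qed.

Lemma isp_le (s s' : R) : 0 < s -> s <= s' -> isp s' <= isp s.
Proof.
move=> s0 ss; rewrite lef_pV2 ?posrE ?sqrtr_gt0//; first exact: ler_wsqrtr.
exact: lt_le_trans ss.
Qed.

Lemma kap_gt0 y s : 0 < kap v y s.
Proof. by rewrite invr_gt0 mulr_gt0// (cp_ca_gt0 lam0 hv). Qed.

(** At fixed elapsed time the kernels are bounded uniformly in [z], so the density alone serves as
    majorant in [y]; losing the Gaussian is harmless for qualitative statements. *)
Lemma kernel_sup : exists2 C : R, 0 < C & forall y z s r : R, 0 < r ->
  [/\ `|h0 (kap v y s) z r| <= C * isp r, `|hx (kap v y s) z r| <= C * isp r ^+ 2 &
      `|hxx (kap v y s) z r| <= C * isp r ^+ 3].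
Proof.
have [M M0 hM] := kap_pairs al lam0 lamrho A1.
have [C C0 hC] := ker_bounds k00 k01 M0.
have [hk _] := hM _ _ _ hv.
have k20 : 0 <= k0 / 2 by rewrite divr_ge0 ?ltW.
exists C => // y z s r r0.
have g1 := gk_isp z k20 r0; have i0 := ltW (isp_gt0 r0).
have [[e0 _ _] [e1 _ _] [e2 _ _] _] := hC _ _ _ z _ (hk y s) r0.
split.
- by apply: (le_trans e0); rewrite ler_wpM2l ?(ltW C0).
- by apply: (le_trans e1); rewrite expr2 [leRHS]mulrA; apply: ler_wpM2l => //; nonneg.
- by rewrite exprSr [X in _ <= X]mulrA; apply: le_trans (ler_wpM2l _ g1) => //; nonneg.
Qed.

Lemma integrable_slice s B : tau < s -> s - tau <= S ->
  mu.-integrable setT (EFin \o (fun y => B * (Kd * tw al (s - tau) * gk c (y - xi) (s - tau)))).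
Proof.
move=> ts sS; have s0 : 0 < s - tau by lra.
apply: integrable_scale => //; apply: integrable_scale => //.
have [i _] := integral_gk xi (ckn_gt0 lam0 lamrho) s0.
rewrite (_ : (fun y => _) = (fun y => gk c (xi - y) (s - tau)))//.
by apply/funext => y; rewrite /gk -(sqrrN (y - xi)) opprB.
Qed.

Lemma integrable_pot ker (x t s : R) : admissible_kernel ker -> tau < s < t -> s - tau <= S ->
  mu.-integrable setT (EFin \o (fun y => ker (kap v y s) (x - y) (t - s) * f y s)).
Proof.
move=> hk st sS; have [C C0 hC] := kernel_sup.
have ts0 : 0 < t - s by lra.
have ts1 : tau < s by lra.
have i0 := isp_gt0 ts0.
have [C' C'0 hC'] : exists2 C' : R, 0 <= C' & forall y z : R, `|ker (kap v y s) z (t - s)| <= C'.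
  case: hk => [->|[->|->]].
  - by exists (C * isp (t - s)) => [|y z]; [nonneg|have [] := hC y z s _ ts0].
  - by exists (C * isp (t - s) ^+ 2) => [|y z]; [nonneg|have [] := hC y z s _ ts0].
  - by exists (C * isp (t - s) ^+ 3) => [|y z]; [nonneg|have [] := hC y z s _ ts0].
apply: (@integrable_le _ _ _ (fun y => C' * (Kd * tw al (s - tau) * gk c (y - xi) (s - tau)))) => //.
- apply: measurable_funM.
    exact: (measurable_slice (F := fun y s => ker (kap v y s) (x - y) (t - s)) (measurable_kernel_joint x t hk mv) s).
  exact: (measurable_slice (dn_mf hd) s).
- move=> y _; rewrite normrM; apply: ler_pM => //.
  by have [] := dn_bound hd y ts1 sS.
- exact: integrable_slice.
Qed.

Lemma is_derive_pot_x (ker ker' : R -> R -> R -> R) (x t s : R) :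
  (ker = h0 /\ ker' = hx) \/ (ker = hx /\ ker' = hxx) -> tau < s < t -> s - tau <= S ->
  is_derive x 1 (fun x => pot ker v f x t s) (pot ker' v f x t s).
Proof.
move=> kk st sS; have [C C0 hC] := kernel_sup.
have ts0 : 0 < t - s by lra.
have ts1 : tau < s by lra.
have i0 := isp_gt0 ts0.
have hk : admissible_kernel ker by case: kk => [[-> _]|[-> _]]; [left|right; left].
have [C' C'0 hC'] : exists2 C' : R, 0 <= C' & forall y z : R, `|ker' (kap v y s) z (t - s)| <= C'.
  case: kk => [[_ ->]|[_ ->]].
    by exists (C * isp (t - s) ^+ 2) => [|y z]; [nonneg|have [] := hC y z s _ ts0].
  by exists (C * isp (t - s) ^+ 3) => [|y z]; [nonneg|have [] := hC y z s _ ts0].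
apply: (@is_derive_integral R setT (fun x y => ker (kap v y s) (x - y) (t - s) * f y s)
  (fun x y => ker' (kap v y s) (x - y) (t - s) * f y s)
  (fun y => C' * (Kd * tw al (s - tau) * gk c (y - xi) (s - tau))) x 1) => //.
- by move=> z _; exact: integrable_pot.
- move=> z y _ _.
  have D : is_derive (z - y) 1 (fun z => ker (kap v y s) z (t - s)) (ker' (kap v y s) (z - y) (t - s)).
    by case: kk => [[-> ->]|[-> ->]]; [apply: der_h0; exact: kap_gt0|apply: der_hx; exact: kap_gt0].
  have D' := @is_derive1_comp R _ (fun z => z - y) z _ _ D (is_derive_shift y z).
  by apply: der_eq (derM D' (dercst z (f y s))) _; rewrite mulr1 mulr0 addr0.
- exact: integrable_slice.
- move=> z y _ _; rewrite normrM; apply: ler_pM => //.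
  by have [] := dn_bound hd y ts1 sS.
Qed.

(** The heat equation replaces the time derivative of the kernel by [ca v y s] times [hxx]; the
    coefficient is then moved into the density, which is why [a * phi] must satisfy [density]
    too. *)
Lemma is_derive_pot_t (x t s : R) : tau < s < t -> s - tau <= S ->
  is_derive t 1 (fun t => pot h0 v f x t s) (pot hxx v (fun y s => ca v y s * f y s) x t s).
Proof.
move=> st sS; have [C C0 hC] := kernel_sup.
have ts0 : 0 < t - s by lra.
have ts1 : tau < s by lra.
have ts2 : 0 < (t - s) / 2 by lra.
have i0 := isp_gt0 ts2.
have A0 : 0 <= A by exact: le_trans ler01 A1.
pose C' := C * isp ((t - s) / 2) ^+ 3.
apply: (@is_derive_integral R setT (fun t y => h0 (kap v y s) (x - y) (t - s) * f y s)
  (fun t y => hxx (kap v y s) (x - y) (t - s) * (ca v y s * f y s))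
  (fun y => C' * A * (Kd * tw al (s - tau) * gk c (y - xi) (s - tau))) t ((t - s) / 2)) => //.
- move=> r; rewrite ltr_norml => hr; apply: integrable_pot => //; first by left.
  by lra.
- move=> r y; rewrite ltr_norml => hr _; have r0 : 0 < r - s by lra.
  have D := @is_derive1_comp R _ (fun r => r - s) r _ _ (der_h0_s (x - y) (kap_gt0 y s) r0) (is_derive_shift s r).
  apply: der_eq (derM D (dercst r (f y s))) _; rewrite mulr1 mulr0 addr0 /kap.
  have a0 := cp_ca_gt0 lam0 hv y s.
  rewrite (_ : (4 * _)^-1 = ca v y s); last by field; rewrite gt_eqF.
  by ring.
- exact: integrable_slice.
- move=> r y; rewrite ltr_norml => hr _; have r0 : 0 < r - s by lra.
  have [_ _ e] := hC y (x - y) s _ r0.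
  have [e1 _ _] := cp_a hv y s.
  have [e2 _ _] := dn_bound hd y ts1 sS.
  rewrite !normrM mulrA; apply: ler_pM; [nonneg|nonneg| |exact: e2].
  apply: ler_pM => //; apply: (le_trans e).
  rewrite ler_wpM2l ?(ltW C0)// lerXn2r ?nnegrE ?(ltW i0) ?(ltW (isp_gt0 r0))//.
  by apply: isp_le => //; lra.
Qed.

(** The interchange needs a majorant in [s] uniform in [x]. For [hxx] the direct bound [(t - s)^-1]
    would not do; [pot_hxx_bound] provides an integrable one, the Gaussian in [x] being at most
    [isp (t - tau)]. *)
Lemma is_derive_vpot_x (ker ker' : R -> R -> R -> R) (x t : R) :
  (ker = h0 /\ ker' = hx) \/ (ker = hx /\ ker' = hxx) -> tau < t -> t - tau <= S ->
  is_derive x 1 (fun x => vpot ker v f tau x t) (vpot ker' v f tau x t).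
Proof.
move=> kk tt tS.
have [K1 K10 h1] := pot_bounds01 S al0 lam0 lamrho A1 Kd0.
have [K2 K20 h2] := pot_hxx_bound al0 al1 lam0 lamrho A1 S1 Kd0.
have [a0 a1 S1'] : [/\ 0 < al, al <= 1 & 1 <= S] by [].
have [p41 p40 p21 p20] : [/\ al / 4 <= 1, 0 < al / 4, al / 2 <= 1 & 0 < al / 2].
  by split; lra.
have u0 : 0 < t - tau by lra.
have i0 := isp_gt0 u0.
have [h20 h21] : 0 < (1/2 : R) /\ (1/2 : R) <= 1 by lra.
have sS (s : R) : tau < s < t -> s - tau <= S by lra.
have [k_0 k_1 k_2] : [/\ admissible_kernel (@h0 R), admissible_kernel (@hx R) & admissible_kernel (@hxx R)].
  by split; [left|right; left|right; right].
have mp ker0 z : admissible_kernel ker0 -> measurable_fun setT (pot ker0 v f z t).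
  by move=> hk; apply: measurable_pot => //; exact: dn_mf hd.
have mi : measurable `]tau, t[%classic by exact: measurable_itv.
pose i := isp (t - tau).
have gi z : gk c z (t - tau) <= i by exact: gk_isp.
have [G iG hG] : exists2 G : R -> R, mu.-integrable `]tau, t[ (EFin \o G) &
    forall z s : R, tau < s < t -> `|pot ker' v f z t s| <= G s.
  case: kk => -[_ ->].
    exists (fun s => K1 * i * endpoint_bound (((t - tau) / 2) `^ (1/2 - 1)) (((t - tau) / 2) `^ (al/2 - 1)) (1/2) (al/2) tau t s).
      by apply: integrable_scale => //; have [] := integral_endpoint_bound (((t - tau) / 2) `^ (1/2 - 1)) (((t - tau) / 2) `^ (al/2 - 1)) tt h20 p20.
    move=> z s st; have [_ _ [e _ _] _] := h1 _ _ _ hv _ _ _ _ hd z t s st tS.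
    apply: (le_trans e); rewrite mulrAC; apply: ler_pM; rewrite ?prod_endpoint_le//; [nonneg|nonneg|].
    by rewrite ler_wpM2l// ltW.
  exists (fun s => i * endpoint_bound (K2 * (t - tau)^-1)
      (K2 * (t - tau) `^ (al / 4 - 1)) (al / 4) (al / 2) tau t s).
    by apply: integrable_scale => //; have [] := integral_endpoint_bound (K2 * (t - tau)^-1) (K2 * (t - tau) `^ (al / 4 - 1)) tt p40 p20.
  move=> z s st; have [e _ _] := h2 _ _ _ hv _ _ _ _ hd z t s st tS.
  apply: (le_trans e); rewrite ler_wpM2r//.
  by apply: endpoint_bound_ge0; nonneg.
apply: (@is_derive_integral R `]tau, t[ (fun x s => pot ker v f x t s)
  (fun x s => pot ker' v f x t s) G x 1) => //.
- move=> z _; have hk : admissible_kernel ker by case: kk => [[-> _]|[-> _]].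
  case: kk => -[-> _].
    apply: (@integrable_le _ _ _ (fun s => K1 * i * (s - tau) `^ (al / 2 - 1))) => //.
    - by apply: measurable_funTS; exact: mp.
    - move=> s; rewrite set_ooE => st; have [_ [e _ _] _ _] := h1 _ _ _ hv _ _ _ _ hd z t s st tS.
      apply: (le_trans e); rewrite mulrAC ler_wpM2r//; first nonneg.
      by rewrite ler_wpM2l// ltW.
    - by apply: integrable_scale => //; have [] := integral_powR_left tt p20.
  apply: (@integrable_le _ _ _ (fun s => K1 * i * endpoint_bound (((t - tau) / 2) `^ (1/2 - 1)) (((t - tau) / 2) `^ (al/2 - 1)) (1/2) (al/2) tau t s)) => //.
  - by apply: measurable_funTS; exact: mp.
  - move=> s; rewrite set_ooE => st; have [_ _ [e _ _] _] := h1 _ _ _ hv _ _ _ _ hd z t s st tS.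
    apply: (le_trans e); rewrite mulrAC; apply: ler_pM; rewrite ?prod_endpoint_le//; [nonneg|nonneg|].
    by rewrite ler_wpM2l// ltW.
  - by apply: integrable_scale => //; have [] := integral_endpoint_bound (((t - tau) / 2) `^ (1/2 - 1)) (((t - tau) / 2) `^ (al/2 - 1)) tt h20 p20.
- move=> z s _; rewrite set_ooE => st; apply: is_derive_pot_x => //; exact: sS.
- by move=> z s _; rewrite set_ooE => st; exact: hG.
Qed.

End potential_derivatives.

(** * The time derivative *)

Section kernel_continuity.
Context {R : realType}.
Implicit Types (sn : nat -> R) (k z s r : R).

Lemma cvg_Fr r k z sn s : 0 < s -> sn @ \oo --> s ->
  Fr r k (z ^+ 2 / sn n) @[n --> \oo] --> Fr r k (z ^+ 2 / s).
Proof.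
move=> s0 cs; rewrite /Fr.
apply: (@continuous_cvg _ _ _ _ _ _ (@expR R)); first exact: continuous_expR.
apply: cvgB; first exact: cvg_cst.
apply: cvgMr; apply: cvgMr; apply: cvgV => //; exact: lt0r_neq0.
Qed.

Lemma cvg_isp sn s : 0 < s -> sn @ \oo --> s -> isp (sn n) @[n --> \oo] --> isp s.
Proof.
move=> s0 cs; apply: cvgV; first by rewrite gt_eqF// sqrtr_gt0.
apply: (@continuous_cvg _ _ _ _ _ _ (@Num.sqrt R)) => //; exact: sqrt_continuous.
Qed.

Lemma cvg_kernels k z sn s : 0 < s -> sn @ \oo --> s ->
  [/\ h0 k z (sn n) @[n --> \oo] --> h0 k z s,
      hx k z (sn n) @[n --> \oo] --> hx k z s &
      hxx k z (sn n) @[n --> \oo] --> hxx k z s].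
Proof.
move=> s0 cs; have cF r : Fr r k (z ^+ 2 / sn n) @[n --> \oo] --> Fr r k (z ^+ 2 / s) by exact: cvg_Fr.
have ci : ipi * isp (sn n) @[n --> \oo] --> ipi * isp s.
  by apply: cvgMr; exact: cvg_isp.
have cV : (sn n)^-1 @[n --> \oo] --> s^-1 by apply: cvgV => //; exact: lt0r_neq0.
have cz : z / sn n @[n --> \oo] --> z / s by apply: cvgMr.
split; rewrite /h0 /hx /hxx.
- by apply: cvgM; [exact: ci|exact: cF].
- by apply: cvgM; [apply: cvgM; [exact: ci|exact: cvgMr]|exact: cF].
- apply: cvgD.
    apply: cvgM; [apply: cvgM; [exact: ci|]|exact: cF].
    by apply: cvgMr; rewrite expr2 (_ : (fun n => _) = (fun n => (z / sn n) * (z / sn n)))//; exact: cvgM.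
  by apply: cvgM; [apply: cvgM; [exact: ci|exact: cvgMr]|exact: cF].
Qed.

End kernel_continuity.

Section dominated_series.
Context {R : realType}.

(** Tannery's theorem for a geometric majorant: the tails after [k] terms are at most
    [2 * B * (1/2)^k], uniformly in [n], and finite sums converge. *)
Lemma cvg_series_dominated (B : R) (u : nat -> nat -> R) (v : nat -> R) :
  (forall n m, `|u n m| <= B * (1/2) ^+ m) -> (forall m, u ^~ m @ \oo --> v m) ->
  limn (series (u n)) @[n --> \oo] --> limn (series v).
Proof.
move=> uB uv.
have B0 : 0 <= B by have := uB 0%N 0%N; rewrite expr0 mulr1; exact: le_trans.
have vB m : `|v m| <= B * (1/2) ^+ m.
  rewrite -(cvg_lim (@Rhausdorff R) (cvg_norm (uv m))).
  apply: limr_le; first by apply: cvgP; apply: cvg_norm; exact: uv.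
  by apply: nearW => n; exact: uB.
have tail (a : nat -> R) k : (forall m, `|a m| <= B * (1/2) ^+ m) ->
    `|limn (series a) - series a k| <= 2 * B * (1/2) ^+ k.
  move=> aB.
  have hpb m : pb 0 (B * (1/2) ^+ m) (a m) (a m) by exact: pb_diag.
  have [ca _ _] := pb_series (lexx 0) hpb.
  have hs m : `|a (m + k)%N| <= B * (1/2) ^+ k * (1/2) ^+ m.
    by rewrite -mulrA -exprD addnC; exact: aB.
  have [ck _ [hk _ _]] := pb_series (lexx 0) (fun m => pb_diag (hs m)).
  suff -> : limn (series a) - series a k = limn (series (fun m => a (m + k)%N)).
    by apply: le_trans hk _; rewrite mulrA.
  apply/esym/cvg_lim => //.
  have -> : series (fun m => a (m + k)%N) = (fun n => series a (n + k)%N - series a k).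
    apply/funext => n; have E : \sum_(k <= i < n + k) a i = \sum_(0 <= i < n) a (i + k)%N.
      by rewrite -{1}[k]add0n big_addn addnK.
    by rewrite /series/= (@big_cat_nat _ _ _ k 0 (n + k))//= ?leq_addl// E addrAC subrr add0r.
  apply: cvgB; last exact: cvg_cst.
  by rewrite (cvg_shiftn k (series a)).
have half0 : (1/2 : R) ^+ n @[n --> \oo] --> (0 : R).
  by apply: cvg_expr; rewrite ger0_norm; lra.
apply/cvgrPdist_le => e e0.
have e4 : 0 < e / 4 / (2 * B + 1) by rewrite !divr_gt0//; lra.
have [k hk] : exists k, (1/2 : R) ^+ k <= e / 4 / (2 * B + 1).
  have [k _ hk] := (cvgrPdist_le _ _).1 half0 _ e4.
  exists k; have := hk k (leqnn k); rewrite /= sub0r normrN ger0_norm// exprn_ge0//.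
have tk : 2 * B * (1/2) ^+ k <= e / 4.
  have B1 : 0 < 2 * B + 1 by lra.
  apply: (@le_trans _ _ ((2 * B + 1) * (1/2) ^+ k)).
    by rewrite ler_wpM2r ?exprn_ge0//; lra.
  by move: hk; rewrite ler_pdivlMr// mulrC.
have sk : series (u n) k @[n --> \oo] --> series v k.
  rewrite /series/=; elim: (k) => [|j IH].
    rewrite big_geq// (_ : (fun n => _) = cst 0); first exact: cvg_cst.
    by apply/funext => n; rewrite big_geq.
  rewrite big_nat_recr//= (_ : (fun n => _) =
    (fun n => \sum_(0 <= i < j) u n i + u n j)); first exact: cvgD.
  by apply/funext => n; rewrite big_nat_recr.
have e2 : 0 < e / 2 by lra.
near=> n.
have h1 : `|series v k - series (u n) k| <= e / 2.
  by near: n; exact: (cvgrPdist_le _ _).1 sk _ e2.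
have h2 := le_trans (tail _ k (uB n)) tk; have h3 := le_trans (tail _ k vB) tk.
rewrite (_ : _ - _ = (limn (series v) - series v k) +
  (series v k - series (u n) k) - (limn (series (u n)) - series (u n) k)); last by ring.
apply: (le_trans (ler_normB _ _)); have := ler_normD (limn (series v) - series v k) (series v k - series (u n) k).
lra.
Unshelve. all: by end_near. Qed.

End dominated_series.

(** * Continuity of the iterates and of [parametrix_phi] in time *)

Section density_continuity.
Context {R : realType}.
Let mu := @lebesgue_measure R.
Variables (al lam rho A S : R).
Hypotheses (al0 : 0 < al) (al1 : al <= 1) (lam0 : 0 < lam) (lamrho : lam <= rho)
  (A1 : 1 <= A) (S1 : 1 <= S).
Let c := ckn rho.
Variables (v : coeffs R).
Hypothesis hv : coef_pair al lam rho A 0 v v.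
Let v0 := cp_ca_gt0 lam0 hv.

Lemma cvg_hoelder_time (h : R -> R -> R) (x t : R) (tn : nat -> R) :
  (forall x y t s : R, pb 0 (A * hd al x y t s) (h x t - h y s) (h x t - h y s)) ->
  tn @ \oo --> t -> h x (tn n) @[n --> \oo] --> h x t.
Proof.
move=> hh cvt; apply/cvgrPdist_le => e e0.
have A0 : 0 < A by exact: lt_le_trans ltr01 A1.
have eA : 0 < e / A by rewrite divr_gt0.
have p0 : 0 < al / 2 by rewrite divr_gt0.
have [dl dl0 hdl] := powR_small p0 eA.
near=> n.
have hn : `|t - tn n| <= dl by near: n; exact: (cvgrPdist_le _ _).1 cvt _ dl0.
have [hb _ _] := hh x x t (tn n).
apply: (le_trans hb); rewrite /hd subrr normr0 powR0 ?gt_eqF// add0r mulrC -ler_pdivlMr//.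
by apply: hdl; rewrite normr_ge0.
Unshelve. all: by end_near. Qed.

Lemma cvg_LZ1_time (x t y s : R) (tn : nat -> R) : s < t -> (forall n, s < tn n) ->
  tn @ \oo --> t -> LZ1 v x (tn n) y s @[n --> \oo] --> LZ1 v x t y s.
Proof.
move=> st stn cvt; rewrite LZ1E//.
rewrite (_ : (fun n => _) = (fun n =>
  (ca v y s - ca v x (tn n)) * hxx (kap v y s) (x - y) (tn n - s) +
  cb v x (tn n) * hx (kap v y s) (x - y) (tn n - s) +
  cc v x (tn n) * h0 (kap v y s) (x - y) (tn n - s))); last by apply/funext => n; rewrite LZ1E.
have ts0 : 0 < t - s by lra.
have cts : tn n - s @[n --> \oo] --> t - s by apply: cvgB => //; exact: cvg_cst.
have [c0 c1 c2] := cvg_kernels (kap v y s) (x - y) ts0 cts.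
apply: cvgD; first apply: cvgD.
- apply: cvgM; last exact: c2.
  apply: cvgB; first exact: cvg_cst.
  exact: (@cvg_hoelder_time (ca v) x t tn (cp_ah hv) cvt).
- by apply: cvgM; [exact: (@cvg_hoelder_time (cb v) x t tn (cp_bh hv) cvt)|exact: c1].
- by apply: cvgM; [exact: (@cvg_hoelder_time (cc v) x t tn (cp_ch hv) cvt)|exact: c0].
Qed.

Lemma cvg_shift_above (tn : nat -> R) (t b : R) : tn @ \oo --> t -> b < t ->
  exists k, (forall n, b < tn (n + k)%N) /\ tn (n + k)%N @[n --> \oo] --> t.
Proof.
move=> cvt bt; have tb : 0 < t - b by lra.
have [k _ hk] := (cvgrPdist_lt _ _).1 cvt _ tb.
exists k; split; last by rewrite (cvg_shiftn k tn).
by move=> n; have := hk (n + k)%N (leq_addl _ _); rewrite /= ltr_norml; lra.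
Qed.

(** Elapsed times stay above [d], so constants are uniform along the sequence. The outer integral
    has a moving end point, treated by [cvg_Rintegral_moving]; inside, only the first factor [LZ1]
    depends on [tn n], so no induction on [m] is needed. *)
Lemma cvg_LZ_time m (x t xi tau d : R) (tn : nat -> R) : 0 < d ->
  (forall n, tau + d <= tn n /\ tn n - tau <= S) -> tau + d <= t -> t - tau <= S ->
  tn @ \oo --> t -> LZ v m x (tn n) xi tau @[n --> \oo] --> LZ v m x t xi tau.
Proof.
move=> d0 htn td tS cvt; have tt : tau < t by lra.
have ttn n : tau < tn n by have [] := htn n; lra.
case: m => [|m]; first exact: cvg_LZ1_time.
have [K K0 hK] := LZ1_bound al0 al1 lam0 lamrho A1 S1.
have [[a m0] [a0 m00] hLZ] := LZ_bound al0 al1 lam0 lamrho A1 S1; rewrite /= in a0 m00 hLZ.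
have [a0' a1'] : 0 < al /\ al <= 1 by [].
have [p0 p1] : 0 < al / 2 /\ al / 2 <= 1 by split; lra.
have g0 := gconst_gt0 lam0 lamrho; have c0 := ckn_gt0 lam0 lamrho.
have id0 := isp_gt0 d0.
pose Dm := a * (1/2) ^+ m * expR (m0 * S).
have Dm0 : 0 <= Dm by rewrite /Dm; nonneg.
have hG (y s : R) : tau < s -> s - tau <= S ->
    pb 0 (Dm * tw al (s - tau) * gk c (y - xi) (s - tau)) (LZ v m y s xi tau) (LZ v m y s xi tau).
  move=> ts sS; apply: pb_le (hLZ _ _ _ hv m y s xi tau ts sS) => //.
  rewrite ler_wpM2r ?gk_ge0// ler_wpM2r ?tw_ge0// ler_wpM2l//; first nonneg.
  by rewrite ler_expR ler_wpM2l// ltW.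
pose Q := 2 * K * Dm * gconst c * isp d.
have Q0 : 0 <= Q by rewrite /Q; nonneg.
pose f r s := \int[mu]_(y in [set: R]) (LZ1 v x r y s * LZ v m y s xi tau).
have hf (r s : R) : tau + d <= r -> r - tau <= S -> tau < s < r ->
    `|f r s| <= endpoint_bound (Q * (d / 2) `^ (al / 2 - 1)) (Q * (d / 2) `^ (al / 2 - 1)) (al / 2) (al / 2) tau r s.
  move=> dr rS sr.
  have [rs0 s0 sr1 ts1] : [/\ 0 < r - s, 0 < s - tau, s < r & tau < s] by split; lra.
  have [rsS sS] : r - s <= S /\ s - tau <= S by split; lra.
  have [_ _ [hb _ _]] := inner_pb (lexx 0) c0 rs0 s0
    (measurable_LZ1_y al0 lam0 hv x r s) (measurable_LZ1_y al0 lam0 hv x r s)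
    (measurable_LZ_y al0 lam0 hv m s xi tau) (measurable_LZ_y al0 lam0 hv m s xi tau)
    (fun y => hK _ _ _ x _ y _ hv sr1 rsS) (fun y => hG y _ ts1 sS).
  apply: (le_trans hb); rewrite (_ : r - s + (s - tau) = r - tau); last by ring.
  have gd : gk c (x - xi) (r - tau) <= isp d.
    have r0 : 0 < r - tau by lra.
    by apply: (le_trans (gk_isp _ (ltW c0) r0)); apply: isp_le => //; lra.
  apply: (@le_trans _ _ (Q * (tw al (r - s) * tw al (s - tau)))).
    rewrite [leRHS](_ : _ = 2 * (K * tw al (r - s)) * (Dm * tw al (s - tau)) * gconst c * isp d).
      by rewrite ler_wpM2l//; nonneg.
    by rewrite /Q; ring.
  apply: (@le_trans _ _ (Q * endpoint_bound (((r - tau) / 2) `^ (al/2 - 1)) (((r - tau) / 2) `^ (al/2 - 1)) (al/2) (al/2) tau r s)).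
    by rewrite ler_wpM2l// prod_endpoint_le.
  rewrite /endpoint_bound mulrDr !(mulrA Q); have e : ((r - tau) / 2) `^ (al / 2 - 1) <= (d / 2) `^ (al / 2 - 1).
    by apply: le_powR_sub1 => //; lra.
  by apply: lerD; rewrite ler_wpM2r ?powR_ge0// ler_wpM2l.
have Qd0 : 0 <= Q * (d / 2) `^ (al / 2 - 1) by nonneg.
rewrite LZ_S (_ : (fun n => _) = (fun n => \int[mu]_(s in `]tau, tn n[) f (tn n) s)); last first.
  by apply/funext => n; rewrite LZ_S.
apply: (@cvg_Rintegral_moving R _ _ (al/2) (al/2) tau Qd0 Qd0 p0 p0 p1 (fun n => f (tn n)) (f t) tn t) => //.
- by move=> n; exact: (measurable_LZ_inner al0 lam0 hv).
- exact: (measurable_LZ_inner al0 lam0 hv).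
- by move=> n s; have [h1 h2] := htn n; exact: hf.
- by move=> s; exact: hf.
move=> s st; have [st1 ts1] : s < t /\ tau < s by lra.
have sS : s - tau <= S by lra.
(* From the index [k] on, [tn n] is above the midpoint of [s] and [t], so its distance to [s] is at
   least [e] and the kernels have a common bound. *)
have [b1 b2] : s < (s + t) / 2 /\ (s + t) / 2 < t by split; lra.
have [k [hk cvk]] := cvg_shift_above cvt b2.
rewrite -(cvg_shiftn k (fun n => f (tn n) s)).
pose e := (t - s) / 2; have e0 : 0 < e by rewrite /e; lra.
have ie0 := isp_gt0 e0.
pose B := K * e `^ (al / 2 - 1) * isp e.
have B0 : 0 <= B by rewrite /B; nonneg.
apply: (@cvg_integral_dominated R setT (fun n y => LZ1 v x (tn (n + k)%N) y s * LZ v m y s xi tau)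
  _ (fun y => B * (Dm * tw al (s - tau) * gk c (y - xi) (s - tau)))) => //.
- move=> n; apply: measurable_funM; first exact: (measurable_LZ1_y al0 lam0 hv).
  exact: (measurable_LZ_y al0 lam0 hv).
- apply: measurable_funM; first exact: (measurable_LZ1_y al0 lam0 hv).
  exact: (measurable_LZ_y al0 lam0 hv).
- move=> y _; apply: cvgMl; apply: cvg_LZ1_time => // n.
  by have := hk n; lra.
- apply: integrable_scale => //; apply: integrable_scale => //.
  have s0 : 0 < s - tau by lra.
  have [i _] := integral_gk xi c0 s0.
  rewrite (_ : (fun y => _) = (fun y => gk c (xi - y) (s - tau)))//.
  by apply/funext => y; rewrite /gk -(sqrrN (y - xi)) opprB.
- move=> n y _; rewrite normrM; have h1 := hk n; have [h2 h3] := htn (n + k)%N.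
  have [h4 h5] : s < tn (n + k)%N /\ tn (n + k)%N - s <= S by split; lra.
  have h6 : e <= tn (n + k)%N - s by rewrite /e; lra.
  have [e1 _ _] := hK _ _ _ x _ y _ hv h4 h5; have [e2 _ _] := hG y _ ts1 sS.
  apply: ler_pM => //; apply: (le_trans e1); rewrite /B.
  apply: ler_pM; [nonneg|nonneg| |].
    by rewrite ler_wpM2l ?(ltW K0)//; apply: le_powR_sub1 => //; lra.
  by apply: (le_trans (gk_isp _ (ltW c0) (lt_le_trans e0 h6))); exact: isp_le.
Qed.

Lemma cvg_phi_time (x t xi tau d : R) (tn : nat -> R) : 0 < d ->
  (forall n, tau + d <= tn n /\ tn n - tau <= S) -> tau + d <= t -> t - tau <= S ->
  tn @ \oo --> t ->
  parametrix_phi v x (tn n) xi tau @[n --> \oo] --> parametrix_phi v x t xi tau.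
Proof.
move=> d0 htn td tS cvt.
have [[a m0] [a0 m00] hLZ] := LZ_bound al0 al1 lam0 lamrho A1 S1; rewrite /= in a0 m00 hLZ.
have [a0' a1'] : 0 < al /\ al <= 1 by [].
have id0 := isp_gt0 d0; have c0 := ckn_gt0 lam0 lamrho.
apply: (@cvg_series_dominated R (a * expR (m0 * S) * d `^ (al / 2 - 1) * isp d)
  (fun n => phi_term v x (tn n) xi tau) (phi_term v x t xi tau)).
  move=> n m; have [h1 h2] := htn n; have ttn : tau < tn n by lra.
  have [hb _ _] := hLZ _ _ _ hv m x (tn n) xi tau ttn h2.
  have -> : `|phi_term v x (tn n) xi tau m| = `|LZ v m x (tn n) xi tau|.
    by rewrite /phi_term normrM normrX normrN1 expr1n mul1r.
  apply: (le_trans hb).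
  rewrite [leRHS](_ : _ = a * (1/2) ^+ m * expR (m0 * S) * d `^ (al / 2 - 1) * isp d); last by ring.
  apply: ler_pM; [nonneg|nonneg| |].
    apply: ler_pM; [nonneg|nonneg| |].
      rewrite ler_wpM2l//; first nonneg.
      by rewrite ler_expR ler_wpM2l// ltW.
    by apply: le_powR_sub1 => //; lra.
  have u0 : 0 < tn n - tau by lra.
  by apply: (le_trans (gk_isp _ (ltW c0) u0)); apply: isp_le => //; lra.
by move=> m; apply: cvgMr; apply: cvg_LZ_time htn _ _ _.
Qed.

End density_continuity.

(** * Difference quotients along sequences *)

Section difference_quotients.
Context {R : realType}.
Let mu := @lebesgue_measure R.

(** Dominated convergence is a statement about sequences, so derivatives are computed along
    sequences of increments; the restriction [|h n| < e] makes side conditions valid for every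
    [n]. *)
Lemma is_derive_seq (F : R -> R) (t L e : R) : 0 < e ->
  (forall h : nat -> R, (forall n, h n != 0 /\ `|h n| < e) -> h @ \oo --> (0 : R) ->
    (h n)^-1 * (F (t + h n) - F t) @[n --> \oo] --> L) -> is_derive t 1 F L.
Proof.
move=> e0 hF.
pose G (h : R) := h^-1 *: ((F \o shift t) (h *: (1 : R)) - F t).
have GE (h : R) : G h = h^-1 * (F (t + h) - F t).
  by rewrite /G /= [h%:A]mulr1 (addrC h t).
have cv : G h @[h --> 0^'] --> L.
  apply/cvgr_dnbhsP => h [hn0 h0].
  have [k _ hk] := (cvgrPdist_lt _ _).1 h0 _ e0.
  rewrite -(cvg_shiftn k).
  have hk' n : h (n + k)%N != 0 /\ `|h (n + k)%N| < e.
    by split=> //; have := hk (n + k)%N (leq_addl _ _); rewrite /= sub0r normrN.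
  have := hF (fun n => h (n + k)%N) hk'; rewrite (cvg_shiftn k h) => /(_ h0).
  by under eq_fun do rewrite -GE.
apply: DeriveDef; first exact: cvgP cv.
exact: cvg_lim cv.
Qed.

Lemma is_derive_cvg_seq (F : R -> R) (t L : R) (h : nat -> R) : is_derive t 1 F L ->
  (forall n, h n != 0) -> h @ \oo --> (0 : R) ->
  (h n)^-1 * (F (t + h n) - F t) @[n --> \oo] --> L.
Proof.
move=> [dF <-] hn0 h0.
have cv : h^-1 *: ((F \o shift t) (h *: (1 : R)) - F t) @[h --> 0^'] --> 'D_1 F t by exact: dF.
have := (cvgr_dnbhsP _ _ _).1 cv h (conj hn0 h0).
by under eq_fun do rewrite /= [_%:A]mulr1 (addrC _ t).
Qed.

Lemma Rintegral_split (f : R -> R) (a m b : R) : a < m -> m < b ->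
  mu.-integrable `]a, b[ (EFin \o f) ->
  \int[mu]_(s in `]a, b[) f s = \int[mu]_(s in `]a, m[) f s + \int[mu]_(s in `]m, b[) f s.
Proof.
move=> am mb i.
have := @Rintegral_itvB R f (BRight a) (BLeft b) m i.
rewrite !bnd_simp => /(_ (ltW am) mb) <-.
rewrite (@Rintegral_itv_bndo_bndc R (BRight a) m f); first by rewrite addrC subrK.
apply: integrableS i => //.
by apply: subset_itvl; rewrite bnd_simp ltW.
Qed.

Lemma Rintegral_scaleB (D : set R) (k : R) (f g : R -> R) : measurable D ->
  mu.-integrable D (EFin \o f) -> mu.-integrable D (EFin \o g) ->
  \int[mu]_(s in D) (k * (f s - g s)) =
  k * (\int[mu]_(s in D) f s - \int[mu]_(s in D) g s).
Proof.
move=> mD i1 i2.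
have iB : mu.-integrable D (EFin \o (fun s => f s - g s)).
  rewrite (_ : (fun s => _) = (fun s => f s + -1 * g s)).
    by apply: integrable_add => //; exact: integrable_scale.
  by apply/funext => s; rewrite mulN1r.
by rewrite RintegralZl// RintegralB.
Qed.

Lemma average_bound (f : R -> R) (m b L e : R) : m < b -> measurable_fun setT f ->
  (forall s, m < s < b -> `|f s - L| <= e) ->
  `|(b - m)^-1 * (\int[mu]_(s in `]m, b[) f s) - L| <= e.
Proof.
move=> mb mf hf.
have bm0 : 0 < b - m by lra.
have [i1 e1] : mu.-integrable `]m, b[ (EFin \o (fun=> 1 : R)) /\ \int[mu]_(s in `]m, b[) (1 : R) = b - m.
  have [i E] := integral_powR_left mb (@ltr01 R).
  have E' : (fun s => (s - m) `^ (1 - 1)) = (fun=> 1 : R) by apply/funext => s; rewrite subrr powRr0.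
  by rewrite E' in i E; rewrite E invr1 mulr1 powRr1// ltW.
have ic (k : R) : mu.-integrable `]m, b[ (EFin \o (fun=> k)).
  by rewrite (_ : (fun=> k) = (fun=> k * 1)); [exact: integrable_scale|apply/funext => ?; rewrite mulr1].
have eC (k : R) : \int[mu]_(s in `]m, b[) k = k * (b - m).
  rewrite -e1 -RintegralZl//; by apply: eq_Rintegral => s _; rewrite mulr1.
have mfL : measurable_fun `]m, b[ (fun s => f s - L) by apply: measurable_funTS; apply: measurable_funB.
have hfL (s : R) : `]m, b[%classic s -> `|f s - L| <= e by rewrite set_ooE => /hf.
have ifL : mu.-integrable `]m, b[ (EFin \o (fun s => f s - L)).
  by apply: (@integrable_le _ _ _ (fun=> e)).
have E : \int[mu]_(s in `]m, b[) f s = \int[mu]_(s in `]m, b[) (f s - L) + L * (b - m).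
  rewrite -eC -RintegralD//; by apply: eq_Rintegral => s _; rewrite subrK.
have := @Rintegral_norm_le R _ _ (fun=> e) (measurable_itv _) mfL hfL (ic e); rewrite eC => hI.
rewrite E mulrDr [X in _ + X - _](_ : _ = L); last by field; rewrite gt_eqF.
by rewrite addrK normrM gtr0_norm ?invr_gt0// mulrC ler_pdivrMr.
Qed.

End difference_quotients.

Section time_derivative.
Context {R : realType}.
Let mu := @lebesgue_measure R.
Variables (al lam rho A S : R).
Hypotheses (al0 : 0 < al) (al1 : al <= 1) (lam0 : 0 < lam) (lamrho : lam <= rho)
  (A1 : 1 <= A) (S1 : 1 <= S).
Let c := ckn rho.
Let k0 := (4 * rho)^-1.
Let k1 := (4 * lam)^-1.
Let k00 : 0 < k0 := k0_gt0 lam0 lamrho.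
Let k01 : k0 <= k1 := k0_le_k1 lam0 lamrho.
Variables (Kd : R) (v : coeffs R) (f : R -> R -> R) (xi tau : R).
Hypotheses (Kd0 : 0 < Kd) (hv : coef_pair al lam rho A 0 v v)
  (hd : density al rho S Kd 0 xi tau f f)
  (hda : density al rho S Kd 0 xi tau (fun y s => ca v y s * f y s) (fun y s => ca v y s * f y s)).
Let mv : mcoef v := coef_pair_measurable al0 hv.

Lemma pot_h0_near (d : R) : 0 < d -> exists2 K : R, 0 <= K & forall x s t : R,
  tau + d <= s -> s < t -> t - tau <= S ->
  `|pot h0 v f x t s - f x s| <= K * ((t - s) `^ (al / 4) + (t - s) `^ (al / 2)).
Proof.
move=> d0; have k00p := k00; have a0 := al0; have a1 := al1.
have [p21 p20] : al / 2 <= 1 /\ 0 < al / 2 by split; lra.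
have [p41 p42] : al / 4 <= 1 /\ 0 < al / 4 by split; lra.
have [M M0 hM] := kap_pairs al lam0 lamrho A1.
have [C C0 hC] := ker_bounds k00 k01 M0.
have [C2 C20 hC2] := ker_incr_bounds k00 k01 M0.
have g0 := gconst_gt0 lam0 lamrho; have c0 := ckn_gt0 lam0 lamrho.
have ck : c < k0 / 2 by rewrite /c /ckn -/k0; lra.
have [C' C'0 hC'] := gk_absorb 1 ck.
have [hk hinc] := hM _ _ _ hv.
have id0 := isp_gt0 d0.
have i20 : 0 <= 2 * isp d by nonneg.
pose Q1 := C * C' * (Kd * d `^ (al / 4 - 1) * (2 * isp d)).
pose Q2 := Kd * d `^ (al / 2 - 1) * isp d * (C2 * C').
have Q10 : 0 <= Q1 by rewrite /Q1; nonneg.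
have Q20 : 0 <= Q2 by rewrite /Q2; nonneg.
exists (gconst c * (Q1 + Q2)) => [|x s t ds st tS]; first nonneg.
have ts0 : 0 < t - s by lra.
have ts1 : tau < s by lra.
have sS : s - tau <= S by lra.
have s0 : 0 < s - tau by lra.
have sd : d <= s - tau by lra.
set r := t - s in ts0 *.
have [ig eg] := integral_gk x c0 ts0.
have absorb (b y : R) : 0 < b -> b <= 1 ->
    `|y - x| `^ b * gk (k0 / 2) (x - y) r <= C' * r `^ (b / 2) * gk c (x - y) r.
  move=> b0 b1; rewrite (distrC y).
  have hA := hC' (x - y) _ ts0; rewrite expr1 in hA.
  have hP := powR_abs_le (x - y) b0 b1 ts0.
  apply: (@le_trans _ _ ((r `^ (b / 2) * (1 + (x - y) ^+ 2 / r)) * gk (k0 / 2) (x - y) r)).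
    by rewrite ler_wpM2r ?gk_ge0.
  rewrite -mulrA [leRHS](_ : _ = r `^ (b / 2) * (C' * gk c (x - y) r)); last by ring.
  by rewrite ler_wpM2l// powR_ge0.
have gd z : gk c z (s - tau) <= isp d.
  by apply: (le_trans (gk_isp _ (ltW c0) s0)); exact: isp_le.
pose D1 (y : R) := h0 (kap v y s) (x - y) r * (f y s - f x s).
pose D2 (y : R) := h0 (kap v y s) (x - y) r - h0 (kap v x s) (x - y) r.
have m1 : measurable_fun setT (fun y => h0 (kap v y s) (x - y) r).
  exact: (measurable_slice (F := fun y s => h0 (kap v y s) (x - y) (t - s))
    (measurable_kernel_joint x t (or_introl erefl) mv) s).
have m2 : measurable_fun setT (fun y => f y s) := measurable_slice (dn_mf hd) s.
have m3 : measurable_fun setT (fun y : R => h0 (kap v x s) (x - y) r).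
  by apply: measurable_kernel_y; left.
have mD1 : measurable_fun setT D1 by apply: measurable_funM => //; exact: measurable_funB.
have mD2 : measurable_fun setT D2 by exact: measurable_funB.
have B1 (y : R) : `|D1 y| <= Q1 * r `^ (al / 4) * gk c (x - y) r.
  have [[e1 _ _] _ _ _] := hC _ _ _ (x - y) _ (hk y s) ts0.
  have [e2 _ _] := dn_hoelder hd y x ts1 sS.
  rewrite normrM; apply: (le_trans (ler_pM (normr_ge0 _) (normr_ge0 _) e1 e2)).
  have := absorb (al / 2) y p20 p21.
  rewrite (_ : al / 2 / 2 = al / 4); last by field.
  move=> ab.
  have eq : (s - tau) `^ (al / 4 - 1) <= d `^ (al / 4 - 1) by exact: le_powR_sub1.
  have eg2 : gk c (y - xi) (s - tau) + gk c (x - xi) (s - tau) <= 2 * isp d.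
    by rewrite mulr_natl mulr2n lerD.
  rewrite [leLHS](_ : _ = C * Kd * (((s - tau) `^ (al / 4 - 1) * (gk c (y - xi) (s - tau) + gk c (x - xi) (s - tau))) *
    (`|y - x| `^ (al / 2) * gk (k0 / 2) (x - y) r))); last by ring.
  rewrite [leRHS](_ : _ = C * Kd * ((d `^ (al / 4 - 1) * (2 * isp d)) *
     (C' * r `^ (al / 4) * gk c (x - y) r))); last by rewrite /Q1; ring.
  apply: ler_wpM2l; first nonneg.
  apply: ler_pM => //; [nonneg|nonneg|].
  by apply: ler_pM => //; nonneg.
have B2 (y : R) : `|D2 y| <= C2 * C' * r `^ (al / 2) * gk c (x - y) r.
  have dd0 : 0 <= `|y - x| `^ al by exact: powR_ge0.
  have hi := hinc y x s s; rewrite (hd_space al0) in hi.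
  have [[e1 _ _] _] := hC2 _ _ _ _ _ (x - y) _ _ (hk y s) (hk x s) hi dd0 ts0.
  apply: (le_trans e1); rewrite -!mulrA ler_wpM2l ?(ltW C20)//.
  by rewrite mulrA; exact: absorb.
have iB1 : mu.-integrable setT (EFin \o (fun y => Q1 * r `^ (al / 4) * gk c (x - y) r)) by exact: integrable_scale.
have iB2 : mu.-integrable setT (EFin \o (fun y => C2 * C' * r `^ (al / 2) * gk c (x - y) r)) by exact: integrable_scale.
have i1 : mu.-integrable setT (EFin \o D1) by apply: (@integrable_le _ _ _ (fun y => Q1 * r `^ (al / 4) * gk c (x - y) r)).
have i2 : mu.-integrable setT (EFin \o D2) by apply: (@integrable_le _ _ _ (fun y => C2 * C' * r `^ (al / 2) * gk c (x - y) r)).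
have I1 : `|\int[mu]_(y in [set: R]) D1 y| <= Q1 * r `^ (al / 4) * gconst c.
  apply: (le_trans (Rintegral_norm_le measurableT mD1 (fun y _ => B1 y) iB1)).
  by rewrite RintegralZl// eg.
have I2 : `|\int[mu]_(y in [set: R]) D2 y| <= C2 * C' * r `^ (al / 2) * gconst c.
  apply: (le_trans (Rintegral_norm_le measurableT mD2 (fun y _ => B2 y) iB2)).
  by rewrite RintegralZl// eg.
have kx : 0 < kap v x s by exact: (kap_gt0 lam0 hv).
have [i3 e3] := integral_h0 x kx ts0.
have i2' : mu.-integrable setT (EFin \o (fun y => f x s * D2 y)) by exact: integrable_scale.
have i3' : mu.-integrable setT (EFin \o (fun y => f x s * h0 (kap v x s) (x - y) r)) by exact: integrable_scale.
have E : pot h0 v f x t s = \int[mu]_(y in [set: R]) D1 y + f x s * \int[mu]_(y in [set: R]) D2 y + f x s.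
  have -> : pot h0 v f x t s = \int[mu]_(y in [set: R])
      ((D1 y + f x s * D2 y) + f x s * h0 (kap v x s) (x - y) r).
    by apply: eq_Rintegral => y _; rewrite /D1 /D2 -/r; ring.
  rewrite RintegralD//; last exact: integrable_add.
  by rewrite RintegralD// RintegralZl// RintegralZl// e3 mulr1.
rewrite E addrK; apply: (le_trans (ler_normD _ _)); rewrite normrM.
have [ef _ _] := dn_bound hd x ts1 sS.
have ef' : `|f x s| <= Kd * d `^ (al / 2 - 1) * isp d.
  apply: (le_trans ef); apply: ler_pM => //; [nonneg|nonneg|].
  by rewrite ler_wpM2l ?(ltW Kd0)//; apply: le_powR_sub1 => //; lra.
apply: (@le_trans _ _ (Q1 * r `^ (al / 4) * gconst c + Q2 * r `^ (al / 2) * gconst c)).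
  apply: lerD => //; rewrite [leRHS](_ : _ = Kd * d `^ (al / 2 - 1) * isp d * (C2 * C' * r `^ (al / 2) * gconst c)).
    exact: ler_pM.
  by rewrite /Q2; ring.
rewrite -subr_ge0 (_ : _ - _ = gconst c * (Q1 * r `^ (al / 2) + Q2 * r `^ (al / 4))); last by ring.
by nonneg.
Qed.

End time_derivative.

Section time_derivative.
Context {R : realType}.
Let mu := @lebesgue_measure R.
Variables (al lam rho A S : R).
Hypotheses (al0 : 0 < al) (al1 : al <= 1) (lam0 : 0 < lam) (lamrho : lam <= rho)
  (A1 : 1 <= A) (S1 : 1 <= S).
Let c := ckn rho.
Variables (Kd : R) (v : coeffs R) (f : R -> R -> R) (xi tau : R).
Hypotheses (Kd0 : 0 < Kd) (hv : coef_pair al lam rho A 0 v v)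
  (hd : density al rho S Kd 0 xi tau f f)
  (hda : density al rho S Kd 0 xi tau (fun y s => ca v y s * f y s) (fun y s => ca v y s * f y s)).
Let mv : mcoef v := coef_pair_measurable al0 hv.
Let J x t s := pot h0 v f x t s.
Let J' x t s := pot hxx v (fun y s => ca v y s * f y s) x t s.

(** The majorant is singular at [m] and not at [t]: the exponent being negative,
    [(t - s)^(al/4 - 1)] is at most the same power of [m - s]. One majorant thus serves all times
    from [m] on, in particular those between [t0] and [t0 + h]. *)
Lemma pot_time_bound (d : R) : 0 < d -> exists2 K : R, 0 <= K & forall x m t s : R,
  tau + d <= m -> m <= t -> t - tau <= S -> tau < s < m ->
  `|J' x t s| <= endpoint_bound K K (al / 4) (al / 2) tau m s.
Proof.
move=> d0; have [K K0 hK] := pot_hxx_bound al0 al1 lam0 lamrho A1 S1 Kd0.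
have c0 := ckn_gt0 lam0 lamrho; have id0 := isp_gt0 d0.
have [a0 a1] : 0 < al /\ al <= 1 by [].
pose L := isp d * K * (d^-1 + d `^ (al / 4 - 1)).
exists L => [|x m t s dm mt tS sm]; first by rewrite /L; nonneg.
have st : tau < s < t by lra.
have u0 : 0 < t - tau by lra.
have du : d <= t - tau by lra.
have [e _ _] := hK _ _ _ hv _ _ _ _ hda x t s st tS.
have gd : gk c (x - xi) (t - tau) <= isp d.
  by apply: (le_trans (gk_isp _ (ltW c0) u0)); exact: isp_le.
apply: (le_trans e).
apply: (@le_trans _ _ (isp d * endpoint_bound (K * (t - tau)^-1)
  (K * (t - tau) `^ (al / 4 - 1)) (al / 4) (al / 2) tau t s)).
  rewrite ler_wpM2r//; apply: endpoint_bound_ge0; nonneg.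
rewrite /endpoint_bound mulrDr; apply: lerD.
  rewrite mulrA; apply: ler_wpM2r; first nonneg.
  rewrite /L mulrA; apply: ler_wpM2l; first nonneg.
  have : (t - tau)^-1 <= d^-1 by rewrite lef_pV2 ?posrE.
  by have := powR_ge0 d (al / 4 - 1); lra.
rewrite mulrA; apply: ler_pM; [nonneg|nonneg| |].
  rewrite /L mulrA; apply: ler_wpM2l; first nonneg.
  have : (t - tau) `^ (al / 4 - 1) <= d `^ (al / 4 - 1) by apply: le_powR_sub1 => //; lra.
  have : 0 < d^-1 by rewrite invr_gt0.
  lra.
by apply: le_powR_sub1; lra.
Qed.

Lemma pot_lipschitz (d : R) : 0 < d -> exists2 K : R, 0 <= K & forall x m t1 t2 s : R,
  tau + d <= m -> m <= t1 -> m <= t2 -> t1 - tau <= S -> t2 - tau <= S -> tau < s < m ->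
  `|J x t1 s - J x t2 s| <= endpoint_bound K K (al / 4) (al / 2) tau m s * `|t1 - t2|.
Proof.
move=> d0; have [K K0 hK] := pot_time_bound d0.
exists K => // x m t1 t2 s dm m1 m2 t1S t2S sm.
have hmS (t : R) : m <= t <= tau + S -> tau < s < t /\ s - tau <= S by lra.
apply: (@lipschitz_deriv R (fun t => J x t s) (fun t => J' x t s) m (tau + S)).
- by move=> t mt; have [? ?] := hmS t mt; exact: (is_derive_pot_t al0 lam0 lamrho A1 hv hd).
- by move=> t mt; apply: hK => //; lra.
- lra.
- lra.
Qed.

Let vpotE x t : vpot h0 v f tau x t = \int[mu]_(s in `]tau, t[) J x t s. Proof. by []. Qed.

Let mJ x t : measurable_fun setT (J x t).
Proof. by apply: measurable_pot => //; [left|exact: dn_mf hd]. Qed.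

Let mJ' x t : measurable_fun setT (J' x t).
Proof. by apply: measurable_pot => //; [right; right|exact: dn_mf hda]. Qed.

Let iJ x t : tau < t -> t - tau <= S -> mu.-integrable `]tau, t[ (EFin \o J x t).
Proof.
move=> tt tS; have [K K0 h] := pot_bounds01 S al0 lam0 lamrho A1 Kd0.
have c0 := ckn_gt0 lam0 lamrho.
have p20 : 0 < al / 2 by rewrite divr_gt0.
apply: (@integrable_le _ _ _ (fun s => K * gk c (x - xi) (t - tau) * (s - tau) `^ (al / 2 - 1))) => //.
- by apply: measurable_funTS; exact: mJ.
- move=> s; rewrite set_ooE => st; have [_ [e _ _] _ _] := h _ _ _ hv _ _ _ _ hd x t s st tS.
  by apply: (le_trans e); rewrite mulrAC.
- by apply: integrable_scale => //; have [] := integral_powR_left tt p20.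
Qed.

(* The second term is an average of [J] near the diagonal and tends to [f x t0]. *)
Lemma quotient_split (x t0 h : R) : h != 0 -> tau < t0 -> tau < t0 + h ->
  t0 - tau <= S -> t0 + h - tau <= S ->
  h^-1 * (vpot h0 v f tau x (t0 + h) - vpot h0 v f tau x t0) =
  \int[mu]_(s in `]tau, Num.min t0 (t0 + h)[) (h^-1 * (J x (t0 + h) s - J x t0 s)) +
  (Num.max t0 (t0 + h) - Num.min t0 (t0 + h))^-1 *
    \int[mu]_(s in `]Num.min t0 (t0 + h), Num.max t0 (t0 + h)[) J x (Num.max t0 (t0 + h)) s.
Proof.
move=> hn0 tt tth tS thS.
have sub (b m t : R) : tau < m -> m < b -> b = t \/ m = t -> tau < t -> t - tau <= S ->
    b - tau <= S -> mu.-integrable `]tau, m[ (EFin \o J x t).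
  move=> tm mb bt taut t1 b1; apply: integrableS (iJ x taut t1) => //.
  by apply: subset_itvl; rewrite bnd_simp; case: bt => [<-|<-]//; exact: ltW.
have zl (m : R) : mu.-integrable `]tau, m[ (EFin \o J x (t0 + h)) -> mu.-integrable `]tau, m[ (EFin \o J x t0) ->
    \int[mu]_(s in `]tau, m[) (h^-1 * (J x (t0 + h) s - J x t0 s)) =
    h^-1 * (\int[mu]_(s in `]tau, m[) J x (t0 + h) s - \int[mu]_(s in `]tau, m[) J x t0 s).
  exact: Rintegral_scaleB.
have [h0|h0] : 0 < h \/ h < 0 by move: hn0; rewrite neq_lt => /orP[]; [right|left].
  have th : t0 < t0 + h by lra.
  rewrite min_l ?(ltW th)// max_r ?(ltW th)//.
  rewrite (_ : t0 + h - t0 = h); last by ring.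
  have i1 := @sub (t0 + h) t0 (t0 + h) tt th (or_introl erefl) tth thS thS.
  have i2 := @sub (t0 + h) t0 t0 tt th (or_intror erefl) tt tS thS.
  rewrite !vpotE (Rintegral_split tt th (iJ x tth thS)).
  by rewrite (zl _ i1 i2) addrAC mulrDr.
have th : t0 + h < t0 by lra.
rewrite min_r ?(ltW th)// max_l ?(ltW th)//.
rewrite (_ : t0 - (t0 + h) = - h); last by ring.
have i1 := @sub t0 (t0 + h) (t0 + h) tth th (or_intror erefl) tth thS tS.
have i2 := @sub t0 (t0 + h) t0 tth th (or_introl erefl) tt tS tS.
rewrite !vpotE (Rintegral_split tth th (iJ x tt tS)).
by rewrite (zl _ i1 i2) invrN mulNr -mulrBr opprD addrA.
Qed.

(** The term [f x t0] comes from the upper limit of integration, as a limit of averages of slices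
    near the diagonal; the other is the integral of the derivatives of the slices, the quotients
    being dominated by means of [pot_lipschitz]. *)
Lemma is_derive_vpot_t (x t0 : R) : tau < t0 -> t0 - tau < S -> {for t0, continuous (f x)} ->
  is_derive t0 1 (fun t => vpot h0 v f tau x t) (f x t0 + vpot hxx v (fun y s => ca v y s * f y s) tau x t0).
Proof.
move=> tt tS fc; pose d := (t0 - tau) / 2; have d0 : 0 < d by rewrite /d; lra.
have [a0 a1] : 0 < al /\ al <= 1 by [].
have [[p21 p20] [p41 p40]] : (al / 2 <= 1 /\ 0 < al / 2) /\ (al / 4 <= 1 /\ 0 < al / 4).
  by split; split; lra.
have [K1 K10 hK1] := pot_h0_near al0 al1 lam0 lamrho A1 Kd0 hv hd d0.
have [K2 K20 hK2] := pot_lipschitz d0.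
have [K3 K30 hK3] := pot_time_bound d0.
have K230 : 0 <= K2 + K3 by exact: addr_ge0.
(* Increments below [e0] keep [t0 + h] inside [[tau + d, tau + S]], where the constants are
   valid. *)
pose e0 := Num.min d (S - (t0 - tau)).
have e00 : 0 < e0 by rewrite lt_min d0; lra.
have e0P (h : R) : `|h| < e0 -> tau + d <= t0 + h /\ t0 + h - tau <= S.
  by rewrite lt_min !ltr_norml /d; lra.
have dt0 : tau + d <= t0 by rewrite /d; lra.
have tS' : t0 - tau <= S by exact: ltW.
apply: (is_derive_seq e00) => h hn h_0.
pose m n := Num.min t0 (t0 + h n); pose b n := Num.max t0 (t0 + h n).
have cth : t0 + h n @[n --> \oo] --> t0.
  by rewrite -[X in _ --> X]addr0; apply: cvgD => //; exact: cvg_cst.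
have hm n : [/\ tau + d <= m n, m n <= t0, m n <= t0 + h n & m n < b n].
  have [hn0 hne] := hn n; have [q1 q2] := e0P _ hne.
  rewrite /m /b !ge_min !lexx orbT le_min q1 dt0; split => //.
  have [h_gt|h_le] := ltP 0 (h n); first by rewrite min_l ?max_r; lra.
  have h_lt : h n < 0 by rewrite lt_neqAle hn0.
  by rewrite min_r ?max_l; lra.
have hb n : [/\ b n - tau <= S, b n - m n = `|h n|, `|m n - t0| <= `|h n| & `|b n - t0| <= `|h n|].
  have [hn0 hne] := hn n; have [q1 q2] := e0P _ hne.
  have eh : t0 + h n - t0 = h n by ring.
  have eh' : t0 - (t0 + h n) = - h n by ring.
  rewrite /m /b; have [h_ge|h_lt] := leP 0 (h n).
    have le1 : t0 <= t0 + h n by lra.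
    rewrite (min_l le1) (max_r le1) subrr normr0 eh ger0_norm//; split => //; lra.
  have le1 : t0 + h n <= t0 by lra.
  rewrite (min_r le1) (max_l le1) subrr normr0 eh eh' ltr0_norm//; split => //; lra.
have hsmall (e : R) : 0 < e -> \forall n \near \oo, `|h n| < e.
  move=> ep; have hx := (cvgrPdist_lt _ _).1 h_0 _ ep.
  near=> n; rewrite -normrN -[- _]sub0r; near: n; exact: hx.
rewrite (_ : (fun n => _) = (fun n => \int[mu]_(s in `]tau, m n[) ((h n)^-1 * (J x (t0 + h n) s - J x t0 s)) +
  (b n - m n)^-1 * \int[mu]_(s in `]m n, b n[) J x (b n) s)); last first.
  apply/funext => n; have [hn0 hne] := hn n; have [q1 q2] := e0P _ hne.
  by rewrite quotient_split//; lra.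
rewrite addrC; apply: cvgD.
- apply: (@cvg_Rintegral_moving R (K2 + K3) (K2 + K3) (al/4) (al/2) tau K230 K230 p40 p20 p21
    (fun n s => (h n)^-1 * (J x (t0 + h n) s - J x t0 s)) (J' x t0) m t0) => //.
  + by move=> n; have [? _ _ _] := hm n; lra.
  + apply/cvgrPdist_le => e ep; near=> n; have hne : `|h n| < e by near: n; exact: hsmall.
    by have [_ _ h1 _] := hb n; rewrite distrC; exact: le_trans h1 (ltW hne).
  + by move=> n; apply: measurable_funM => //; apply: measurable_funB.
  + move=> n s sm; have [m1 m2 m3 _] := hm n; have [hn0 hne] := hn n; have [q1 q2] := e0P _ hne.
    have := hK2 x (m n) (t0 + h n) t0 s m1 m3 m2 q2 tS' sm.
    rewrite (_ : t0 + h n - t0 = h n); last by ring.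
    have hp : 0 < `|h n| by rewrite normr_gt0.
    move=> hq; rewrite normrM normfV [leLHS]mulrC ler_pdivrMr//; apply: (le_trans hq).
    rewrite ler_wpM2r// /endpoint_bound.
    by apply: lerD; apply: ler_wpM2r; rewrite ?powR_ge0//; lra.
  + move=> s st; have := hK3 x t0 t0 s dt0 (lexx _) tS' st => hq; apply: (le_trans hq).
    rewrite /endpoint_bound.
    by apply: lerD; apply: ler_wpM2r; rewrite ?powR_ge0//; lra.
  + move=> s st; have sS : s - tau <= S by lra.
    apply: (@is_derive_cvg_seq R (fun t => J x t s)) => //.
      exact: (is_derive_pot_t al0 lam0 lamrho A1 hv hd).
    by move=> n; have [] := hn n.
- apply/cvgrPdist_le => e ep.
  have e20 : 0 < e / 2 by lra.
  have K11 : 0 < 4 * (K1 + 1) by lra.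
  have e40 : 0 < e / (4 * (K1 + 1)) by rewrite divr_gt0.
  have [d1 d10 hd1] := powR_small p40 e40; have [d2 d20 hd2] := powR_small p20 e40.
  have [d3 /= d30 hd3] := (cvgrPdist_le _ _).1 fc _ e20.
  near=> n.
  have h1 : `|h n| <= d1 by apply: ltW; near: n; exact: hsmall.
  have h2 : `|h n| <= d2 by apply: ltW; near: n; exact: hsmall.
  have h3 : `|h n| < d3 by near: n; exact: hsmall.
  have [m1 m2 m3 m4] := hm n; have [b1 b2 b3 b4] := hb n.
  rewrite distrC; apply: average_bound => // s sm.
  have st0 : `|t0 - s| <= `|h n| by move: b3 b4; rewrite !ler_norml; lra.
  have hf : `|f x t0 - f x s| <= e / 2 by apply: hd3; exact: le_lt_trans st0 h3.
  have sd : tau + d <= s by lra.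
  have sb : s < b n by lra.
  have := hK1 x s (b n) sd sb b1.
  have bs : 0 <= b n - s <= `|h n| by lra.
  have q1 : (b n - s) `^ (al / 4) <= e / (4 * (K1 + 1)) by apply: hd1; lra.
  have q2 : (b n - s) `^ (al / 2) <= e / (4 * (K1 + 1)) by apply: hd2; lra.
  have q3 : K1 * ((b n - s) `^ (al / 4) + (b n - s) `^ (al / 2)) <= e / 2.
    apply: (@le_trans _ _ ((K1 + 1) * (e / (4 * (K1 + 1)) + e / (4 * (K1 + 1))))).
      by apply: ler_pM => //; [rewrite addr_ge0 ?powR_ge0|lra|exact: lerD].
    by rewrite le_eqVlt; apply/orP; left; apply/eqP; field; lra.
  move=> q4; have q5 := le_trans q4 q3.
  rewrite (_ : _ - _ = (J x (b n) s - f x s) - (f x t0 - f x s)); last by ring.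
  by apply: (le_trans (ler_normB _ _)); rewrite /J; lra.
Unshelve. all: by end_near. Qed.

End time_derivative.

(** * The fundamental solution *)

Section fundamental_solution.
Context {R : realType}.
Let mu := @lebesgue_measure R.
Variables (al lam rho A S : R).
Hypotheses (al0 : 0 < al) (al1 : al <= 1) (lam0 : 0 < lam) (lamrho : lam <= rho)
  (A1 : 1 <= A) (S1 : 1 <= S).
Let c := ckn rho.
Let k0 := (4 * rho)^-1.
Let k1 := (4 * lam)^-1.
Let k00 : 0 < k0 := k0_gt0 lam0 lamrho.
Let k01 : k0 <= k1 := k0_le_k1 lam0 lamrho.

Definition Gamma_x (ker : R -> R -> R -> R) (v : coeffs R) (x t xi tau : R) :=
  ker (kap v xi tau) (x - xi) (t - tau) +
  vpot ker v (fun y s => parametrix_phi v y s xi tau) tau x t.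

(** The expected time derivative: each time derivative of a kernel has become [a] times its second
    space derivative, [a] being taken at the source point, and the bare [parametrix_phi] is the
    contribution of the upper limit of integration. *)
Definition Gamma_t (v : coeffs R) (x t xi tau : R) :=
  ca v xi tau * hxx (kap v xi tau) (x - xi) (t - tau) + (parametrix_phi v x t xi tau +
  vpot hxx v (fun y s => ca v y s * parametrix_phi v y s xi tau) tau x t).

Lemma Gamma_bounds : exists2 K : R, 0 < K & forall N v w, coef_pair al lam rho A N v w ->
  forall x t xi tau : R, tau < t -> t - tau <= S ->
  [/\ pb N (K * gk c (x - xi) (t - tau)) (Gamma_x h0 v x t xi tau) (Gamma_x h0 w x t xi tau),
      pb N (K * (t - tau) `^ (- (1/2)) * gk c (x - xi) (t - tau))
        (Gamma_x hx v x t xi tau) (Gamma_x hx w x t xi tau),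
      pb N (K * (t - tau)^-1 * gk c (x - xi) (t - tau))
        (Gamma_x hxx v x t xi tau) (Gamma_x hxx w x t xi tau) &
      pb N (K * (t - tau)^-1 * gk c (x - xi) (t - tau))
        (Gamma_t v x t xi tau) (Gamma_t w x t xi tau)].
Proof.
have k00p := k00; have a0 := al0; have a1 := al1; have A1p := A1; have S1p := S1.
have A0 : 0 < A by lra.
have S0 : 0 < S by lra.
have [M M0 hM] := kap_pairs al lam0 lamrho A1.
have [C C0 hC] := ker_bounds k00 k01 M0.
have [Kd Kd0 hKd] := phi_density al0 al1 lam0 lamrho A1 S1.
have [K1 K10 hK1] := vpot_bounds al0 al1 lam0 lamrho A1 S1 Kd0.
have ck : c <= k0 / 2 by rewrite /c /ckn -/k0; lra.
have AC0 : 0 < A * C by rewrite mulr_gt0.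
have KS0 : 0 < Kd * S by rewrite mulr_gt0.
have [e1 e2 e3] : [/\ C + K1 <= C + 2 * (A * C) + Kd * S + K1, 2 * (A * C) + (Kd * S + K1) <= C + 2 * (A * C) + Kd * S + K1 & 0 < C + 2 * (A * C) + Kd * S + K1].
  by split; lra.
exists (C + 2 * (A * C) + Kd * S + K1) => // N v w h x t xi tau tt tS.
move: (C + 2 * (A * C) + Kd * S + K1) e1 e2 e3 => K e1 e2 e3.
have N0 := cp_N h.
have u0 : 0 < t - tau by lra.
have [hk _] := hM _ _ _ h; have [d1 d2] := hKd _ _ _ h xi tau.
have [b0 b1 b2 _] := hC _ _ _ (x - xi) _ (hk xi tau) u0.
have [p0 p1 p2] := hK1 _ _ _ h _ _ _ _ d1 x t tt tS.
have [_ _ p3] := hK1 _ _ _ h _ _ _ _ d2 x t tt tS.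
have pf := dn_bound d1 x tt tS.
rewrite isp_powR// in b1; rewrite sqr_isp// in b2.
have gg := gk_le (x - xi) u0 ck.
have G0 := gk_ge0 c (x - xi) (t - tau).
have P0 := powR_ge0 (t - tau) (- (1/2)).
have ti0 : 0 < (t - tau)^-1 by rewrite invr_gt0.
have b0' : pb N (C * gk c (x - xi) (t - tau)) (h0 (kap v xi tau) (x - xi) (t - tau)) (h0 (kap w xi tau) (x - xi) (t - tau)).
  by apply: pb_le b0 => //; rewrite ler_wpM2l// ltW.
have b1' : pb N (C * (t - tau) `^ (- (1/2)) * gk c (x - xi) (t - tau)) (hx (kap v xi tau) (x - xi) (t - tau)) (hx (kap w xi tau) (x - xi) (t - tau)).
  by apply: pb_le b1 => //; rewrite ler_wpM2l//; nonneg.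
have b2' : pb N (C * (t - tau)^-1 * gk c (x - xi) (t - tau)) (hxx (kap v xi tau) (x - xi) (t - tau)) (hxx (kap w xi tau) (x - xi) (t - tau)).
  by apply: pb_le b2 => //; rewrite ler_wpM2l//; nonneg.
split.
- apply: pb_le (pbD b0' p0) => //; rewrite -mulrDl ler_wpM2r//.
- apply: pb_le (pbD b1' p1) => //; rewrite -mulrDl -mulrDl ler_wpM2r// ler_wpM2r//.
- apply: pb_le (pbD b2' p2) => //; rewrite -mulrDl -mulrDl ler_wpM2r// ler_wpM2r// ltW//.
- apply: pb_le (pbD (pbM N0 (cp_a h xi tau) b2') (pbD pf p3)) => //.
  have ht : tw al (t - tau) <= S * (t - tau)^-1.
    by rewrite /tw -(powR_inv1 (ltW u0)); apply: powR_ratio_le => //; lra.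
  apply: (@le_trans _ _ ((2 * (A * C) + (Kd * S + K1)) * (t - tau)^-1 * gk c (x - xi) (t - tau))).
    rewrite [leRHS](_ : _ = 2 * A * (C * (t - tau)^-1 * gk c (x - xi) (t - tau)) +
      (Kd * (S * (t - tau)^-1) * gk c (x - xi) (t - tau) + K1 * (t - tau)^-1 * gk c (x - xi) (t - tau))); last by ring.
    by rewrite lerD2l lerD2r ler_wpM2r// ler_wpM2l// ltW.
  by rewrite ler_wpM2r// ler_wpM2r// ltW.
Qed.

Variable v : coeffs R.
Hypothesis hv : coef_pair al lam rho A 0 v v.
Let v0 := cp_ca_gt0 lam0 hv.

Lemma GammaE x t xi tau : tau < t -> Gamma v x t xi tau = Gamma_x h0 v x t xi tau.
Proof.
move=> tt.
have E : spacetime_conv (parametrixZ v) (parametrix_phi v) x t xi tau =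
    vpot h0 v (fun y s => parametrix_phi v y s xi tau) tau x t.
  apply: eq_Rintegral => s; rewrite inE set_ooE => /andP[_ st].
  by apply: eq_Rintegral => y _; rewrite (Z_h0 x _ st)//; exact: v0.
have Z := @Z_h0 R v x t xi tau (v0 xi tau) tt.
by rewrite /Gamma /Gamma_x E Z.
Qed.

Lemma is_derive_Gamma_x (ker ker' : R -> R -> R -> R) (x t xi tau : R) :
  (ker = h0 /\ ker' = hx) \/ (ker = hx /\ ker' = hxx) -> tau < t -> t - tau <= S ->
  is_derive x 1 (fun x => Gamma_x ker v x t xi tau) (Gamma_x ker' v x t xi tau).
Proof.
move=> kk tt tS; have [Kd Kd0 hKd] := phi_density al0 al1 lam0 lamrho A1 S1.
have [d1 _] := hKd _ _ _ hv xi tau.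
have kp := kap_gt0 lam0 hv xi tau.
apply: derD; last exact: (is_derive_vpot_x al0 al1 lam0 lamrho A1 S1 Kd0 hv d1).
have D : is_derive (x - xi) 1 (fun z => ker (kap v xi tau) z (t - tau)) (ker' (kap v xi tau) (x - xi) (t - tau)).
  by case: kk => [[-> ->]|[-> ->]]; [exact: der_h0|exact: der_hx].
have := @is_derive1_comp R _ (fun x => x - xi) x _ _ D (is_derive_shift xi x).
by rewrite mulr1.
Qed.

Lemma derive1_Gamma x t xi tau : tau < t -> t - tau <= S ->
  derive1n 1 (fun z => Gamma v z t xi tau) x = Gamma_x hx v x t xi tau /\
  derive1n 2 (fun z => Gamma v z t xi tau) x = Gamma_x hxx v x t xi tau.
Proof.
move=> tt tS.
have -> : (fun z => Gamma v z t xi tau) = (fun z => Gamma_x h0 v z t xi tau).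
  by apply/funext => z; exact: GammaE.
have E1 : derive1 (fun z => Gamma_x h0 v z t xi tau) = (fun z => Gamma_x hx v z t xi tau).
  apply/funext => z; rewrite derive1E.
  by have [_ ->] := @is_derive_Gamma_x h0 hx z t xi tau (or_introl (conj erefl erefl)) tt tS.
split; first by rewrite derive1n1 E1.
rewrite derive1nS derive1n1 E1 derive1E.
by have [_ ->] := @is_derive_Gamma_x hx hxx x t xi tau (or_intror (conj erefl erefl)) tt tS.
Qed.

Lemma continuous_phi_time (x t xi tau : R) : tau < t -> t - tau < S ->
  {for t, continuous (fun t => parametrix_phi v x t xi tau)}.
Proof.
move=> tt tS; apply/continuous_withinNx/cvgr_dnbhsP => tn [_ cvt].
pose d := (t - tau) / 2; have d0 : 0 < d by rewrite /d; lra.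
pose e := Num.min d (S - (t - tau)); have e0 : 0 < e by rewrite lt_min d0; lra.
have [k _ hk] := (cvgrPdist_lt _ _).1 cvt _ e0.
rewrite -(cvg_shiftn k).
apply: (@cvg_phi_time R al lam rho A S al0 al1 lam0 lamrho A1 S1 v hv x t xi tau d (fun n => tn (n + k)%N)) => //.
- move=> n; have := hk (n + k)%N (leq_addl _ _); rewrite /= lt_min !ltr_norml /d.
  by move=> /andP[h1 h2]; split; lra.
- by rewrite /d; lra.
- exact: ltW.
- by rewrite (cvg_shiftn k tn).
Qed.

Lemma is_derive_Gamma_t (x t xi tau : R) : tau < t -> t - tau < S ->
  is_derive t 1 (fun t => Gamma v x t xi tau) (Gamma_t v x t xi tau).
Proof.
move=> tt tS; have [Kd Kd0 hKd] := phi_density al0 al1 lam0 lamrho A1 S1.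
have [d1 d2] := hKd _ _ _ hv xi tau.
have kp := kap_gt0 lam0 hv xi tau.
have u0 : 0 < t - tau by lra.
have D1 : is_derive t 1 (fun t => h0 (kap v xi tau) (x - xi) (t - tau))
    (ca v xi tau * hxx (kap v xi tau) (x - xi) (t - tau)).
  have := @is_derive1_comp R _ (fun r => r - tau) t _ _ (der_h0_s (x - xi) kp u0) (is_derive_shift tau t).
  have E : (4 * kap v xi tau)^-1 = ca v xi tau.
    by have h := v0 xi tau; rewrite /kap; field; rewrite gt_eqF.
  by rewrite mulr1 E.
have D2 := is_derive_vpot_t al0 al1 lam0 lamrho A1 S1 Kd0 hv d1 d2 tt tS (continuous_phi_time tt tS).
apply: is_derive_near (derD D1 (D2 x)).
near=> r; rewrite GammaE//; near: r; exact: lt_nbhsr.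
Unshelve. all: by end_near. Qed.

End fundamental_solution.

(** * Hoelder norms and derivatives relative to the strip *)

Section hoelder_norms.
Context {R : realType}.
Variables (T al : R).
Hypotheses (T0 : 0 < T) (al0 : 0 < al).

Lemma stripE (x t : R) : strip T (x, t) <-> 0 <= t <= T.
Proof. by rewrite /strip; split => [[_]|h]; rewrite ?/= ?in_itv//; split. Qed.

Lemma hd_gt0 (x y t s : R) : (x, t) <> (y, s) -> 0 < hd al x y t s.
Proof.
move=> ne; rewrite lt0r hd_ge0 andbT; apply/eqP => /eqP.
rewrite paddr_eq0 ?powR_ge0// => /andP[/eqP/powR_eq0_eq0/eqP + /eqP/powR_eq0_eq0/eqP].
by rewrite !normr_eq0 !subr_eq0 => /eqP e1 /eqP e2; apply: ne; rewrite e1 e2.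
Qed.

(** The norm is a sum of two suprema in the extended reals. Both are nonnegative, as witnessed by
    the points [(0, 0)] and [(1, 0)] of the strip, so each is at most the sum. *)
Lemma holder_norm_bound (u : R -> R -> R) (B : R) : (holder_norm T al u <= B%:E)%E ->
  (forall x t : R, 0 <= t <= T -> `|u x t| <= B) /\
  (forall x y t s : R, 0 <= t <= T -> 0 <= s <= T -> `|u x t - u y s| <= B * hd al x y t s).
Proof.
rewrite /holder_norm; set s1 := ereal_sup _; set s2 := ereal_sup _ => hB.
have T00 (x : R) : strip T (x, 0) by apply/stripE; rewrite lexx ltW.
have s1P x t : 0 <= t <= T -> (`|u x t|%:E <= s1)%E.
  by move=> tT; apply: ereal_sup_ubound; exists (x, t) => //; apply/stripE.
have s2P : forall x y t s : R, 0 <= t <= T -> 0 <= s <= T -> (x, t) <> (y, s) ->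
    ((`|u x t - u y s| / hd al x y t s)%:E <= s2)%E.
  by move=> x y t s tT sT ne; apply: ereal_sup_ubound; exists ((x, t), (y, s)) => //.
have z0 : 0 <= (0 : R) <= T by rewrite lexx ltW.
have s10 : (0 <= s1)%E by apply: le_trans (s1P 0 0 z0); rewrite lee_fin.
have s20 : (0 <= s2)%E.
  have ne : (0, 0) <> (1, 0) :> R * R by case=> /eqP; rewrite eq_sym oner_eq0.
  by apply: le_trans (s2P 0 1 0 0 z0 z0 ne); rewrite lee_fin divr_ge0// hd_ge0.
have s1B : (s1 <= B%:E)%E by apply: le_trans hB; rewrite leeDl.
have s2B : (s2 <= B%:E)%E by apply: le_trans hB; rewrite leeDr.
split=> [x t tT|x y t s tT sT]; first by rewrite -lee_fin (le_trans (s1P _ _ tT)).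
have [[-> ->]|/eqP ne] := eqVneq (x, t) (y, s).
  by rewrite subrr normr0 mulr_ge0 ?hd_ge0// -lee_fin (le_trans s10).
rewrite -ler_pdivrMr ?hd_gt0// -lee_fin.
exact: le_trans (s2P _ _ _ _ tT sT ne) s2B.
Qed.

Lemma holder_norm_le (u : R -> R -> R) (B1 B2 : R) :
  (forall x t : R, 0 <= t <= T -> `|u x t| <= B1) ->
  (forall x y t s : R, 0 <= t <= T -> 0 <= s <= T -> `|u x t - u y s| <= B2 * hd al x y t s) ->
  (holder_norm T al u <= (B1 + B2)%:E)%E.
Proof.
move=> h1 h2; rewrite EFinD; apply: leeD; apply: ge_ereal_sup.
  by move=> _ [[x t] /stripE tT <-]; rewrite lee_fin; exact: h1.
move=> _ [[[x t] [y s]] [/stripE tT /stripE sT ne] <-].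
by rewrite lee_fin ler_pdivrMr; [exact: h2|exact: hd_gt0].
Qed.

(** [f] agrees on [[0, T]] with a function [F] differentiable on both sides of [t]. The limit within
    the interval is that of [F], and it is unique because points of the interval accumulate at [t]
    from the left, even for [t = T]. *)
Lemma derive_in_itv (f F : R -> R) (t L : R) : 0 < t <= T ->
  (forall s, 0 <= s <= T -> f s = F s) -> is_derive t 1 F L -> derive_in `[0, T] f t = L.
Proof.
move=> tT fF dF.
have cF : (F s - F t) / (s - t) @[s --> t^'] --> L.
  apply/cvgr_dnbhsP => u [un cu].
  have h0 : u n - t @[n --> \oo] --> (0 : R).
    by rewrite -(subrr t); apply: cvgB => //; exact: cvg_cst.
  have hn n : u n - t != 0 by rewrite subr_eq0.
  have := is_derive_cvg_seq dF hn h0.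
  by under eq_fun do rewrite (addrC t) subrK mulrC.
have PF : ProperFilter (within `[0, T] t^').
  apply: Build_ProperFilter_ex => P [e /= e0 he].
  pose s := t - Num.min (e / 2) (t / 2).
  have [s1 s2] : 0 < t - s <= t / 2 /\ t - s < e.
    rewrite /s opprB addrC subrK; split; last by rewrite gt_min; lra.
    by rewrite lt_min ge_min lexx orbT; lra.
  exists s; apply: he => /=; rewrite ?in_itv/=; [|lra|lra].
  by rewrite gtr0_norm; lra.
apply: cvg_lim => //.
have cW : (F s - F t) / (s - t) @[s --> within `[0, T] t^'] --> L.
  exact: cvg_within_filter cF.
apply: cvg_trans cW; apply: near_eq_cvg.
near=> s; rewrite fF ?fF//; first lra.
by have : `[0, T]%classic s by near: s; exact: withinT.
Unshelve. all: by end_near. Qed.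

End hoelder_norms.

(** * Extension of the coefficients to all times *)

Section clamp.
Context {R : realType}.
Variables (T al lam rho : R).
Hypotheses (T0 : 0 < T) (al0 : 0 < al).

Definition clamp (t : R) : R := Num.min (Num.max t 0) T.

Lemma clamp_itv t : 0 <= clamp t <= T.
Proof. by rewrite /clamp le_min le_max lexx orbT (ltW T0) ge_min lexx orbT. Qed.

Lemma clamp_id t : 0 <= t <= T -> clamp t = t.
Proof. by move=> /andP[t0 tT]; rewrite /clamp max_l// min_l. Qed.

Lemma clamp_dist t s : `|clamp t - clamp s| <= `|t - s|.
Proof.
have T0' := T0.
have [a1 [a2 a3]] : t - s <= `|t - s| /\ s - t <= `|t - s| /\ 0 <= `|t - s|.
  by split; [exact: ler_norm|split => //; rewrite distrC; exact: ler_norm].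
have clE (r : R) : clamp r = if r <= 0 then 0 else if r <= T then r else T.
  rewrite /clamp; have [r0|r0] := leP r 0; first by rewrite min_l ?ltW.
  by case: leP.
rewrite !clE ler_norml; move: (`|t - s|) a1 a2 a3 => d a1 a2 a3.
by case: (leP t 0) => t0; case: (leP s 0) => s0; try case: (leP t T) => tT; try case: (leP s T) => sT; lra.
Qed.

(* Agrees with [v] on the strip, and satisfies the same Hoelder bounds at all times. *)
Definition clamp_time (v : coeffs R) :=
  Coeffs (fun x t => ca v x (clamp t)) (fun x t => cb v x (clamp t)) (fun x t => cc v x (clamp t)).

Lemma hd_clamp x y t s : hd al x y (clamp t) (clamp s) <= hd al x y t s.
Proof.
rewrite /hd lerD2l; apply: ge0_ler_powR; rewrite ?nnegrE ?normr_ge0 ?clamp_dist//.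
by rewrite divr_ge0 ?ltW.
Qed.

(** Since [N] is the [fine] of an extended real, finiteness must be shown: norms of differences are
    at most [4 * rho], and [-oo] is excluded. The constant is [rho + 1] because [N * A] has to
    dominate [N]. *)
Lemma coef_pair_clamp v w : 0 < rho -> admissible T rho lam al v -> admissible T rho lam al w ->
  coef_pair al lam rho (rho + 1) (fine (coeffs_norm T al (coeffs_sub v w)))
    (clamp_time v) (clamp_time w).
Proof.
move=> rho0 [va vb vc vl] [wa wb wc wl].
have [va1 va2] := holder_norm_bound T0 (ltW va); have [vb1 vb2] := holder_norm_bound T0 (ltW vb).
have [vc1 vc2] := holder_norm_bound T0 (ltW vc); have [wa1 wa2] := holder_norm_bound T0 (ltW wa).
have [wb1 wb2] := holder_norm_bound T0 (ltW wb); have [wc1 wc2] := holder_norm_bound T0 (ltW wc).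
have dif (p q : R -> R -> R) :
    (forall x t : R, 0 <= t <= T -> `|p x t| <= rho) ->
    (forall x y t s : R, 0 <= t <= T -> 0 <= s <= T -> `|p x t - p y s| <= rho * hd al x y t s) ->
    (forall x t : R, 0 <= t <= T -> `|q x t| <= rho) ->
    (forall x y t s : R, 0 <= t <= T -> 0 <= s <= T -> `|q x t - q y s| <= rho * hd al x y t s) ->
    (holder_norm T al (fun x t => (p x t - q x t)%R) <= ((rho + rho) + (rho + rho))%:E)%E.
  move=> p1 p2 q1 q2; apply: holder_norm_le => //.
    by move=> x t tT; apply: (le_trans (ler_normB _ _)); apply: lerD; auto.
  move=> x y t s tT sT; rewrite (_ : _ - _ = (p x t - p y s) - (q x t - q y s)); last by ring.
  by apply: (le_trans (ler_normB _ _)); rewrite mulrDl; apply: lerD; auto.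
set Nn := coeffs_norm _ _ _.
have NB : (Nn <= ((rho + rho) + (rho + rho))%:E)%E.
  by rewrite /Nn /coeffs_norm !ge_max/= !dif.
have hN (p : R -> R -> R) : (holder_norm T al p <= Nn)%E ->
  (forall x t : R, 0 <= t <= T -> `|p x t| <= fine Nn) /\
  (forall x y t s : R, 0 <= t <= T -> 0 <= s <= T -> `|p x t - p y s| <= fine Nn * hd al x y t s).
  move=> pN; apply: holder_norm_bound => //.
  rewrite fineK// fin_numE gt_eqF/=; last first.
    rewrite ltNge; apply/negP => Nu.
    (* A norm equal to [-oo] would bound [|p 0 0|] by [-1]. *)
    have hp : (holder_norm T al p <= (-1)%:E)%E by apply: (le_trans (le_trans pN Nu)); exact: leNye.
    have z0 : 0 <= (0 : R) <= T by rewrite lexx ltW.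
    by have := (holder_norm_bound T0 hp).1 0 0 z0; have := normr_ge0 (p 0 0); lra.
  by rewrite lt_eqF// (le_lt_trans NB) ?ltry.
have [na1 na2] := hN (fun x t => ca v x t - ca w x t) ltac:(by rewrite /Nn /coeffs_norm le_max lexx).
have [nb1 nb2] := hN (fun x t => cb v x t - cb w x t) ltac:(by rewrite /Nn /coeffs_norm !le_max lexx orbT).
have [nc1 nc2] := hN (fun x t => cc v x t - cc w x t) ltac:(by rewrite /Nn /coeffs_norm !le_max lexx !orbT).
have z0 : 0 <= (0 : R) <= T by rewrite lexx ltW.
have N0 : 0 <= fine Nn by apply: le_trans (na1 0 0 z0).
move: (fine Nn) na1 na2 nb1 nb2 nc1 nc2 N0 {hN NB} => N na1 na2 nb1 nb2 nc1 nc2 N0.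
have b1 (p q : R -> R -> R) x t :
    (forall x t : R, 0 <= t <= T -> `|p x t| <= rho) -> (forall x t : R, 0 <= t <= T -> `|q x t| <= rho) ->
    (forall x t : R, 0 <= t <= T -> `|p x t - q x t| <= N) ->
    pb N (rho + 1) (p x (clamp t)) (q x (clamp t)).
  move=> hp hq hpq; have ct := clamp_itv t; split.
  - by apply: (le_trans (hp _ _ ct)); rewrite lerDl.
  - by apply: (le_trans (hq _ _ ct)); rewrite lerDl.
  - by apply: (le_trans (hpq _ _ ct)); rewrite ler_peMr// lerDr ltW.
have b2 (p q : R -> R -> R) x y t s :
    (forall x y t s : R, 0 <= t <= T -> 0 <= s <= T -> `|p x t - p y s| <= rho * hd al x y t s) ->
    (forall x y t s : R, 0 <= t <= T -> 0 <= s <= T -> `|q x t - q y s| <= rho * hd al x y t s) ->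
    (forall x y t s : R, 0 <= t <= T -> 0 <= s <= T ->
       `|(p x t - q x t) - (p y s - q y s)| <= N * hd al x y t s) ->
    pb N ((rho + 1) * hd al x y t s) (p x (clamp t) - p y (clamp s)) (q x (clamp t) - q y (clamp s)).
  move=> hp hq hpq; have ct := clamp_itv t; have cs := clamp_itv s.
  have H0 := hd_ge0 al x y t s; have H1 := hd_clamp x y t s.
  have r1 : rho <= rho + 1 by rewrite lerDl.
  have r2 : N <= N * (rho + 1) by rewrite ler_peMr// lerDr ltW.
  split.
  - by apply: (le_trans (hp _ _ _ _ ct cs)); apply: ler_pM; rewrite ?hd_ge0 ?(ltW rho0).
  - by apply: (le_trans (hq _ _ _ _ ct cs)); apply: ler_pM; rewrite ?hd_ge0 ?(ltW rho0).
  - rewrite (_ : _ - _ = (p x (clamp t) - q x (clamp t)) - (p y (clamp s) - q y (clamp s))); last by ring.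
    by apply: (le_trans (hpq _ _ _ _ ct cs)); rewrite mulrA; apply: ler_pM; rewrite ?hd_ge0.
split => //.
- move=> x t; have ct := clamp_itv t; rewrite /= vl; last exact/stripE.
  exact: le_trans (ler_norm _) (va1 _ _ ct).
- move=> x t; have ct := clamp_itv t; rewrite /= wl; last exact/stripE.
  exact: le_trans (ler_norm _) (wa1 _ _ ct).
- by move=> x t; exact: b1.
- by move=> x t; exact: b1.
- by move=> x t; exact: b1.
- by move=> x y t s; exact: b2.
- by move=> x y t s; exact: b2.
- by move=> x y t s; exact: b2.
Qed.

End clamp.

Section clamped_coefficients.
Context {R : realType}.
Variables (T : R) (v : coeffs R).

Lemma parametrixZ_clamp (x t xi tau : R) : 0 <= tau <= T ->
  parametrixZ (clamp_time T v) x t xi tau = parametrixZ v x t xi tau.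
Proof. by move=> tT; rewrite /parametrixZ /= clamp_id. Qed.

Lemma LZ1_clamp (x t xi tau : R) : 0 <= t <= T -> 0 <= tau <= T ->
  LZ1 (clamp_time T v) x t xi tau = LZ1 v x t xi tau.
Proof.
move=> tT sT; rewrite /LZ1 /= !clamp_id// parametrixZ_clamp//.
rewrite (_ : (fun z => parametrixZ (clamp_time T v) z t xi tau) = (fun z => parametrixZ v z t xi tau))//.
by apply/funext => z; exact: parametrixZ_clamp.
Qed.

(** Between [tau] and [t] in [[0, T]] the iterated integrals read the coefficients only at times of
    [[0, T]], where clamping changes nothing. *)
Lemma LZ_clamp m (x t xi tau : R) : 0 <= t <= T -> 0 <= tau <= T ->
  LZ (clamp_time T v) m x t xi tau = LZ v m x t xi tau.
Proof.
elim: m x t => [|m IH] x t tT sT; first exact: LZ1_clamp.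
rewrite !LZ_S; apply: eq_Rintegral => s; rewrite inE set_ooE => st.
have sT' : 0 <= s <= T by lra.
by apply: eq_Rintegral => y _; rewrite LZ1_clamp// IH.
Qed.

Lemma phi_clamp (x t xi tau : R) : 0 <= t <= T -> 0 <= tau <= T ->
  parametrix_phi (clamp_time T v) x t xi tau = parametrix_phi v x t xi tau.
Proof.
move=> tT sT; rewrite !phiE; congr (limn (series _)).
by apply/funext => m; rewrite /phi_term LZ_clamp.
Qed.

Lemma Gamma_clamp (x t xi tau : R) : 0 <= t <= T -> 0 <= tau <= T ->
  Gamma v x t xi tau = Gamma (clamp_time T v) x t xi tau.
Proof.
move=> tT sT.
have E : spacetime_conv (parametrixZ v) (parametrix_phi v) x t xi tau =
    spacetime_conv (parametrixZ (clamp_time T v)) (parametrix_phi (clamp_time T v)) x t xi tau.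
  apply: eq_Rintegral => s; rewrite inE set_ooE => st.
  have sT' : 0 <= s <= T by lra.
  by apply: eq_Rintegral => y _; rewrite parametrixZ_clamp// phi_clamp.
have Z := parametrixZ_clamp x t xi sT.
by rewrite /Gamma E Z.
Qed.

End clamped_coefficients.

(** * Transfer to the original coefficients and conclusion *)

Section final_estimates.
Context {R : realType}.
Variables (T al lam rho : R) (v : coeffs R).
Hypotheses (T0 : 0 < T) (al0 : 0 < al) (al1 : al <= 1) (lam0 : 0 < lam) (lamrho : lam <= rho)
  (hv : coef_pair al lam rho (rho + 1) 0 (clamp_time T v) (clamp_time T v)).

Let S1 : 1 <= T + 1. Proof. by rewrite lerDr ltW. Qed.
Let A1 : 1 <= rho + 1. Proof. by rewrite lerDr (le_trans (ltW lam0)). Qed.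

Lemma DxGammaE (x t xi tau : R) : 0 <= t <= T -> 0 <= tau <= T -> tau < t ->
  [/\ DxGamma 0 v x t xi tau = Gamma_x h0 (clamp_time T v) x t xi tau,
      DxGamma 1 v x t xi tau = Gamma_x hx (clamp_time T v) x t xi tau,
      DxGamma 2 v x t xi tau = Gamma_x hxx (clamp_time T v) x t xi tau &
      DtGamma T v x t xi tau = Gamma_t (clamp_time T v) x t xi tau].
Proof.
move=> tT sT tt; rewrite /DxGamma /DtGamma.
(* Taking [S = T + 1] makes this inequality strict, so that the solution for the clamped
   coefficients is differentiable in time on both sides, at [t = T] included. *)
have tS : t - tau < T + 1 by lra.
have E : (fun z => Gamma v z t xi tau) = (fun z => Gamma (clamp_time T v) z t xi tau).
  by apply/funext => z; exact: Gamma_clamp.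
have [e1 e2] := derive1_Gamma al0 al1 lam0 lamrho A1 S1 hv x xi tt (ltW tS).
split.
- by rewrite E derive1n0; exact: (GammaE lam0 hv).
- by rewrite E; exact: e1.
- by rewrite E; exact: e2.
have t0 : 0 < t <= T by lra.
apply: (derive_in_itv t0 _ (is_derive_Gamma_t al0 al1 lam0 lamrho A1 S1 hv x xi tt tS)).
by move=> s sT'; exact: Gamma_clamp.
Qed.

End final_estimates.

Lemma gk_weight (R : realType) (C z u : R) : 0 < u ->
  gk C z u = (u `^ (1/2))^-1 * expR (- (C * (z ^+ 2 / u))).
Proof. by move=> u0; rewrite /gk -powRN; congr (_ `^ _ * _); lra. Qed.

(* Only the [(t - tau)^(-3/2)] term is used; the other one is nonnegative in \bar R even when
   [x = xi]. *)
Lemma le_second_order_bound (R : realType) (al beta gamma C K N x t xi tau y : R) :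
  0 <= K -> 0 <= N -> tau < t ->
  y <= N * (K * (t - tau)^-1 * gk C (x - xi) (t - tau)) ->
  (y%:E <= second_order_bound al beta gamma C K N x t xi tau)%E.
Proof.
move=> K0 N0 tt hy; have u0 : 0 < t - tau by lra.
pose E := expR (- (C * ((x - xi) ^+ 2 / (t - tau)))).
have P0 : 0 < (t - tau) `^ (3 / 2) by exact: powR_gt0.
have KN0 : 0 <= K * N by exact: mulr_ge0.
have e : N * (K * (t - tau)^-1 * gk C (x - xi) (t - tau)) = K * N * ((t - tau) `^ (3 / 2))^-1 * E.
  (* The exponent [-3/2] is [-1], the rate of the second derivatives, plus [-1/2] from the
     normalisation of [gk]. *)
  rewrite /gk -/E -powRN (_ : - (3 / 2) = - 1 + - 2^-1); last by lra.
  by rewrite powRDp// powR_inv1 ?(ltW u0)//; ring.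
rewrite /second_order_bound; rewrite e in hy.
have i0 : 0 <= ((t - tau) `^ (3 / 2))^-1 by rewrite invr_ge0 ltW.
apply: (@le_trans _ _ ((K * N)%:E * ((t - tau) `^ (3 / 2))^-1%:E * E%:E)%E); first by rewrite -!EFinM lee_fin.
apply: lee_pmul; rewrite ?lee_fin ?mulr_ge0 ?expR_ge0//.
apply: lee_pmul; rewrite ?lee_fin//.
  by rewrite ler_wpM2l// lerDl powR_ge0.
rewrite [X in (_ + X)%E]inver gt_eqF// leeDr// inve_ge0 lee_fin.
by rewrite mulr_ge0 ?powR_ge0.
Qed.

Unset Implicit Arguments.

Theorem lemma4 (R : realType) (T alpha lambda rho beta gamma : R)
    (T_gt0 : 0 < T)
    (alpha_gt0 : 0 < alpha) (alpha_le1 : alpha <= 1)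
    (lambda_gt0 : 0 < lambda) (lambda_lt_rho : lambda < rho)
    (beta_gt0 : 0 < beta) (beta_lt1 : beta < 1)
    (gamma_gt0 : 0 < gamma) (gamma_lt_alpha : gamma < alpha) :
  exists C K : R,
    [/\ 0 < C, C < 1 / (4 * rho), 0 < K &
      forall v w : coeffs R,
        admissible T rho lambda alpha v ->
        admissible T rho lambda alpha w ->
      forall x t xi tau : R,
        strip T (x, t) -> strip T (xi, tau) -> tau < t ->
      let N : R := fine (coeffs_norm T alpha (coeffs_sub v w)) in
      [/\ forall s : nat, (s <= 1)%N ->
            `|DxGamma s v x t xi tau - DxGamma s w x t xi tau|
            <= K * N / (t - tau) `^ (s.+1%:R / 2)
               * expR (- (C * ((x - xi) ^+ 2 / (t - tau)))),
          (`|DxGamma 2 v x t xi tau - DxGamma 2 w x t xi tau|%:E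
            <= second_order_bound alpha beta gamma C K N x t xi tau)%E
        & (`|DtGamma T v x t xi tau - DtGamma T w x t xi tau|%:E
            <= second_order_bound alpha beta gamma C K N x t xi tau)%E]].
Proof.
have lamrho := ltW lambda_lt_rho.
have rho0 : 0 < rho by lra.
have S1 : 1 <= T + 1 by lra.
have A1 : 1 <= rho + 1 by lra.
have [K K0 hK] := Gamma_bounds alpha_gt0 alpha_le1 lambda_gt0 lamrho A1 S1.
have c0 := ckn_gt0 lambda_gt0 lamrho.
(* [ckn rho] is [1 / (32 * rho)], the exponent in which all the Gaussian bounds have been
   expressed. *)
exists (ckn rho), K; split => //.
  by rewrite /ckn div1r ltr_pdivrMr// ltr_pMr ?invr_gt0 ?mulr_gt0//; lra.
move=> v w hv hw x t xi tau /stripE tT /stripE sT tt N.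
have h := coef_pair_clamp T_gt0 alpha_gt0 rho0 hv hw; rewrite -/N in h.
have N0 : 0 <= N := cp_N h.
have [tS u0] : t - tau <= T + 1 /\ 0 < t - tau by split; lra.
have [[_ _ b0] [_ _ b1] [_ _ b2] [_ _ b3]] := hK _ _ _ h x t xi tau tt tS.
have [v0 v1 v2 v3] := DxGammaE T_gt0 alpha_gt0 alpha_le1 lambda_gt0 lamrho (coef_pair_l h) x xi tT sT tt.
have [w0 w1 w2 w3] := DxGammaE T_gt0 alpha_gt0 alpha_le1 lambda_gt0 lamrho (coef_pair_r h) x xi tT sT tt.
split; last 2 first.
- by apply: le_second_order_bound (ltW K0) N0 tt _; rewrite v2 w2.
- by apply: le_second_order_bound (ltW K0) N0 tt _; rewrite v3 w3.
move=> [|[|//]] _.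
- rewrite v0 w0; apply: (le_trans b0); rewrite (gk_weight _ _ u0).
  have -> : (1%:R / 2 : R) = 1/2 by rewrite mulr1n.
  by rewrite le_eqVlt; apply/orP; left; apply/eqP; ring.
- rewrite v1 w1; apply: (le_trans b1).
  (* One half of the exponent [(s + 1) / 2 = 1] belongs to the normalisation of [gk], the other to
     the derivative in [x]. *)
  have -> : (2%:R / 2 : R) = 1/2 + 1/2 by rewrite -mulrDl.
  rewrite (gk_weight _ _ u0) (powRDp _ _ u0) invfM powRN.
  by rewrite le_eqVlt; apply/orP; left; apply/eqP; ring.
Qed.
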